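(* Let $B$ be a (strict) left $H$-module algebra for a coquasi-Hopf algebra $(H,\phi)$. Suppose that $\gamma:H\otimes H\to B$ is a unital convolution-invertible map of associative type, in the sense that $$\gamma(h_{(1)},g_{(1)})\big((h_{(2)}g_{(2)})\triangleright b\big)=\big((h_{(1)}g_{(1)})\triangleright b\big)\gamma(h_{(2)},g_{(2)})\qquad\text{for all }h,g\in H,\ b\in B.$$ Then $(B\otimes H\otimes B,\Phi^{\gamma})=(B\otimes H\otimes B,\Phi)^{\Gamma}$, where $\Gamma\in C^2(\mathcal{L},B)$, with $\mathcal{L}=(B\otimes H\otimes B,\Phi)$, is given by $$\Gamma(X,Y)=a(h_{(1)}\triangleright b)\,\gamma(h_{(2)},g)\,(h_{(3)}\triangleright b')a'$$ for any $X=a\otimes h\otimes a'$, $Y=b\otimes g\otimes b'\in B\otimes H\otimes B$. In particular, if $B$ is a left module algebra of $H$, and $\gamma$ is a $2$-cocycle of associative type, then $(B\otimes H\otimes B)^{\Gamma}$ is a left and anti-left Hopf algebroid.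
   Context: $k$ is a field, $B$ a unital associative $k$-algebra, $\overline{B}$ its opposite algebra with the antiisomorphism $b\mapsto\overline{b}$, and $B^e=B\otimes\overline{B}$. $B$ is a left $B^e$-module by $(b\overline{c})\cdot a=bac$. Sumless Sweedler notation is used for coproducts. Coquasi-bialgebra: a coalgebra $H$ over $k$ with a unital, not necessarily associative algebra structure whose product and unit are coalgebra morphisms, together with a convolution-invertible linear map $\phi:H\otimes H\otimes H\to k$ such that for all $h,g,f,l\in H$: (1) $\phi(h,1,g)=\varepsilon(hg)$; (2) $\phi(h_{(1)},g_{(1)},f_{(1)}l_{(1)})\phi(h_{(2)}g_{(2)},f_{(2)},l_{(2)})=\phi(g_{(1)},f_{(1)},l_{(1)})\phi(h_{(1)},g_{(2)}f_{(2)},l_{(2)})\phi(h_{(2)},g_{(3)},f_{(3)})$; (3) $\phi(h_{(1)},g_{(1)},f_{(1)})(h_{(2)}g_{(2)})f_{(2)}=h_{(1)}(g_{(1)}f_{(1)})\phi(h_{(2)},g_{(2)},f_{(2)})$. A coquasi-Hopf algebra is a coquasi-bialgebra with an antipode in the standard sense: a coalgebra antihomomorphism $S:H\to H$ and functionals $\mathsf a,\mathsf b:H\to k$ with $S(h_{(1)})h_{(3)}\mathsf a(h_{(2)})=\mathsf a(h)1$, $h_{(1)}S(h_{(3)})\mathsf b(h_{(2)})=\mathsf b(h)1$, $\phi(h_{(1)},S(h_{(3)}),h_{(5)})\mathsf b(h_{(2)})\mathsf a(h_{(4)})=\varepsilon(h)$, $\phi^{-1}(S(h_{(1)}),h_{(3)},S(h_{(5)}))\mathsf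 a(h_{(2)})\mathsf b(h_{(4)})=\varepsilon(h)$. $B$ is a (strict) left $H$-module algebra if there is a linear map $\triangleright:H\otimes B\to B$ with $h\triangleright(ab)=(h_{(1)}\triangleright a)(h_{(2)}\triangleright b)$, $h\triangleright1_B=\varepsilon(h)1_B$, $(hg)\triangleright b=h\triangleright(g\triangleright b)$ and $1_H\triangleright b=b$. $\gamma$ is unital if $\gamma(1,h)=\gamma(h,1)=\varepsilon(h)1_B$; $\gamma^{-1}$ is its convolution inverse. $\gamma$ is a $2$-cocycle if $(h_{(1)}\triangleright\gamma(g_{(1)},f_{(1)}))\gamma(h_{(2)},g_{(2)}f_{(2)})=\gamma(h_{(1)},g_{(1)})\gamma(h_{(2)}g_{(2)},f)$ for all $h,g,f\in H$. For $B^e$-bimodules $M,N$: $M\diamond_B N:=M\otimes N/\langle \overline{b}m\otimes n-m\otimes bn\rangle$, and the Takeuchi product $M\times_B N\subseteq M\diamond_B N$ consists of the elements $\sum_i m_i\otimes n_i$ with $\sum_i m_i\overline{b}\otimes n_i=\sum_i m_i\otimes n_i b$ for all $b\in B$; $B^e$ acts on it from the left by $b\overline{c}(m\otimes n)=bm\otimes\overline{c}n$. The triple product $M\times_B P\times_B N$ is defined analogously (balancing relations and invariance conditions between neighbouring factors). A left $B$-coalgebroid ($\times_B$-coalgebra) is a $B^e$-bimodule $\mathcal{L}$ with left $B^e$-module maps $\Delta:\mathcal{L}\to\mathcal{L}\times_B\mathcal{L}$, $\Delta(X)=X_{(1)}\otimes X_{(2)}$, and $\varepsilon:\mathcal{L}\to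 B$, such that $\Delta$ is coassociative (the two iterated coproducts agree in $\mathcal{L}\times_B\mathcal{L}\times_B\mathcal{L}$) and $\varepsilon(X_{(1)})X_{(2)}=X=\overline{\varepsilon(X_{(2)})}X_{(1)}$. A left $B$-coquasi-bialgebroid is a unital, not necessarily associative algebra $\mathcal{L}$ with algebra maps $s:B\to\mathcal{L}$, $t:\overline{B}\to\mathcal{L}$ with commuting images, which is also a left $B$-coalgebroid for the $B^e$-bimodule structure given by multiplication with $s,t$ (write $bX=s(b)X$, $\overline{b}X=t(b)X$, $Xb=Xs(b)$, $X\overline{b}=Xt(b)$), such that: (i) $\Delta:\mathcal{L}\to\mathcal{L}\times_B\mathcal{L}$ is an algebra map (factorwise product on the target). (ii) $\varepsilon(1)=1_B$ and $\varepsilon(X\varepsilon(Y))=\varepsilon(XY)=\varepsilon(X\overline{\varepsilon(Y)})$. (iii) There is a convolution-invertible $\Phi\in\mathrm{Hom}_{B^e-}(\mathcal{L}\otimes_{B^e}\mathcal{L}\otimes_{B^e}\mathcal{L},B)$ such that for all $X,Y,Z,W\in\mathcal{L}$, $b\in B$: (1) $\Phi(1,X,Y)=\Phi(X,1,Y)=\Phi(X,Y,1)=\varepsilon(XY)$; (2) $\Phi(X,Y,Zb)=\Phi(X,Y,Z\overline{b})$; (3) $\Phi(X_{(1)},Y_{(1)},Z_{(1)}W_{(1)})\Phi(X_{(2)}Y_{(2)},Z_{(2)},W_{(2)})=\Phi(X_{(1)},\Phi(Y_{(1)},Z_{(1)},W_{(1)})Y_{(2)}Z_{(2)},W_{(2)})\Phi(X_{(2)},Y_{(3)},Z_{(3)})$;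 (4) $\Phi(X_{(1)},Y_{(1)},Z_{(1)})\,(X_{(2)}Y_{(2)})Z_{(2)}=\overline{\Phi(X_{(2)},Y_{(2)},Z_{(2)})}\,X_{(1)}(Y_{(1)}Z_{(1)})$. Here $\mathrm{Hom}_{B^e-}$ denotes left $B^e$-linear maps; convolution is $(f\star g)(X,Y)=f(X_{(1)},Y_{(1)})g(X_{(2)},Y_{(2)})$ with unit $\varepsilon(XY)$, and similarly for three arguments with unit $\varepsilon(XYZ):=\varepsilon((XY)Z)=\varepsilon(X(YZ))$. A left bialgebroid is the case $\Phi(X,Y,Z)=\varepsilon(XYZ)$. A left bialgebroid $\mathcal{L}$ is a left Hopf algebroid if $\lambda:\mathcal{L}\otimes_{\overline{B}}\mathcal{L}\to\mathcal{L}\diamond_B\mathcal{L}$, $X\otimes Y\mapsto X_{(1)}\otimes X_{(2)}Y$, is invertible, where $\otimes_{\overline{B}}$ imposes $X\overline{b}\otimes Y=X\otimes\overline{b}Y$; it is an anti-left Hopf algebroid if $\mu:\mathcal{L}\otimes_B\mathcal{L}\to\mathcal{L}\diamond_B\mathcal{L}$, $X\otimes Y\mapsto X_{(1)}Y\otimes X_{(2)}$, is invertible, where $\otimes_B$ imposes $Xb\otimes Y=X\otimes bY$. $C^2(\mathcal{L},B)$ is the set of unital ($\Sigma(1,X)=\Sigma(X,1)=\varepsilon(X)$) convolution-invertible $\Sigma\in\mathrm{Hom}_{B^e-}(\mathcal{L}\otimes_{B^e}\mathcal{L},B)$ with $\Sigma(X,Y\overline{b})=\Sigma(X,Yb)$.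 For such $\Sigma$, $(\mathcal{L},\Phi)^\Sigma$ is the left $B$-coquasi-bialgebroid given by the $B$-coalgebroid $\mathcal{L}$ with product $X\cdot_\Sigma Y=\Sigma(X_{(1)},Y_{(1)})\overline{\Sigma^{-1}(X_{(3)},Y_{(3)})}X_{(2)}Y_{(2)}$ and $3$-cocycle $\Phi^\Sigma(X,Y,Z)=\Sigma(X_{(1)},\Sigma(Y_{(1)},Z_{(1)})Y_{(2)}Z_{(2)})\Phi(X_{(2)},Y_{(3)},Z_{(3)})\Sigma^{-1}(\overline{\Sigma^{-1}(X_{(4)},Y_{(5)})}X_{(3)}Y_{(4)},Z_{(4)})$. The left $B$-coquasi-bialgebroid $(B\otimes H\otimes B,\Phi^\gamma)$ has $s(b)=b\otimes1\otimes1$, $t(b)=1\otimes1\otimes b$, $\Delta(b\otimes h\otimes b')=(b\otimes h_{(1)}\otimes1)\otimes(1\otimes h_{(2)}\otimes b')$, $\varepsilon(b\otimes h\otimes b')=bb'\varepsilon(h)$, product $(a\otimes h\otimes a')(b\otimes g\otimes b')=a(h_{(1)}\triangleright b)\gamma(h_{(2)},g_{(1)})\otimes h_{(3)}g_{(2)}\otimes\gamma^{-1}(h_{(4)},g_{(3)})(h_{(5)}\triangleright b')a'$, and, for $X=a\otimes h\otimes a'$, $Y=b\otimes g\otimes b'$, $Z=c\otimes f\otimes c'$, $\Phi^{\gamma}(X,Y,Z)=a(h_{(1)}\triangleright b)(h_{(2)}\triangleright(g_{(1)}\triangleright c))(h_{(3)}\triangleright\gamma(g_{(2)},f_{(1)}))\gamma(h_{(4)},g_{(3)}f_{(2)})\phi(h_{(5)},g_{(4)},f_{(3)})\gamma^{-1}(h_{(6)}g_{(5)},f_{(4)})\gamma^{-1}(h_{(7)},g_{(6)})(h_{(8)}\triangleright(g_{(7)}\triangleright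 c'))(h_{(9)}\triangleright b')a'$. The left $B$-coquasi-bialgebroid $(B\otimes H\otimes B,\Phi)$ is the same with $\gamma$ replaced by the trivial map $h\otimes g\mapsto\varepsilon(hg)1_B$. $(B\otimes H\otimes B)^\Gamma$ denotes the twist $(B\otimes H\otimes B,\Phi)^\Gamma$.
   Formalization: In the ''in particular'' clause, H is an ordinary Hopf algebra (φ is the trivial cocycle), and the anti-left Hopf algebroid claim additionally assumes that the antipode of H is bijective; both fail otherwise, e.g. for B = k and γ trivial. *)

(* Defs.v *)
From HB Require Import structures.
From mathcomp Require Import all_boot all_algebra.
From mathcomp Require Import generic_quotient ring_quotient.
From mathcomp Require Import boolp.
From mathcomp Require Import freeg.

Set Implicit Arguments.
Unset Strict Implicit.
Unset Printing Implicit Defensive.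

Import GRing.Theory.
Local Open Scope ring_scope.
Local Open Scope quotient_scope.

Section Multilinear.
Variables (k : fieldType) (U V W X : lmodType k).

Definition bilin (f : U -> V -> W) : Prop :=
  (forall u, linear (f u)) /\ (forall v, linear (fun u => f u v)).

Definition trilin (f : U -> V -> W -> X) : Prop :=
  [/\ forall u v, linear (f u v),
      forall u w, linear (fun v => f u v w)
    & forall v w, linear (fun u => f u v w)].

End Multilinear.

(* Quotient of a k-module by the submodule generated by a set G. *)
Section QuotientModule.
Variables (k : fieldType) (V : lmodType k).

Definition is_submodule (P : V -> Prop) : Prop :=
  P 0 /\ forall (a : k) u v, P u -> P v -> P (a *: u + v).

Definition gen_submodule (G : V -> Prop) : V -> bool := fun v =>
  `[< forall P : V -> Prop,
        is_submodule P -> (forall g, G g -> P g) -> P v >].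

Variable G : V -> Prop.

Lemma gen_submodule_sub v : G v -> gen_submodule G v.
Proof. by move=> Gv; apply/asboolP => P _; apply. Qed.

Lemma gen_submodule_lin (a : k) u v :
  gen_submodule G u -> gen_submodule G v -> gen_submodule G (a *: u + v).
Proof.
move=> /asboolP Hu /asboolP Hv; apply/asboolP => P sP GP.
by apply: sP.2; [apply: Hu | apply: Hv].
Qed.

Lemma gen_submodule0 : gen_submodule G 0.
Proof. by apply/asboolP => P [P0]. Qed.

Lemma gen_submodule_zmod : zmod_closed (gen_submodule G : {pred V}).
Proof.
split=> [|u v Gu Gv]; first exact: gen_submodule0.
by rewrite addrC -scaleN1r; apply: gen_submodule_lin.
Qed.

Definition gen_zmodClosed : zmodClosed V :=
  HB.pack_for (zmodClosed V) (gen_submodule G)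
    (GRing.isZmodClosed.Build V (gen_submodule G) gen_submodule_zmod).

Definition quot_mod : Type := Quotient.quot gen_zmodClosed.

HB.instance Definition _ := GRing.Zmodule.on quot_mod.

Definition cls (v : V) : quot_mod := \pi_(Quotient.quot gen_zmodClosed) v.
Definition rep (u : quot_mod) : V := repr (u : Quotient.quot gen_zmodClosed).

Lemma repK u : cls (rep u) = u.
Proof. exact: reprK. Qed.

Lemma cls_eq u v : cls u = cls v <-> gen_submodule G (u - v).
Proof. by rewrite /cls; split=> [/eqP|Guv]; rewrite ?piE //; apply/eqP; rewrite piE. Qed.

Lemma clsD u v : cls (u + v) = cls u + cls v.
Proof. exact: (raddfD \pi_(Quotient.quot gen_zmodClosed)). Qed.

Definition quot_scale (a : k) (u : quot_mod) : quot_mod := cls (a *: rep u).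

Lemma cls_scale a u : cls (a *: u) = quot_scale a (cls u).
Proof.
apply/cls_eq; rewrite -scalerBr -[_ *: _]addr0.
apply: gen_submodule_lin (gen_submodule0).
by apply/cls_eq; rewrite repK.
Qed.

Lemma quot_scaleA a b u : quot_scale a (quot_scale b u) = quot_scale (a * b) u.
Proof. by rewrite -[u]repK -!cls_scale scalerA. Qed.
Lemma quot_scale1 u : quot_scale 1 u = u.
Proof. by rewrite -[u]repK -!cls_scale scale1r. Qed.
Lemma quot_scaleDr a : {morph quot_scale a : u v / u + v}.
Proof.
by move=> u v; rewrite -[u]repK -[v]repK -clsD -!cls_scale scalerDr clsD.
Qed.
Lemma quot_scaleDl u : {morph quot_scale^~ u : a b / a + b}.
Proof. by move=> a b; rewrite -[u]repK -!cls_scale scalerDl clsD. Qed.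

HB.instance Definition _ := GRing.Zmodule_isLmodule.Build k quot_mod
  quot_scaleA quot_scale1 quot_scaleDr quot_scaleDl.

Lemma cls_linear : linear cls.
Proof. by move=> a u v; rewrite clsD cls_scale. Qed.

HB.instance Definition _ := GRing.isLinear.Build k V quot_mod *:%R cls cls_linear.

Lemma quot_modP (W : lmodType k) (f : V -> W) (v : V) :
  linear f -> (forall g, G g -> f g = 0) -> f (rep (cls v)) = f v.
Proof.
move=> fL fG; pose f' := GRing.isLinear.Build k V W *:%R f fL.
pose F : {linear V -> W} := HB.pack_for {linear V -> W} f f'.
apply/eqP; rewrite -subr_eq0 -[f]/(F : V -> W) -raddfB /=; apply/eqP.
have /asboolP Gv : gen_submodule G (rep (cls v) - v).
  by apply/cls_eq; rewrite repK.
apply: (Gv (fun w => f w = 0)) fG; split; first exact: (raddf0 F).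
by move=> a u w fu fw; rewrite fL fu fw scaler0 addr0.
Qed.

End QuotientModule.

Section Tensor.
Variables (k : fieldType) (M N : lmodType k).

Local Notation F := {freeg (M * N)%type / k}.
Definition pair_gen (m : M) (n : N) : F := Freeg [:: (1, (m, n))].

Inductive tensor_rel : F -> Prop :=
| TensorL (a : k) (m m' : M) (n : N) : tensor_rel
    (pair_gen (a *: m + m') n - (a *: pair_gen m n + pair_gen m' n))
| TensorR (a : k) (m : M) (n n' : N) : tensor_rel
    (pair_gen m (a *: n + n') - (a *: pair_gen m n + pair_gen m n')).

Definition tensor : Type := quot_mod tensor_rel.
HB.instance Definition _ := GRing.Lmodule.on tensor.

Definition tens (m : M) (n : N) : tensor := cls tensor_rel (pair_gen m n).

(* For bilinear f this is the linear map induced by f on the tensor product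
   (teval_tens, teval_linear). It is a sum over a chosen representative of t,
   so nested evaluations of independent tensors can be exchanged freely. *)
Definition teval (W : lmodType k) (f : M -> N -> W) (t : tensor) : W :=
  fglift (fun p : M * N => f p.1 p.2) (rep t).

Lemma tens_bilin : bilin tens.
Proof.
split=> [m a n n'|n a m m'] /=.
  by rewrite -cls_linear; apply/cls_eq/gen_submodule_sub/TensorR.
by rewrite -cls_linear; apply/cls_eq/gen_submodule_sub/TensorL.
Qed.

Lemma fglift_linear (W : lmodType k) (f : M * N -> W) :
  linear (fglift f : F -> W).
Proof.
have fD : additive (fglift f : F -> W) := @lift_is_additive _ _ _ f.
pose L : {additive F -> W} :=
  HB.pack_for {additive F -> W} (fglift f : F -> W)
    (GRing.isZmodMorphism.Build F W (fglift f) fD).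
move=> a u v; rewrite -[fglift f]/(L : F -> W) raddfD; congr (_ + _).
have -> : a *: u = \sum_(x <- dom u) Freeg [:: (a * coeff x u, x)] by [].
have -> : L u = \sum_(x <- dom u) coeff x u *: f x.
  rewrite -[in LHS](freeg_sumE u) raddf_sum.
  by apply: eq_bigr => x _; rewrite /= liftU.
rewrite raddf_sum scaler_sumr.
by apply: eq_bigr => x _; rewrite /= !liftU scalerA.
Qed.

Section Eval.
Variables (W : lmodType k) (f : M -> N -> W).
Hypothesis f_bilin : bilin f.

Lemma teval_cls (u : F) :
  teval f (cls tensor_rel u) = fglift (fun p : M * N => f p.1 p.2) u.
Proof.
apply: (@quot_modP k F tensor_rel W (fglift (fun p : M * N => f p.1 p.2))).
  exact: fglift_linear.
have sub u' v' : fglift (fun p : M * N => f p.1 p.2) (u' - v')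
    = fglift (fun p : M * N => f p.1 p.2) u'
      - fglift (fun p : M * N => f p.1 p.2) v'.
  exact: lift_is_additive.
move=> _ [a m m' n|a m n n']; rewrite sub fglift_linear !liftU /= !scale1r.
  by rewrite f_bilin.2 subrr.
by rewrite f_bilin.1 subrr.
Qed.

Lemma teval_tens m n : teval f (tens m n) = f m n.
Proof. by rewrite teval_cls liftU scale1r. Qed.

Lemma teval_linear : linear (teval f).
Proof.
move=> a t t'; rewrite -[t]repK -[t']repK.
by rewrite -[LHS]/(teval f (a *: cls tensor_rel _ + cls tensor_rel _))
  -cls_linear !teval_cls fglift_linear.
Qed.

End Eval.
End Tensor.

(* M (x) N modulo  f b m (x) n = m (x) g b n  for all b. *)
Section BalancedTensor.
Variables (k : fieldType) (B : Type) (M N : lmodType k).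
Variables (f : B -> M -> M) (g : B -> N -> N).

Definition btensor_rel (u : tensor M N) : Prop :=
  exists b m n, u = tens (f b m) n - tens m (g b n).

Definition btensor : Type := quot_mod btensor_rel.
HB.instance Definition _ := GRing.Lmodule.on btensor.

Definition btens (m : M) (n : N) : btensor := cls btensor_rel (tens m n).

(* The induced map, when F is bilinear and F (f b m) n = F m (g b n). *)
Definition beval (W : lmodType k) (F : M -> N -> W) (u : btensor) : W :=
  teval F (rep u).

Lemma beval_btens (W : lmodType k) (F : M -> N -> W) m n :
  bilin F -> (forall b m' n', F (f b m') n' = F m' (g b n')) ->
  beval F (btens m n) = F m n.
Proof.
move=> FL Fb; rewrite -(teval_tens FL); apply: quot_modP.
  exact: teval_linear.
move=> _ [b [m' [n' ->]]].
by rewrite addrC -scaleN1r teval_linear // !teval_tens // Fb scaleN1r addNr.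
Qed.

End BalancedTensor.

(* Sweedler notation: given [split h F], read as "sum of F h(1) h(2)", the
   iterated version  \sw[n]_(h1 ... hn)  splits off the legs from the left,
   the last leg being split again each time. *)
Fixpoint nary (T V : Type) (n : nat) : Type :=
  if n is m.+1 then T -> nary T V m else V.

Fixpoint sweedler (T V : Type) (split : T -> (T -> T -> V) -> V) (n : nat) :
    T -> nary T V n.+1 -> V :=
  match n with
  | 0 => fun h F => F h
  | m.+1 => fun h F => split h (fun h1 h' => sweedler split h' (F h1))
  end.

Section Coalgebra.
Variable k : fieldType.

Record coalgebra := Coalgebra {
  coalg_sort :> lmodType k;
  comul : {linear coalg_sort -> tensor coalg_sort coalg_sort};
  counit : {linear coalg_sort -> k^o};
  comulA : forall h,
    teval (fun x y => teval (fun y1 y2 => tens x (tens y1 y2)) (comul y))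
          (comul h)
    = teval (fun x y => teval (fun x1 x2 => tens x1 (tens x2 y)) (comul x))
            (comul h);
  counitl : forall h, teval (fun x y => counit x *: y) (comul h) = h;
  counitr : forall h, teval (fun x y => counit y *: x) (comul h) = h
}.

End Coalgebra.

Definition swH (k : fieldType) (H : coalgebra k) (V : lmodType k) (n : nat)
    (h : H) (F : nary H V n.-1.+1) : V :=
  sweedler (fun x G => teval G (comul H x)) h F.

Notation "\sw[ n ]_( x .. y <- h ) E" :=
  (swH (n := n) h (fun x => .. (fun y => E) ..))
  (at level 41, x binder, y binder, E at level 41, h at level 99,
   format "\sw[ n ]_( x .. y  <-  h )  E") : ring_scope.

Record coquasi_bialgebra (k : fieldType) := CoquasiBialgebra {
  cqb_coalg :> coalgebra k;
  hmul : cqb_coalg -> cqb_coalg -> cqb_coalg;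
  hone : cqb_coalg;
  hmul_bilin : bilin hmul;
  hmul1l : forall h, hmul hone h = h;
  hmul1r : forall h, hmul h hone = h;
  comul_hmul : forall h g, comul cqb_coalg (hmul h g)
    = \sw[2]_(h1 h2 <- h) \sw[2]_(g1 g2 <- g) tens (hmul h1 g1) (hmul h2 g2);
  counit_hmul : forall h g, counit cqb_coalg (hmul h g)
    = counit cqb_coalg h * counit cqb_coalg g;
  comul_hone : comul cqb_coalg hone = tens hone hone;
  counit_hone : counit cqb_coalg hone = 1;
  phi : cqb_coalg -> cqb_coalg -> cqb_coalg -> k^o;
  phiV : cqb_coalg -> cqb_coalg -> cqb_coalg -> k^o;
  phi_trilin : trilin phi;
  phiV_trilin : trilin phiV;
  phi_phiV : forall h g f,
    \sw[2]_(h1 h2 <- h) \sw[2]_(g1 g2 <- g) \sw[2]_(f1 f2 <- f)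
      (phi h1 g1 f1 * phiV h2 g2 f2)
    = counit cqb_coalg h * counit cqb_coalg g * counit cqb_coalg f;
  phiV_phi : forall h g f,
    \sw[2]_(h1 h2 <- h) \sw[2]_(g1 g2 <- g) \sw[2]_(f1 f2 <- f)
      (phiV h1 g1 f1 * phi h2 g2 f2)
    = counit cqb_coalg h * counit cqb_coalg g * counit cqb_coalg f;
  phi1 : forall h g, phi h hone g = counit cqb_coalg (hmul h g);
  phi_cocycle : forall h g f l,
    \sw[2]_(h1 h2 <- h) \sw[2]_(g1 g2 <- g)
    \sw[2]_(f1 f2 <- f) \sw[2]_(l1 l2 <- l)
      (phi h1 g1 (hmul f1 l1) * phi (hmul h2 g2) f2 l2)
    = \sw[2]_(h1 h2 <- h) \sw[3]_(g1 g2 g3 <- g)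
      \sw[3]_(f1 f2 f3 <- f) \sw[2]_(l1 l2 <- l)
        (phi g1 f1 l1 * phi h1 (hmul g2 f2) l2 * phi h2 g3 f3);
  phi_assoc : forall h g f,
    \sw[2]_(h1 h2 <- h) \sw[2]_(g1 g2 <- g) \sw[2]_(f1 f2 <- f)
      (phi h1 g1 f1 *: hmul (hmul h2 g2) f2)
    = \sw[2]_(h1 h2 <- h) \sw[2]_(g1 g2 <- g) \sw[2]_(f1 f2 <- f)
        (phi h2 g2 f2 *: hmul h1 (hmul g1 f1))
}.

Record coquasi_hopf (k : fieldType) := CoquasiHopf {
  cqh_bialg :> coquasi_bialgebra k;
  antipode : {linear cqh_bialg -> cqh_bialg};
  alpha : {linear cqh_bialg -> k^o};
  beta : {linear cqh_bialg -> k^o};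
  comul_antipode : forall h, comul cqh_bialg (antipode h)
    = \sw[2]_(h1 h2 <- h) tens (antipode h2) (antipode h1);
  counit_antipode : forall h,
    counit cqh_bialg (antipode h) = counit cqh_bialg h;
  antipode_alpha : forall h,
    \sw[3]_(h1 h2 h3 <- h) (alpha h2 *: hmul (antipode h1) h3)
    = alpha h *: hone cqh_bialg;
  antipode_beta : forall h,
    \sw[3]_(h1 h2 h3 <- h) (beta h2 *: hmul h1 (antipode h3))
    = beta h *: hone cqh_bialg;
  antipode_phi : forall h,
    \sw[5]_(h1 h2 h3 h4 h5 <- h)
      (phi h1 (antipode h3) h5 * beta h2 * alpha h4)
    = counit cqh_bialg h;
  antipode_phiV : forall h,
    \sw[5]_(h1 h2 h3 h4 h5 <- h)
      (phiV (antipode h1) h3 (antipode h5) * alpha h2 * beta h4)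
    = counit cqh_bialg h
}.

Section ModuleAlgebra.
Variables (k : fieldType) (H : coquasi_bialgebra k) (B : algType k).

(* Linear maps H (x) B -> B and H (x) H -> B are given as bilinear maps. *)
Record is_module_algebra (act : H -> B -> B) : Prop := {
  act_bilin : bilin act;
  actM : forall h a b, act h (a * b)
    = \sw[2]_(h1 h2 <- h) (act h1 a * act h2 b);
  act1r : forall h, act h 1 = counit H h *: 1;
  act_hmul : forall h g b, act (hmul h g) b = act h (act g b);
  act1l : forall b, act (hone H) b = b
}.

Definition eps2 (h g : H) : B := counit H (hmul h g) *: 1.

Definition unital2 (gam : H -> H -> B) : Prop :=
  forall h, gam (hone H) h = counit H h *: 1
         /\ gam h (hone H) = counit H h *: 1.

Definition hconv2 (gam gam' : H -> H -> B) (h g : H) : B :=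
  \sw[2]_(h1 h2 <- h) \sw[2]_(g1 g2 <- g) (gam h1 g1 * gam' h2 g2).

Definition is_hconv_inverse2 (gam gamV : H -> H -> B) : Prop :=
  [/\ bilin gamV,
      forall h g, hconv2 gam gamV h g = eps2 h g
    & forall h g, hconv2 gamV gam h g = eps2 h g].

Definition associative_type (act : H -> B -> B) (gam : H -> H -> B) : Prop :=
  forall h g b,
    \sw[2]_(h1 h2 <- h) \sw[2]_(g1 g2 <- g) (gam h1 g1 * act (hmul h2 g2) b)
    = \sw[2]_(h1 h2 <- h) \sw[2]_(g1 g2 <- g) (act (hmul h1 g1) b * gam h2 g2).

Definition two_cocycle (act : H -> B -> B) (gam : H -> H -> B) : Prop :=
  forall h g f,
    \sw[2]_(h1 h2 <- h) \sw[2]_(g1 g2 <- g) \sw[2]_(f1 f2 <- f)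
      (act h1 (gam g1 f1) * gam h2 (hmul g2 f2))
    = \sw[2]_(h1 h2 <- h) \sw[2]_(g1 g2 <- g)
        (gam h1 g1 * gam (hmul h2 g2) f).

End ModuleAlgebra.

Section Bimodule.
Variables (k : fieldType) (B : algType k).

(* The four actions of B and its opposite on a B^e-bimodule L:
   lact b X = b X,  lbact b X = \bar b X,  ract b X = X b,  rbact b X = X \bar b.
   In particular lbact and rbact reverse products of B in the way dictated by
   \bar b \bar c = \bar{c b}. *)
Record bimod_ops (L : Type) := BimodOps {
  lact : B -> L -> L;
  lbact : B -> L -> L;
  ract : B -> L -> L;
  rbact : B -> L -> L
}.

Record is_bimodule (L : lmodType k) (M : bimod_ops L) : Prop := {
  lact_bilin : bilin (lact M);
  lbact_bilin : bilin (lbact M);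
  ract_bilin : bilin (ract M);
  rbact_bilin : bilin (rbact M);
  lact1 : forall X, lact M 1 X = X;
  lbact1 : forall X, lbact M 1 X = X;
  ract1 : forall X, ract M 1 X = X;
  rbact1 : forall X, rbact M 1 X = X;
  lactM : forall b c X, lact M (b * c) X = lact M b (lact M c X);
  lbactM : forall b c X, lbact M (b * c) X = lbact M c (lbact M b X);
  ractM : forall b c X, ract M (b * c) X = ract M c (ract M b X);
  rbactM : forall b c X, rbact M (b * c) X = rbact M b (rbact M c X);
  lact_lbact : forall b c X, lact M b (lbact M c X) = lbact M c (lact M b X);
  ract_rbact : forall b c X, ract M b (rbact M c X) = rbact M c (ract M b X);
  lact_ract : forall b c X, lact M b (ract M c X) = ract M c (lact M b X);
  lact_rbact : forall b c X, lact M b (rbact M c X) = rbact M c (lact M b X);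
  lbact_ract : forall b c X, lbact M b (ract M c X) = ract M c (lbact M b X);
  lbact_rbact : forall b c X, lbact M b (rbact M c X) = rbact M c (lbact M b X)
}.

Variables (L : lmodType k) (M : bimod_ops L).

(* L diamond_B L = L (x) L / < \bar b m (x) n - m (x) b n > *)
Definition diamond : Type := btensor (lbact M) (lact M).
HB.instance Definition _ := GRing.Lmodule.on diamond.

Definition dia (m n : L) : diamond := btens (lbact M) (lact M) m n.
Definition dia_eval (W : lmodType k) (F : L -> L -> W) (u : diamond) : W :=
  beval F u.

Definition takeuchi (u : diamond) : Prop := forall b,
  dia_eval (fun m n => dia (rbact M b m) n) u
  = dia_eval (fun m n => dia m (ract M b n)) u.

Inductive diamond3_rel : tensor L (tensor L L) -> Prop :=
| Diamond3L b m p n : diamond3_rel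
    (tens (lbact M b m) (tens p n) - tens m (tens (lact M b p) n))
| Diamond3R b m p n : diamond3_rel
    (tens m (tens (lbact M b p) n) - tens m (tens p (lact M b n))).

Definition diamond3 : Type := quot_mod diamond3_rel.
HB.instance Definition _ := GRing.Lmodule.on diamond3.

Definition dia3 (m p n : L) : diamond3 := cls diamond3_rel (tens m (tens p n)).
Definition dia3_eval (W : lmodType k) (F : L -> L -> L -> W) (u : diamond3) : W :=
  teval (fun m t => teval (F m) t) (rep u).

Definition takeuchi3 (u : diamond3) : Prop := forall b,
  dia3_eval (fun m p n => dia3 (rbact M b m) p n) u
  = dia3_eval (fun m p n => dia3 m (ract M b p) n) u
  /\ dia3_eval (fun m p n => dia3 m (rbact M b p) n) u
  = dia3_eval (fun m p n => dia3 m p (ract M b n)) u.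

End Bimodule.

Record coalgebroid_data (k : fieldType) (B : algType k) (L : lmodType k) :=
  CoalgebroidData {
  cgd_bimod :> bimod_ops B L;
  cgd_comul : L -> diamond cgd_bimod;
  cgd_counit : L -> B
}.

Definition swL (k : fieldType) (B : algType k) (L : lmodType k)
    (D : coalgebroid_data B L) (V : lmodType k) (n : nat)
    (X : L) (F : nary L V n.-1.+1) : V :=
  sweedler (fun Y G => dia_eval G (cgd_comul D Y)) X F.

Notation "\sw[ D , n ]_( x .. y <- X ) E" :=
  (swL D (n := n) X (fun x => .. (fun y => E) ..))
  (at level 41, x binder, y binder, E at level 41, X at level 99,
   format "\sw[ D , n ]_( x .. y  <-  X )  E") : ring_scope.

Record is_coalgebroid (k : fieldType) (B : algType k) (L : lmodType k)
    (D : coalgebroid_data B L) : Prop := {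
  cgd_bimodule : is_bimodule D;
  cgd_comul_linear : linear (cgd_comul D);
  cgd_comul_takeuchi : forall X, takeuchi (cgd_comul D X);
  cgd_comul_lact : forall b X, cgd_comul D (lact D b X)
    = \sw[D, 2]_(X1 X2 <- X) dia D (lact D b X1) X2;
  cgd_comul_lbact : forall b X, cgd_comul D (lbact D b X)
    = \sw[D, 2]_(X1 X2 <- X) dia D X1 (lbact D b X2);
  cgd_counit_linear : linear (cgd_counit D);
  cgd_counit_lact : forall b X,
    cgd_counit D (lact D b X) = b * cgd_counit D X;
  cgd_counit_lbact : forall b X,
    cgd_counit D (lbact D b X) = cgd_counit D X * b;
  cgd_comulA : forall X,
    \sw[D, 2]_(X1 Y <- X) \sw[D, 2]_(X2 X3 <- Y) dia3 D X1 X2 X3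
    = \sw[D, 2]_(Y X3 <- X) \sw[D, 2]_(X1 X2 <- Y) dia3 D X1 X2 X3;
  cgd_comulA_takeuchi : forall X,
    takeuchi3 (\sw[D, 2]_(X1 Y <- X) \sw[D, 2]_(X2 X3 <- Y) dia3 D X1 X2 X3);
  cgd_counitl : forall X,
    \sw[D, 2]_(X1 X2 <- X) lact D (cgd_counit D X1) X2 = X;
  cgd_counitr : forall X,
    \sw[D, 2]_(X1 X2 <- X) lbact D (cgd_counit D X2) X1 = X
}.

(* Left B^e-linear maps to B on L (x)_{B^e} L and L (x)_{B^e} L (x)_{B^e} L,
   where B carries the action (b \bar c) . a = b a c. *)
Section Hom.
Variables (k : fieldType) (B : algType k) (L : lmodType k).
Variable M : bimod_ops B L.

Record is_hom2 (f : L -> L -> B) : Prop := {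
  hom2_bilin : bilin f;
  hom2_lact : forall b X Y, f (lact M b X) Y = b * f X Y;
  hom2_lbact : forall b X Y, f (lbact M b X) Y = f X Y * b;
  hom2_bal : forall b X Y, f (ract M b X) Y = f X (lact M b Y);
  hom2_balb : forall b X Y, f (rbact M b X) Y = f X (lbact M b Y)
}.

Record is_hom3 (f : L -> L -> L -> B) : Prop := {
  hom3_trilin : trilin f;
  hom3_lact : forall b X Y Z, f (lact M b X) Y Z = b * f X Y Z;
  hom3_lbact : forall b X Y Z, f (lbact M b X) Y Z = f X Y Z * b;
  hom3_bal1 : forall b X Y Z, f (ract M b X) Y Z = f X (lact M b Y) Z;
  hom3_balb1 : forall b X Y Z, f (rbact M b X) Y Z = f X (lbact M b Y) Z;
  hom3_bal2 : forall b X Y Z, f X (ract M b Y) Z = f X Y (lact M b Z);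
  hom3_balb2 : forall b X Y Z, f X (rbact M b Y) Z = f X Y (lbact M b Z)
}.

End Hom.

(* The source and target maps are s = csrc : B -> L and t = ctgt, where
   ctgt b stands for t(\bar b); hence ctgt is an antihomomorphism on B. The
   B^e-bimodule actions are stored with the coalgebroid and required below to
   be multiplication by csrc and ctgt. *)
Record coquasi_bialgebroid_data (k : fieldType) (B : algType k)
    (L : lmodType k) := CoquasiBialgebroidData {
  cbd_coalg :> coalgebroid_data B L;
  cmul : L -> L -> L;
  cone : L;
  csrc : B -> L;
  ctgt : B -> L;
  cPhi : L -> L -> L -> B
}.

Section CoquasiBialgebroid.
Variables (k : fieldType) (B : algType k) (L : lmodType k).
Variable D : coquasi_bialgebroid_data B L.

Local Notation "X ** Y" := (cmul D X Y) (at level 40, left associativity).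
Local Notation eps := (cgd_counit D).
Local Notation Phi := (cPhi D).

Definition conv2 (f g : L -> L -> B) (X Y : L) : B :=
  \sw[D, 2]_(Y1 Y2 <- Y) \sw[D, 2]_(X1 X2 <- X) (f X1 Y1 * g X2 Y2).

Definition conv3 (f g : L -> L -> L -> B) (X Y Z : L) : B :=
  \sw[D, 2]_(Z1 Z2 <- Z) \sw[D, 2]_(Y1 Y2 <- Y) \sw[D, 2]_(X1 X2 <- X)
    (f X1 Y1 Z1 * g X2 Y2 Z2).

Definition is_conv_inverse2 (f g : L -> L -> B) : Prop :=
  [/\ is_hom2 D g,
      forall X Y, conv2 f g X Y = eps (X ** Y)
    & forall X Y, conv2 g f X Y = eps (X ** Y)].

Definition is_conv_inverse3 (f g : L -> L -> L -> B) : Prop :=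
  [/\ is_hom3 D g,
      forall X Y Z, conv3 f g X Y Z = eps (X ** Y ** Z)
    & forall X Y Z, conv3 g f X Y Z = eps (X ** Y ** Z)].

Record is_coquasi_bialgebroid : Prop := {
  cb_mul_bilin : bilin (cmul D);
  cb_mul1l : forall X, cone D ** X = X;
  cb_mul1r : forall X, X ** cone D = X;
  cb_src_linear : linear (csrc D);
  cb_src1 : csrc D 1 = cone D;
  cb_srcM : forall b c, csrc D (b * c) = csrc D b ** csrc D c;
  cb_tgt_linear : linear (ctgt D);
  cb_tgt1 : ctgt D 1 = cone D;
  cb_tgtM : forall b c, ctgt D (c * b) = ctgt D b ** ctgt D c;
  cb_src_tgt : forall b c, csrc D b ** ctgt D c = ctgt D c ** csrc D b;
  cb_lact : forall b X, lact D b X = csrc D b ** X;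
  cb_lbact : forall b X, lbact D b X = ctgt D b ** X;
  cb_ract : forall b X, ract D b X = X ** csrc D b;
  cb_rbact : forall b X, rbact D b X = X ** ctgt D b;
  cb_coalgebroid : is_coalgebroid D;
  cb_comulM : forall X Y, cgd_comul D (X ** Y)
    = \sw[D, 2]_(Y1 Y2 <- Y) \sw[D, 2]_(X1 X2 <- X)
        dia D (X1 ** Y1) (X2 ** Y2);
  cb_comul1 : cgd_comul D (cone D) = dia D (cone D) (cone D);
  cb_counit1 : eps (cone D) = 1;
  cb_counit_src : forall X Y, eps (ract D (eps Y) X) = eps (X ** Y);
  cb_counit_tgt : forall X Y, eps (rbact D (eps Y) X) = eps (X ** Y);
  cb_Phi_hom : is_hom3 D Phi;
  cb_Phi_inv : exists PhiV, is_conv_inverse3 Phi PhiV;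
  cb_Phi1l : forall X Y, Phi (cone D) X Y = eps (X ** Y);
  cb_Phi1m : forall X Y, Phi X (cone D) Y = eps (X ** Y);
  cb_Phi1r : forall X Y, Phi X Y (cone D) = eps (X ** Y);
  cb_Phi_right : forall X Y Z b, Phi X Y (ract D b Z) = Phi X Y (rbact D b Z);
  cb_Phi_cocycle : forall X Y Z W,
    \sw[D, 2]_(W1 W2 <- W) \sw[D, 2]_(Z1 Z2 <- Z)
    \sw[D, 2]_(Y1 Y2 <- Y) \sw[D, 2]_(X1 X2 <- X)
      (Phi X1 Y1 (Z1 ** W1) * Phi (X2 ** Y2) Z2 W2)
    = \sw[D, 2]_(W1 W2 <- W) \sw[D, 3]_(Z1 Z2 Z3 <- Z)
      \sw[D, 3]_(Y1 Y2 Y3 <- Y) \sw[D, 2]_(X1 X2 <- X)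
        (Phi X1 (lact D (Phi Y1 Z1 W1) (Y2 ** Z2)) W2 * Phi X2 Y3 Z3);
  cb_Phi_assoc : forall X Y Z,
    \sw[D, 2]_(Z1 Z2 <- Z) \sw[D, 2]_(Y1 Y2 <- Y) \sw[D, 2]_(X1 X2 <- X)
      lact D (Phi X1 Y1 Z1) (X2 ** Y2 ** Z2)
    = \sw[D, 2]_(Z1 Z2 <- Z) \sw[D, 2]_(Y1 Y2 <- Y) \sw[D, 2]_(X1 X2 <- X)
        lbact D (Phi X2 Y2 Z2) (X1 ** (Y1 ** Z1))
}.

Definition is_left_bialgebroid : Prop :=
  is_coquasi_bialgebroid /\ forall X Y Z, Phi X Y Z = eps (X ** Y ** Z).

Definition lambda (u : btensor (rbact D) (lbact D)) : diamond D :=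
  beval (fun X Y => \sw[D, 2]_(X1 X2 <- X) dia D X1 (X2 ** Y)) u.

Definition mu (u : btensor (ract D) (lact D)) : diamond D :=
  beval (fun X Y => \sw[D, 2]_(X1 X2 <- X) dia D (X1 ** Y) X2) u.

Definition is_left_hopf_algebroid : Prop :=
  is_left_bialgebroid /\ bijective lambda.

Definition is_anti_left_hopf_algebroid : Prop :=
  is_left_bialgebroid /\ bijective mu.

Record is_C2 (Sig : L -> L -> B) : Prop := {
  C2_hom : is_hom2 D Sig;
  C2_unitall : forall X, Sig (cone D) X = eps X;
  C2_unitalr : forall X, Sig X (cone D) = eps X;
  C2_inv : exists SigV, is_conv_inverse2 Sig SigV;
  C2_right : forall X Y b, Sig X (rbact D b Y) = Sig X (ract D b Y)
}.

Definition twist_mul (Sig SigV : L -> L -> B) (X Y : L) : L :=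
  \sw[D, 3]_(Y1 Y2 Y3 <- Y) \sw[D, 3]_(X1 X2 X3 <- X)
    lact D (Sig X1 Y1) (lbact D (SigV X3 Y3) (X2 ** Y2)).

Definition twist_Phi (Sig SigV : L -> L -> B) (X Y Z : L) : B :=
  \sw[D, 4]_(Z1 Z2 Z3 Z4 <- Z) \sw[D, 5]_(Y1 Y2 Y3 Y4 Y5 <- Y)
  \sw[D, 4]_(X1 X2 X3 X4 <- X)
    (Sig X1 (lact D (Sig Y1 Z1) (Y2 ** Z2)) * Phi X2 Y3 Z3
     * SigV (lbact D (SigV X4 Y5) (X3 ** Y4)) Z4).

(* (L, Phi)^Sig, where SigV is the convolution inverse of Sig. *)
Definition twist (Sig SigV : L -> L -> B) : coquasi_bialgebroid_data B L :=
  CoquasiBialgebroidData D (twist_mul Sig SigV) (cone D) (csrc D) (ctgt D)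
    (twist_Phi Sig SigV).

End CoquasiBialgebroid.

Section BHB.
Variables (k : fieldType) (H : coquasi_bialgebra k) (B : algType k).
Variable act : H -> B -> B.

Definition BHB : Type := tensor B (tensor H B).
HB.instance Definition _ := GRing.Lmodule.on BHB.

Definition box (a : B) (h : H) (a' : B) : BHB := tens a (tens h a').
Definition box_eval (W : lmodType k) (F : B -> H -> B -> W) (X : BHB) : W :=
  teval (fun a t => teval (F a) t) X.

Definition bhb_bimod : bimod_ops B BHB := {|
  lact := fun b => box_eval (fun a h a' => box (b * a) h a');
  lbact := fun b => box_eval (fun a h a' => box a h (a' * b));
  ract := fun b => box_eval (fun a h a' =>
    \sw[2]_(h1 h2 <- h) box (a * act h1 b) h2 a');
  rbact := fun b => box_eval (fun a h a' =>
    \sw[2]_(h1 h2 <- h) box a h1 (act h2 b * a'))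
|}.

Definition bhb_comul : BHB -> diamond bhb_bimod :=
  box_eval (fun b h b' =>
    \sw[2]_(h1 h2 <- h) dia bhb_bimod (box b h1 1) (box 1 h2 b')).

Definition bhb_counit : BHB -> B :=
  box_eval (fun b h b' => counit H h *: (b * b')).

Definition bhb_coalg : coalgebroid_data B BHB :=
  CoalgebroidData bhb_comul bhb_counit.

Definition bhb_mul (gam gamV : H -> H -> B) (X Y : BHB) : BHB :=
  box_eval (fun b g b' => box_eval (fun a h a' =>
    \sw[3]_(g1 g2 g3 <- g) \sw[5]_(h1 h2 h3 h4 h5 <- h)
      box (a * act h1 b * gam h2 g1) (hmul h3 g2)
          (gamV h4 g3 * act h5 b' * a')) X) Y.

Definition bhb_Phi (gam gamV : H -> H -> B) (X Y Z : BHB) : B :=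
  box_eval (fun c f c' => box_eval (fun b g b' => box_eval (fun a h a' =>
    \sw[4]_(f1 f2 f3 f4 <- f) \sw[7]_(g1 g2 g3 g4 g5 g6 g7 <- g)
    \sw[9]_(h1 h2 h3 h4 h5 h6 h7 h8 h9 <- h)
      (phi h5 g4 f3 *:
        (a * act h1 b * act h2 (act g1 c) * act h3 (gam g2 f1)
         * gam h4 (hmul g3 f2) * gamV (hmul h6 g5) f4 * gamV h7 g6
         * act h8 (act g7 c') * act h9 b' * a'))) X) Y) Z.

(* (B (x) H (x) B, Phi^gam), where gamV is the convolution inverse of gam. *)
Definition bhb (gam gamV : H -> H -> B) : coquasi_bialgebroid_data B BHB :=
  CoquasiBialgebroidData bhb_coalg (bhb_mul gam gamV) (box 1 (hone H) 1)
    (fun b => box b (hone H) 1) (fun b => box 1 (hone H) b)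
    (bhb_Phi gam gamV).

Definition bhb0 : coquasi_bialgebroid_data B BHB :=
  bhb (@eps2 k H B) (@eps2 k H B).

Definition Gam (gam : H -> H -> B) (X Y : BHB) : B :=
  box_eval (fun b g b' => box_eval (fun a h a' =>
    \sw[3]_(h1 h2 h3 <- h) (a * act h1 b * gam h2 g * act h3 b' * a')) X) Y.

End BHB.

(* Main.v *)
From HB Require Import structures.
Require Import Defs.
From mathcomp Require Import all_boot all_algebra.
From mathcomp Require Import boolp.
From mathcomp Require Import freeg ring.

Set Implicit Arguments.
Unset Strict Implicit.
Unset Printing Implicit Defensive.

Import GRing.Theory.
Local Open Scope ring_scope.

(* Work in the convolution algebras Hom(C, B) with C a tensor power of H, where
   "gamma is of associative type" says that gamma commutes with the maps
   h (x) g |-> (hg) |> b.  The B^e-bimodule B (x) H (x) B is generated by the elements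
   J h = 1 (x) h (x) 1, so a functional that is left B^e-linear and balanced in its
   arguments is determined by its values on them; conversely each F in Hom(H (x) H, B)
   or Hom(H (x) H (x) H, B) satisfying the analogous commutation relation extends.
   Gamma extends gamma and Phi^gamma extends
     Om(h, g, f) = (h |> gamma(g, f)) gamma(h, gf) phi(h, g, f) gamma^-1(hg, f) gamma^-1(h, g),
   so the axioms of a coquasi-bialgebroid and the comparison with the twist by Gamma
   become identities of convolution products; the pentagon for Om follows from that of
   phi since all terms involving gamma cancel.

   If phi is trivial then S'(h) = b(h1) S(h2) a(h3) is an ordinary antipode, and it is
   bijective as soon as S is.  When moreover gamma is a cocycle, Om is trivial and
     lambda^-1(X # Y) = (a (x) h1 (x) gamma(h2, S' h3)) # gamma^-1(S' h5, h6) J(S' h4) (a' Y)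
   for X = a (x) h (x) a'; mu is inverted by the mirror formula with S'^-1. *)

(** * Tensors and multilinear maps *)

(** A Sweedler sum in the diamond product runs over a chosen representative, so it may be rewritten
    only when the summand is balanced between neighbouring legs. The axioms split several arguments
    at once, and an inner sum over the legs of X is balanced in the legs of Y only because the
    Takeuchi condition carries a scalar from one leg of X to the next. This bookkeeping ([good2] to
    [good5], [nest], [bal3], [bal4]) accounts for much of the length.

    The product is only associative up to Phi, so X(Yb) = (XY)b does not come for free: it rests on
    the commutation of gamma with (hg) |> b. The same commutation yields Phi(X, Y, Zb) = Phi(X, Y,
    Z\bar b), without which the right side of the cocycle condition would not be balanced between Z
    and W.

    The given antipode S satisfies its axioms only up to the functionals a and b. For trivial phi
    these are convolution inverse to each other, which is why conjugating S by them gives an honest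
    antipode. *)

Section TevalTheory.
Variable k : fieldType.
Implicit Types (M N V W U : lmodType k).

Definition mklin V W (f : V -> W) (lf : linear f) : {linear V -> W} :=
  HB.pack_for {linear V -> W} f (GRing.isLinear.Build k V W *:%R f lf).

Lemma lin_sum V W (f : V -> W) I (r : seq I) (F : I -> V) :
  linear f -> f (\sum_(i <- r) F i) = \sum_(i <- r) f (F i).
Proof. by move=> lf; apply: (raddf_sum (mklin lf)). Qed.

Lemma linZ V W (f : V -> W) a u : linear f -> f (a *: u) = a *: f u.
Proof. by move=> lf; apply: (linearZ_LR (mklin lf)). Qed.

Lemma freeg_linE (K : choiceType) W (f : {freeg K / k} -> W) u :
  linear f -> f u = \sum_(p <- dom u) coeff p u *: f << p >>.
Proof.
move=> lf; rewrite -[in LHS](freeg_sumE u) lin_sum //.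
apply: eq_bigr => p _; rewrite -linZ //; congr f.
by apply/eqP/freeg_eqP => q; rewrite coeffZ !coeffU mul1r.
Qed.

(** The evaluation is a finite sum over one fixed representative of [t], whether or not [f] is
    bilinear. Hence exchange of sums, linear dependence on parameters and composition with linear
    maps hold for arbitrary [f]; bilinearity matters only when [t] varies. *)
Lemma tevalE M N W (f : M -> N -> W) (t : tensor M N) :
  teval f t = \sum_(p <- dom (rep t)) coeff p (rep t) *: f p.1 p.2.
Proof.
rewrite /teval freeg_linE; last exact: fglift_linear.
by apply: eq_bigr => x _; rewrite liftU scale1r.
Qed.

Lemma eq_teval M N W (f g : M -> N -> W) t :
  (forall x y, f x y = g x y) -> teval f t = teval g t.
Proof. by move=> fg; rewrite !tevalE; apply: eq_bigr => p _; rewrite fg. Qed.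

Lemma teval_exch M N M' N' W (F : M -> N -> M' -> N' -> W) t s :
  teval (fun x y => teval (F x y) s) t = teval (fun u v => teval (fun x y => F x y u v) t) s.
Proof.
rewrite !tevalE; under eq_bigr do rewrite tevalE scaler_sumr.
rewrite exchange_big; apply: eq_bigr => q _; rewrite tevalE scaler_sumr.
by apply: eq_bigr => p _; rewrite !scalerA mulrC.
Qed.

Lemma teval_map M N V W (L : V -> W) (F : M -> N -> V) t :
  linear L -> L (teval F t) = teval (fun x y => L (F x y)) t.
Proof.
move=> linL.
rewrite !tevalE lin_sum //; apply: eq_bigr => p _.
by rewrite linZ.
Qed.

Lemma lin_id V : linear (fun u : V => u). Proof. by []. Qed.

Lemma lin_comp U V W (f : V -> W) (g : U -> V) :
  linear f -> linear g -> linear (fun u => f (g u)).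
Proof. by move=> lf lg a u v; rewrite lg lf. Qed.

Lemma lin_tevalF U M N W (F : U -> M -> N -> W) t :
  (forall x y, linear (fun u => F u x y)) -> linear (fun u => teval (F u) t).
Proof.
move=> lF a u v; rewrite !tevalE scaler_sumr -big_split; apply: eq_bigr => p _ /=.
by rewrite lF scalerDr !scalerA mulrC.
Qed.

Lemma lin_tevalA U M N W (F : M -> N -> W) (g : U -> tensor M N) :
  bilin F -> linear g -> linear (fun u => teval F (g u)).
Proof. by move=> bF lg; apply: lin_comp => //; apply: teval_linear. Qed.

Lemma lin_b1 U V V' W (op : V -> V' -> W) (g : U -> V) c :
  bilin op -> linear g -> linear (fun u => op (g u) c).
Proof. by move=> [_ H] lg; apply: (lin_comp (H c)). Qed.

Lemma lin_b2 U V V' W (op : V -> V' -> W) (g : U -> V') c :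
  bilin op -> linear g -> linear (fun u => op c (g u)).
Proof. by move=> [H _] lg; apply: (lin_comp (H c)). Qed.

Lemma lin_t1 U V V' V'' W (op : V -> V' -> V'' -> W) (g : U -> V) c d :
  trilin op -> linear g -> linear (fun u => op (g u) c d).
Proof. by move=> [_ _ H] lg; apply: (lin_comp (H c d)). Qed.
Lemma lin_t2 U V V' V'' W (op : V -> V' -> V'' -> W) (g : U -> V') c d :
  trilin op -> linear g -> linear (fun u => op c (g u) d).
Proof. by move=> [_ H _] lg; apply: (lin_comp (H c d)). Qed.
Lemma lin_t3 U V V' V'' W (op : V -> V' -> V'' -> W) (g : U -> V'') c d :
  trilin op -> linear g -> linear (fun u => op c d (g u)).
Proof. by move=> [H _ _] lg; apply: (lin_comp (H c d)). Qed.

Lemma lin_mul1 U (A : algType k) (f : U -> A) c : linear f -> linear (fun u => f u * c).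
Proof. by move=> lf a u v; rewrite lf mulrDl scalerAl. Qed.
Lemma lin_mul2 U (A : algType k) (f : U -> A) c : linear f -> linear (fun u => c * f u).
Proof. by move=> lf a u v; rewrite lf mulrDr scalerAr. Qed.
Lemma lin_sc1 U V (f : U -> k^o) (c : V) : linear f -> linear (fun u => f u *: c).
Proof. by move=> lf a u v; rewrite lf scalerDl scalerA. Qed.
Lemma lin_sc2 U V (f : U -> V) (c : k) : linear f -> linear (fun u => c *: f u).
Proof. by move=> lf a u v; rewrite lf scalerDr !scalerA mulrC. Qed.
Lemma lin_linear V W (f : {linear V -> W}) : linear f.
Proof. exact: linearP. Qed.

Lemma tens_eq M N W (f g : tensor M N -> W) :
  linear f -> linear g -> (forall m n, f (tens m n) = g (tens m n)) -> f =1 g.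
Proof.
move=> lf lg fg t; rewrite -[t]repK.
have lc : linear (cls (@tensor_rel k M N)) by apply: cls_linear.
rewrite (freeg_linE _ (lin_comp lf lc)) (freeg_linE _ (lin_comp lg lc)).
by apply: eq_bigr => -[m n] _; congr (_ *: _); apply: fg.
Qed.

End TevalTheory.

Create HintDb bil.
Ltac bil_solve := solve [assumption | auto with bil nocore].

Ltac lin_eta := cbv beta;
  lazymatch goal with
  | |- GRing.linear_for ?s ?f =>
      change (GRing.linear_for s (fun u => f u)); cbv beta delta [Datatypes.id]
  | |- _ => idtac
  end.

Ltac lin_bundled :=
  match goal with
  | |- GRing.linear_for _ (@GRing.Linear.sort _ _ _ _ ?f) => exact: (lin_linear f)
  | |- _ => bil_solve
  end.

Ltac lin_op :=
  match goal with
  | |- GRing.linear_for _ (fun u => ?op ?a (@?g u)) =>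
      apply: (@lin_b2 _ _ _ _ _ op g a); [bil_solve | ]
  | |- GRing.linear_for _ (fun u => ?op (@?g u) ?a) =>
      apply: (@lin_b1 _ _ _ _ _ op g a); [bil_solve | ]
  | |- GRing.linear_for _ (fun u => ?op ?a ?b (@?g u)) =>
      apply: (@lin_t3 _ _ _ _ _ _ op g a b); [bil_solve | ]
  | |- GRing.linear_for _ (fun u => ?op ?a (@?g u) ?b) =>
      apply: (@lin_t2 _ _ _ _ _ _ op g a b); [bil_solve | ]
  | |- GRing.linear_for _ (fun u => ?op (@?g u) ?a ?b) =>
      apply: (@lin_t1 _ _ _ _ _ _ op g a b); [bil_solve | ]
  | |- GRing.linear_for _ (fun u => ?f (@?g u)) =>
      apply: (@lin_comp _ _ _ _ f g); [lin_bundled | ]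
  | |- _ => bil_solve
  end.

(* [match] may bind a pattern variable to a term mentioning the bound [u];
   the subsequent [apply] then fails and the next branch is tried. *)
Ltac lin_step :=
  match goal with
  | |- GRing.linear_for _ (fun u => u) => exact: lin_id
  | |- GRing.linear_for _ (fun u => teval (@?F u) ?t) =>
      apply: (@lin_tevalF _ _ _ _ _ F t); intros
  | |- GRing.linear_for _ (fun u => teval ?F (@?g u)) =>
      apply: (@lin_tevalA _ _ _ _ _ F g)
  | |- GRing.linear_for _ (fun u => @?f u * ?c) => apply: (@lin_mul1 _ _ _ f c)
  | |- GRing.linear_for _ (fun u => ?c * @?f u) => apply: (@lin_mul2 _ _ _ f c)
  | |- GRing.linear_for _ (fun u => @?f u *: ?c) => apply: (@lin_sc1 _ _ _ f c)
  | |- GRing.linear_for _ (fun u => ?c *: @?f u) => apply: (@lin_sc2 _ _ _ f c)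
  | |- _ => lin_op
  end.

Ltac unsw := cbv beta iota delta [swH sweedler Nat.pred].

(** Proves linearity in one variable by recursion on the head symbol: [teval], products and scalings
    are built in, any other operation must have its bilinearity or trilinearity in the context or in
    the hint base [bil]. *)
Ltac lin :=
  lazymatch goal with
  | |- context [@swH] => unsw
  | |- _ => idtac
  end; lin_eta;
  lazymatch goal with
  | |- bilin _ => split; intro; lin
  | |- trilin _ => split; intros ? ?; lin
  | |- GRing.linear_for _ _ => lin_step; lin
  | |- _ => idtac
  end.

#[export] Hint Resolve tens_bilin : bil.

(** * Coalgebras and convolution *)

Section Coalg.
Variable k : fieldType.
Implicit Types (U V W : lmodType k) (C D E : coalgebra k).

Lemma teval_id (M N : lmodType k) (t : tensor M N) : teval (@tens _ M N) t = t.
Proof.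
by apply: (tens_eq (f := teval _) (g := fun u => u)) => [||m n]; rewrite ?teval_tens //; lin.
Qed.

Lemma teval_teval (M N M' N' : lmodType k) W (F : M' -> N' -> W)
   (G : M -> N -> tensor M' N') t :
  bilin F -> teval F (teval G t) = teval (fun x y => teval F (G x y)) t.
Proof. by move=> bF; apply: teval_map; apply: teval_linear. Qed.

Lemma coassoc C W (F : C -> C -> C -> W) (c : C) : trilin F ->
  teval (fun x y => teval (F x) (comul C y)) (comul C c)
  = teval (fun x y => teval (fun x1 x2 => F x1 x2 y) (comul C x)) (comul C c).
Proof.
move=> tF; have /(congr1 (teval (fun x t => teval (F x) t))) := comulA c.
have bF x : bilin (F x) by case: tF => *; split.
rewrite !teval_teval; try by lin.
move=> H; rewrite (eq_teval (g := (fun x y => teval (fun x t => teval (F x) t)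
             (teval (fun y1 y2 => tens x (tens y1 y2)) (comul C y))))).
  rewrite H; apply: eq_teval => x y; rewrite teval_teval; last by lin.
  by apply: eq_teval => x1 x2; rewrite !teval_tens //; lin.
move=> x y; rewrite teval_teval; last by lin.
rewrite -[in LHS](teval_id (comul C y)) teval_teval //.
by apply: eq_teval => x1 x2; rewrite !teval_tens //; lin.
Qed.

Lemma counit_l C W (F : C -> W) (c : C) : linear F ->
  teval (fun x y => counit C x *: F y) (comul C c) = F c.
Proof.
move=> lF; rewrite -[in RHS](counitl c) teval_map //; apply: eq_teval => x y.
by rewrite linZ.
Qed.

Lemma counit_r C W (F : C -> W) (c : C) : linear F ->
  teval (fun x y => counit C y *: F x) (comul C c) = F c.
Proof.
move=> lF; rewrite -[in RHS](counitr c) teval_map //; apply: eq_teval => x y.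
by rewrite linZ.
Qed.

Section TensorCoalgebra.
Variables C D : coalgebra k.

(** All arguments are split at once and the two middle factors interchanged. With this coalgebra
    structure, maps of several variables in [H] become elements of a single convolution algebra. *)
Definition tc_split (c : C) (d : D) : tensor (tensor C D) (tensor C D) :=
  teval (fun c1 c2 => teval (fun d1 d2 => tens (tens c1 d1) (tens c2 d2))
    (comul D d)) (comul C c).

Lemma tc_split_bilin : bilin tc_split. Proof. by rewrite /tc_split; lin. Qed.

Definition tc_comul := mklin (teval_linear tc_split_bilin).

Definition tc_counit : {linear tensor C D -> k^o} :=
  mklin (teval_linear (f := (fun c d => counit C c *: counit D d)) ltac:(lin)).

Lemma tc_comul_tens c d : tc_comul (tens c d) = tc_split c d.
Proof. exact/teval_tens/tc_split_bilin. Qed.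

Lemma teval_tc W (P : tensor C D -> tensor C D -> W) c d : bilin P ->
  teval P (tc_comul (tens c d)) = teval (fun c1 c2 =>
     teval (fun d1 d2 => P (tens c1 d1) (tens c2 d2)) (comul D d)) (comul C c).
Proof.
move=> bP; rewrite tc_comul_tens /tc_split teval_teval //; apply: eq_teval => c1 c2.
by rewrite teval_teval //; apply: eq_teval => d1 d2; rewrite teval_tens.
Qed.

Lemma tc_counit_tens c d : tc_counit (tens c d) = counit C c *: counit D d.
Proof. by apply: teval_tens; lin. Qed.

Lemma tc_comulA (h : tensor C D) :
  teval (fun x y => teval (fun y1 y2 => tens x (tens y1 y2)) (tc_comul y)) (tc_comul h)
  = teval (fun x y => teval (fun x1 x2 => tens x1 (tens x2 y)) (tc_comul x)) (tc_comul h).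
Proof.
move: h; apply: tens_eq => [||c d]; try by lin.
cbv beta; rewrite !teval_tc; try by lin.
transitivity (teval (fun c1 c' => teval (fun c2 c3 => teval (fun d1 d' => teval (fun d2 d3 =>
   tens (tens c1 d1) (tens (tens c2 d2) (tens c3 d3))) (comul D d')) (comul D d)) (comul C c'))
   (comul C c)).
  apply: eq_teval => c1 c2; rewrite teval_exch; apply: eq_teval => d1 d2.
  by rewrite teval_tc //; lin.
rewrite coassoc; last by lin.
apply: eq_teval => c1 c2.
transitivity (teval (fun x1 x2 => teval (fun d1 d2 => teval (fun d11 d12 => 
    tens (tens x1 d11) (tens (tens x2 d12) (tens c2 d2)))
   (comul D d1)) (comul D d)) (comul C c1)).
  by apply: eq_teval => x1 x2; rewrite coassoc //; lin.
rewrite teval_exch; apply: eq_teval => d1 d2.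
by rewrite teval_tc //; lin.
Qed.

Lemma tc_counitl (h : tensor C D) : teval (fun x y => tc_counit x *: y) (tc_comul h) = h.
Proof.
move: h; apply: (tens_eq (g := fun h => h)) => [||c d]; try by lin.
cbv beta; rewrite teval_tc; last by lin.
transitivity (teval (W := tensor C D) (fun c1 c2 : C =>
  (counit C c1 : k) *: tens c2 d) (comul C c)).
  apply: eq_teval => c1 c2.
  rewrite -(counit_l (W := tensor C D) (F := fun d : D => (counit C c1 : k) *: tens c2 d));
    last by lin.
  by apply: eq_teval => d1 d2; rewrite tc_counit_tens scalerA mulrC.
by rewrite (counit_l (F := fun c : C => tens c d)) //; lin.
Qed.

Lemma tc_counitr (h : tensor C D) : teval (fun x y => tc_counit y *: x) (tc_comul h) = h.
Proof.
move: h; apply: (tens_eq (g := fun h => h)) => [||c d]; try by lin.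
cbv beta; rewrite teval_tc; last by lin.
transitivity (teval (W := tensor C D) (fun c1 c2 : C =>
  (counit C c2 : k) *: tens c1 d) (comul C c)).
  apply: eq_teval => c1 c2.
  rewrite -(counit_r (W := tensor C D) (F := fun d : D => (counit C c2 : k) *: tens c1 d));
    last by lin.
  by apply: eq_teval => d1 d2; rewrite tc_counit_tens scalerA mulrC.
by rewrite (counit_r (F := fun c : C => tens c d)) //; lin.
Qed.

Definition tc : coalgebra k := Coalgebra tc_comulA tc_counitl tc_counitr.

End TensorCoalgebra.
End Coalg.

(** By proof irrelevance, equality of such bundled maps is pointwise equality ([lhom_eq]), so
    identities between functionals can be used as equations for rewriting. *)
Record lhom (k : fieldType) (V W : lmodType k) := LHom { hfun :> V -> W; hlin : linear hfun }.
Record bil (k : fieldType) (U V W : lmodType k) := Bil { bfun :> U -> V -> W; bbil : bilin bfun }.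
#[export] Hint Resolve hlin bbil : bil.

Section Convolution.
Variable k : fieldType.
Implicit Types (U V W : lmodType k) (C D E : coalgebra k).

Lemma lhom_eq V W (f g : lhom V W) : f =1 g -> f = g.
Proof.
case: f g => [f lf] [g lg] /= /funext efg; case: _ / efg in lg *.
by congr LHom; apply: Prop_irrelevance.
Qed.

Lemma lhom_tens_eq U V W (f g : lhom (tensor U V) W) :
  (forall u v, f (tens u v) = g (tens u v)) -> f = g.
Proof. by move=> fg; apply/lhom_eq/tens_eq => //; apply: hlin. Qed.

Lemma bil_tens_eq U V W X (f g : lhom (tensor U (tensor V W)) X) :
  (forall u v w, f (tens u (tens v w)) = g (tens u (tens v w))) -> f = g.
Proof.
move=> fg; apply: lhom_tens_eq => u.
by apply: tens_eq => [||v w]; [lin | lin | apply: fg].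
Qed.

Lemma tril_tens_eq U V W X Y (f g : lhom (tensor U (tensor V (tensor W X))) Y) :
  (forall u v w x, f (tens u (tens v (tens w x))) = g (tens u (tens v (tens w x)))) ->
  f = g.
Proof.
move=> fg; apply: bil_tens_eq => u v.
by apply: tens_eq => [||w x]; [lin | lin | apply: fg].
Qed.

Definition lin2 U V W (f : bil U V W) : lhom (tensor U V) W :=
  LHom (teval_linear (bbil f)).
Lemma lin2E U V W (f : bil U V W) u v : lin2 f (tens u v) = f u v.
Proof. by apply: teval_tens; lin. Qed.

Definition hcomp U V W (f : lhom V W) (g : lhom U V) : lhom U W :=
  LHom (lin_comp (hlin f) (hlin g)).
Notation "f \c g" := (hcomp f g) (at level 50, left associativity).

Lemma hcompE U V W (f : lhom V W) (g : lhom U V) x : (f \c g) x = f (g x).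
Proof. by []. Qed.

Fact cv_lin C U V W (op : bil U V W) (F : lhom C U) (G : lhom C V) :
  linear (fun c => teval (fun x y => op (F x) (G y)) (comul C c)).
Proof. by lin. Qed.
(** The pairing [op] is arbitrary because several occur: the product of [B], the actions of [B] on B
    (x) H (x) B, the projection to the diamond product, scalar multiplication. The same lemmas serve
    for all of them. *)
Definition cv C U V W (op : bil U V W) (F : lhom C U) (G : lhom C V) : lhom C W :=
  LHom (cv_lin op F G).

Lemma cvE C U V W (op : bil U V W) (F : lhom C U) (G : lhom C V) c :
  cv op F G c = teval (fun x y => op (F x) (G y)) (comul C c).
Proof. by []. Qed.

(** Coassociativity of [C] combined with one mixed associativity law among four pairings. It
    specialises to associativity in the convolution algebra, to module laws, and to moving a scalar
    across a balanced product. *)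
Lemma cvA C U V W U' V' W' (op1 : bil U' W W') (op2 : bil U V U')
    (op3 : bil U V' W') (op4 : bil V W V') F G K :
  (forall u v w, op1 (op2 u v) w = op3 u (op4 v w)) ->
  cv op1 (cv (C := C) op2 F G) K = cv op3 F (cv op4 G K).
Proof.
move=> opA; apply: lhom_eq => c /=.
transitivity (teval (fun x y => teval (fun x1 x2 => op1 (op2 (F x1) (G x2)) (K y))
  (comul C x)) (comul C c)).
  by apply: eq_teval => x y; rewrite (teval_map (L := fun u => op1 u (K y))) //; lin.
rewrite -coassoc; last by lin.
apply: eq_teval => x y; rewrite (teval_map (L := fun u => op3 (F x) u)); last by lin.
by apply: eq_teval => y1 y2; rewrite opA.
Qed.

Fact cst_lin C V (v : V) : linear (fun c : coalg_sort C => counit C c *: v). Proof. by lin. Qed.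
Definition ccst C V (v : V) : lhom C V := LHom (@cst_lin C V v).

Lemma cv_cstl C U V W (op : bil U V W) u (G : lhom C V) c :
  cv op (ccst C u) G c = op u (G c).
Proof.
rewrite /= -[RHS](counit_l (F := fun c => op u (G c))); last by lin.
by apply: eq_teval => x y; rewrite (linZ _ _ (f := op^~ (G y))) //; lin.
Qed.

Lemma cv_cstr C U V W (op : bil U V W) u (G : lhom C U) c :
  cv op G (ccst C u) c = op (G c) u.
Proof.
rewrite /= -[RHS](counit_r (F := fun c => op (G c) u)); last by lin.
by apply: eq_teval => x y; rewrite (linZ _ _ (f := op (G x))) //; lin.
Qed.

(** Precomposition with a coalgebra map respects convolution ([cv_pull]). Multiplying two
    neighbouring arguments, dropping one or inserting a unit are all of this kind, so identities are
    transported by pulling back. *)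
Record cmap C D := CMap {
  cm :> lhom C D;
  cm_comul : forall c, comul D (cm c) = teval (fun x y => tens (cm x) (cm y)) (comul C c);
  cm_counit : forall c, counit D (cm c) = counit C c }.

Lemma teval_cm C D (p : cmap C D) W (P : D -> D -> W) c : bilin P ->
  teval P (comul D (p c)) = teval (fun x y => P (p x) (p y)) (comul C c).
Proof.
move=> bP; rewrite cm_comul teval_teval //.
by apply: eq_teval => x y; rewrite teval_tens.
Qed.

Lemma cv_pull C D (p : cmap C D) U V W (op : bil U V W) F G :
  cv op F G \c p = cv op (F \c p) (G \c p).
Proof. by apply: lhom_eq => c /=; rewrite teval_cm //; lin. Qed.

Lemma cst_pull C D (p : cmap C D) V (v : V) : ccst D v \c p = ccst C v.
Proof. by apply: lhom_eq => c /=; rewrite cm_counit. Qed.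

Lemma hcompA U V W X (f : lhom W X) (g : lhom V W) (h : lhom U V) : f \c g \c h = f \c (g \c h).
Proof. exact: lhom_eq. Qed.

Fact ccomp_comul C D E (p : cmap D E) (q : cmap C D) c :
  comul E ((p \c q) c) = teval (fun x y => tens ((p \c q) x) ((p \c q) y)) (comul C c).
Proof. by rewrite /= cm_comul teval_cm //; lin. Qed.
Fact ccomp_counit C D E (p : cmap D E) (q : cmap C D) c :
  counit E ((p \c q) c) = counit C c.
Proof. by rewrite /= !cm_counit. Qed.
Definition ccomp C D E (p : cmap D E) (q : cmap C D) : cmap C E :=
  CMap (ccomp_comul p q) (ccomp_counit p q).

Fact cid_comul C c :
  comul C (LHom (@lin_id k C) c) = teval (fun x y =>
    tens (LHom (@lin_id k C) x) (LHom (@lin_id k C) y)) (comul C c).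
Proof. by rewrite /= teval_id. Qed.
Definition idc C : cmap C C := CMap (@cid_comul C) (fun c => erefl).

Lemma tevaltc C D W (P : tensor C D -> tensor C D -> W) c d : bilin P ->
  teval P (comul (tc C D) (tens c d)) = teval (fun c1 c2 =>
     teval (fun d1 d2 => P (tens c1 d1) (tens c2 d2)) (comul D d)) (comul C c).
Proof. exact: teval_tc. Qed.

Lemma counit_tc C D c d : counit (tc C D) (tens c d) = counit C c * counit D d.
Proof. exact: tc_counit_tens. Qed.

Lemma tensZ (M N : lmodType k) (a b : k) (m : M) (n : N) :
  tens (a *: m) (b *: n) = (a * b) *: tens m n.
Proof.
rewrite (linZ b n (f := tens (a *: m))); last by lin.
by rewrite (linZ a m (f := fun x => tens x n)) ?scalerA 1?mulrC //; lin.
Qed.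

Section Maps.
Variables C D : coalgebra k.

Fact pl_bil : bilin (fun (c : C) (d : D) => counit D d *: c). Proof. by lin. Qed.
Definition pl_hom : lhom (tc C D) C := lin2 (Bil pl_bil).
Lemma pl_homE c d : pl_hom (tens c d) = counit D d *: c. Proof. exact: (lin2E (Bil pl_bil)). Qed.

Fact pl_comul x : comul C (pl_hom x) = teval
  (fun x y => tens (pl_hom x) (pl_hom y)) (comul (tc C D) x).
Proof.
move: x; apply: tens_eq => [||c d]; [by lin | by lin | cbv beta].
rewrite tevaltc; last by lin.
rewrite pl_homE (linZ _ _ (f := comul C)); last by lin.
rewrite -[in LHS](teval_id (comul C c)) teval_map; last by lin.
apply: eq_teval => x y.
rewrite -[in LHS](counit_l d (F := counit D)); last by lin.
rewrite (teval_map (L := fun a : k^o => (a : k) *: tens x y)); last by lin.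
apply: eq_teval => d1 d2; rewrite !pl_homE.
by rewrite tensZ.
Qed.
Fact pl_counit x : counit C (pl_hom x) = counit (tc C D) x.
Proof.
move: x; apply: tens_eq => [||c d]; [by lin | by lin | cbv beta].
by rewrite pl_homE linearZ counit_tc /= mulrC.
Qed.
Definition pl : cmap (tc C D) C := CMap pl_comul pl_counit.
Lemma plE c d : pl (tens c d) = counit D d *: c. Proof. exact: pl_homE. Qed.

Fact pr_bil : bilin (fun (c : C) (d : D) => counit C c *: d). Proof. by lin. Qed.
Definition pr_hom : lhom (tc C D) D := lin2 (Bil pr_bil).
Lemma pr_homE c d : pr_hom (tens c d) = counit C c *: d. Proof. exact: (lin2E (Bil pr_bil)). Qed.

Fact pr_comul x : comul D (pr_hom x) = teval
  (fun x y => tens (pr_hom x) (pr_hom y)) (comul (tc C D) x).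
Proof.
move: x; apply: tens_eq => [||c d]; [by lin | by lin | cbv beta].
rewrite tevaltc; last by lin.
rewrite teval_exch pr_homE (linZ _ _ (f := comul D)); last by lin.
rewrite -[in LHS](teval_id (comul D d)) teval_map; last by lin.
apply: eq_teval => x y.
rewrite -[in LHS](counit_l c (F := counit C)); last by lin.
rewrite (teval_map (L := fun a : k^o => (a : k) *: tens x y)); last by lin.
apply: eq_teval => d1 d2; rewrite !pr_homE.
by rewrite tensZ.
Qed.
Fact pr_counit x : counit D (pr_hom x) = counit (tc C D) x.
Proof.
move: x; apply: tens_eq => [||c d]; [by lin | by lin | cbv beta].
by rewrite pr_homE linearZ counit_tc.
Qed.
Definition pr : cmap (tc C D) D := CMap pr_comul pr_counit.
Lemma prE c d : pr (tens c d) = counit C c *: d. Proof. exact: pr_homE. Qed.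
End Maps.

Section TensorMap.
Variables (C D C' D' : coalgebra k) (p : cmap C C') (q : cmap D D').
Fact tm_bil : bilin (fun (c : C) (d : D) => tens (p c) (q d)). Proof. by lin. Qed.
Definition tm_hom : lhom (tc C D) (tc C' D') := lin2 (Bil tm_bil).
Lemma tm_homE c d : tm_hom (tens c d) = tens (p c) (q d). Proof. exact: (lin2E (Bil tm_bil)). Qed.
Fact tm_comul x : comul (tc C' D') (tm_hom x) =
  teval (fun x y => tens (tm_hom x) (tm_hom y)) (comul (tc C D) x).
Proof.
move: x; apply: tens_eq => [||c d]; [by lin | by lin | cbv beta].
rewrite tevaltc; last by lin.
rewrite tm_homE -[LHS]teval_id tevaltc; last by lin.
rewrite teval_cm; last by lin.
apply: eq_teval => x y; rewrite teval_cm; last by lin.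
by apply: eq_teval => x' y'; rewrite !tm_homE.
Qed.
Fact tm_counit x : counit (tc C' D') (tm_hom x) = counit (tc C D) x.
Proof.
move: x; apply: tens_eq => [||c d]; [by lin | by lin | cbv beta].
by rewrite tm_homE !counit_tc !cm_counit.
Qed.
Definition tm : cmap (tc C D) (tc C' D') := CMap tm_comul tm_counit.
Lemma tmE c d : tm (tens c d) = tens (p c) (q d). Proof. exact: tm_homE. Qed.
End TensorMap.

Section PartialConv.
Variables (C D : coalgebra k) (U V W : lmodType k) (op : bil U V W).

Lemma cv_tens (F : lhom (tc C D) U) (G : lhom (tc C D) V) c d :
  cv op F G (tens c d) = teval (fun c1 c2 => teval (fun d1 d2 =>
     op (F (tens c1 d1)) (G (tens c2 d2))) (comul D d)) (comul C c).
Proof. by rewrite /= tevaltc //; lin. Qed.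

(** A factor that ignores [d] puts a counit on one leg of [d], so only [c] is really split. The four
    variants keep the number of sums equal to that in the explicit formulas. *)
Lemma cv_pll (F : lhom C U) (G : lhom (tc C D) V) c d :
  cv op (F \c pl C D) G (tens c d) = teval (fun c1 c2 => op (F c1) (G (tens c2 d))) (comul C c).
Proof.
rewrite cv_tens; apply: eq_teval => c1 c2.
rewrite -[RHS](counit_l d (F := fun d => op (F c1) (G (tens c2 d)))); last by lin.
apply: eq_teval => d1 d2; rewrite hcompE plE.
rewrite (linZ _ _ (f := F)); last by lin.
by rewrite -(linZ _ _ (f := op^~ _)) //; lin.
Qed.

Lemma cv_plr (F : lhom C V) (G : lhom (tc C D) U) c d :
  cv op G (F \c pl C D) (tens c d) = teval (fun c1 c2 => op (G (tens c1 d)) (F c2)) (comul C c).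
Proof.
rewrite cv_tens; apply: eq_teval => c1 c2.
rewrite -[RHS](counit_r d (F := fun d => op (G (tens c1 d)) (F c2))); last by lin.
apply: eq_teval => d1 d2; rewrite hcompE plE.
rewrite (linZ _ _ (f := F)); last by lin.
by rewrite -(linZ _ _ (f := op _)) //; lin.
Qed.

Lemma cv_prl (F : lhom D U) (G : lhom (tc C D) V) c d :
  cv op (F \c pr C D) G (tens c d) = teval (fun d1 d2 => op (F d1) (G (tens c d2))) (comul D d).
Proof.
rewrite cv_tens teval_exch; apply: eq_teval => c1 c2.
rewrite -[RHS](counit_l c (F := fun d => op (F c1) (G (tens d c2)))); last by lin.
apply: eq_teval => d1 d2; rewrite hcompE prE.
rewrite (linZ _ _ (f := F)); last by lin.
by rewrite -(linZ _ _ (f := op^~ _)) //; lin.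
Qed.

Lemma cv_prr (F : lhom D V) (G : lhom (tc C D) U) c d :
  cv op G (F \c pr C D) (tens c d) = teval (fun d1 d2 => op (G (tens c d1)) (F d2)) (comul D d).
Proof.
rewrite cv_tens teval_exch; apply: eq_teval => c1 c2.
rewrite -[RHS](counit_r c (F := fun d => op (G (tens d c1)) (F c2))); last by lin.
apply: eq_teval => d1 d2; rewrite hcompE prE.
rewrite (linZ _ _ (f := F)); last by lin.
by rewrite -(linZ _ _ (f := op _)) //; lin.
Qed.

End PartialConv.

End Convolution.

Notation "f \c g" := (hcomp f g) (at level 50, left associativity).

#[export] Hint Resolve hmul_bilin phi_trilin phiV_trilin : bil.

Section BtensorTheory.
Variables (k : fieldType) (B : Type) (M N : lmodType k).
Variables (f : B -> M -> M) (g : B -> N -> N).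

Lemma btens_bilin : bilin (btens f g).
Proof.
by split=> [m|n]; apply: lin_comp; try apply: cls_linear; case: (tens_bilin M N).
Qed.

Lemma btens_bal b m n : btens f g (f b m) n = btens f g m (g b n).
Proof. by apply/cls_eq/gen_submodule_sub; exists b, m, n. Qed.

Lemma beval_lin (W : lmodType k) (F : M -> N -> W) : bilin F ->
  (forall b m n, F (f b m) n = F m (g b n)) -> linear (beval (f := f) (g := g) F).
Proof.
move=> bF Fb a u v; rewrite -[u]repK -[v]repK -(cls_linear (btensor_rel f g)) /beval.
have E w : teval F (rep (cls (btensor_rel f g) w)) = teval F w.
  apply: (quot_modP (f := teval F)); first exact: teval_linear.
  move=> _ [b [m [n ->]]].
  by rewrite addrC -scaleN1r teval_linear // !teval_tens // Fb scaleN1r addNr.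
by rewrite !E teval_linear.
Qed.

Lemma btens_eq (W : lmodType k) (F G : btensor f g -> W) :
  linear F -> linear G -> (forall m n, F (btens f g m n) = G (btens f g m n)) -> F =1 G.
Proof.
move=> lF lG FG u; rewrite -[u]repK.
have lc : linear (cls (btensor_rel f g)) by apply: cls_linear.
exact: (tens_eq (lin_comp lF lc) (lin_comp lG lc) FG).
Qed.
End BtensorTheory.
#[export] Hint Resolve btens_bilin : bil.

Lemma mul_bilin (k : fieldType) (A : algType k) : bilin (fun a b : A => a * b).
Proof. by lin. Qed.
Definition mA (k : fieldType) (A : algType k) : bil A A A := Bil (mul_bilin A).

Section ConvAlgebra.
Variables (k : fieldType) (C : coalgebra k) (A : algType k).
Implicit Types x y z : lhom C A.
Definition cm1 : lhom C A := ccst C (1 : A).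
Definition cvm x y : lhom C A := cv (mA A) x y.
Lemma cvmA x y z : cvm x (cvm y z) = cvm (cvm x y) z.
Proof. by symmetry; apply: cvA => u v w; rewrite /= mulrA. Qed.
Lemma cvm1l x : cvm cm1 x = x.
Proof. by apply: lhom_eq => c; rewrite /cvm cv_cstl /= mul1r. Qed.
Lemma cvm1r x : cvm x cm1 = x.
Proof. by apply: lhom_eq => c; rewrite /cvm cv_cstr /= mulr1. Qed.
End ConvAlgebra.
Arguments cm1 {k C A}.
Notation "x ** y" := (cvm x y) (at level 40, left associativity).

Section ConvPull.
Variables (k : fieldType) (C D : coalgebra k) (p : cmap C D).
Lemma cvm_pull (A : algType k) (x y : lhom D A) : (x ** y) \c p = (x \c p) ** (y \c p).
Proof. exact: cv_pull. Qed.
Lemma cm1_pull (A : algType k) : (cm1 : lhom D A) \c p = cm1.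
Proof. exact: cst_pull. Qed.
End ConvPull.

Section ConvLinear.
Variables (k : fieldType) (C : coalgebra k).
Implicit Types U V W : lmodType k.

Definition bilr U V W (op : bil U V W) u : lhom V W := LHom (proj1 (bbil op) u).

Lemma lhom_cvr U V V' W W' (op : bil U V W) (op' : bil U V' W') (f : lhom W W')
    (g : lhom V V') (F : lhom C U) (G : lhom C V) :
  (forall u v, f (op u v) = op' u (g v)) -> f \c cv op F G = cv op' F (g \c G).
Proof.
move=> E; apply: lhom_eq => c /=; rewrite teval_map; last by lin.
by apply: eq_teval => x y; rewrite E.
Qed.

Lemma lhom_cvl U U' V W W' (op : bil U V W) (op' : bil U' V W') (f : lhom W W')
    (g : lhom U U') (F : lhom C U) (G : lhom C V) :
  (forall u v, f (op u v) = op' (g u) v) -> f \c cv op F G = cv op' (g \c F) G.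
Proof.
move=> E; apply: lhom_eq => c /=; rewrite teval_map; last by lin.
by apply: eq_teval => x y; rewrite E.
Qed.

End ConvLinear.

(** Moves the sum at depth [n] of the left-hand side to the front by [n] exchanges. *)
Ltac pullout n :=
  lazymatch n with
  | 0%N => idtac
  | S ?m => etransitivity;
     [apply: eq_teval; intros ? ?; pullout m; reflexivity
     | cbv beta; etransitivity; [apply: teval_exch | cbv beta]]
  end.

(** Unless a sum already stands in front of the right-hand side, brings one out of its interior by
    linearity of the surrounding context. [match_teval] then compares the summands of the two
    outermost sums; long Sweedler identities are checked by aligning sums one at a time. *)
Ltac push :=
  match goal with
  | |- _ = teval _ _ => idtac
  | |- _ = ?r =>
    match r with context E [@teval ?k ?M ?N ?W ?F ?t] =>
      let L := constr:(fun X : W => ltac:(let e := context E [X] in exact e)) in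
      transitivity (teval (fun x y => L (F x y)) t);
      [cbv beta | symmetry; apply: (teval_map (L := L)); cbv beta; lin]
    end
  end.
Ltac match_teval := push; apply: eq_teval; intros ? ?.

Lemma tens3_eq (k : fieldType) (U V W X : lmodType k) (f g : tensor U (tensor V W) -> X) :
  linear f -> linear g ->
  (forall u v w, f (tens u (tens v w)) = g (tens u (tens v w))) -> f =1 g.
Proof.
move=> lf lg fg x.
by have /(congr1 (@hfun _ _ _)) /= -> := bil_tens_eq (f := LHom lf) (g := LHom lg) fg.
Qed.

Section Maps.
Variables (k : fieldType) (H : coquasi_bialgebra k).
Local Notation T2 := (tc H H).
Local Notation T3 := (tc H (tc H H)).

Fact hmul_bil : bilin (hmul (c := H)). Proof. exact: hmul_bilin. Qed.
Definition mul_hom : lhom T2 H := lin2 (Bil hmul_bil).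
Lemma mul_homE h g : mul_hom (tens h g) = hmul h g. Proof. exact: (lin2E (Bil hmul_bil)). Qed.
Fact mul_comul x : comul H (mul_hom x) = teval
  (fun x y => tens (mul_hom x) (mul_hom y)) (comul T2 x).
Proof.
move: x; apply: tens_eq => [||h g]; [by lin|by lin|].
cbv beta; rewrite tevaltc; last by lin.
rewrite mul_homE comul_hmul; unsw; apply: eq_teval => h1 h2; apply: eq_teval => g1 g2.
by rewrite !mul_homE.
Qed.
Fact mul_counit x : counit H (mul_hom x) = counit T2 x.
Proof.
move: x; apply: tens_eq => [||h g]; [by lin|by lin|].
by rewrite mul_homE counit_hmul counit_tc.
Qed.
Definition mulc : cmap T2 H := CMap mul_comul mul_counit.
Lemma mulcE h g : mulc (tens h g) = hmul h g. Proof. exact: mul_homE. Qed.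

Section M12.
Variable D : coalgebra k.
Fact m12_bil : bilin (fun (h : H) (t : tc H D) => teval (fun g d => tens (hmul h g) d) t).
Proof. by lin. Qed.
Definition m12_hom : lhom (tc H (tc H D)) (tc H D) := lin2 (Bil m12_bil).
Lemma m12_homE h g d : m12_hom (tens h (tens g d)) = tens (hmul h g) d.
Proof. by rewrite [LHS](lin2E (Bil m12_bil)) /= teval_tens //; lin. Qed.
Fact m12_comul x : comul (tc H D) (m12_hom x)
  = teval (fun x y => tens (m12_hom x) (m12_hom y)) (comul (tc H (tc H D)) x).
Proof.
move: x; apply: tens3_eq => [||h g d]; [by lin|by lin|cbv beta].
rewrite tevaltc; last by lin.
rewrite m12_homE -[LHS]teval_id tevaltc; last by lin.
rewrite -[comul H (hmul h g)]teval_id comul_hmul; unsw; rewrite !teval_teval; try by lin.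
apply: eq_teval => h1 h2; rewrite tevaltc; last by lin.
rewrite !teval_teval; try by lin.
apply: eq_teval => g1 g2; rewrite !teval_tens; try by lin.
by apply: eq_teval => d1 d2; rewrite !m12_homE.
Qed.
Fact m12_counit x : counit (tc H D) (m12_hom x) = counit (tc H (tc H D)) x.
Proof.
move: x; apply: tens3_eq => [||h g d]; [by lin|by lin|cbv beta].
by rewrite m12_homE !counit_tc counit_hmul mulrA.
Qed.
Definition m12 : cmap (tc H (tc H D)) (tc H D) := CMap m12_comul m12_counit.
Lemma m12E h g d : m12 (tens h (tens g d)) = tens (hmul h g) d. Proof. exact: m12_homE. Qed.

(* (h, g, d) |-> (h, g), forgetting d through the counit *)
Definition p12 : cmap (tc H (tc H D)) T2 := tm (idc H) (pl H D).
Lemma p12E h g d : p12 (tens h (tens g d)) = (counit D d : k) *: tens h g.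
Proof. by rewrite /p12 tmE plE (linZ _ _ (f := tens h)) //; lin. Qed.
End M12.
End Maps.

Section PartialConv2.
Variables (k : fieldType) (C D E : coalgebra k) (U V W : lmodType k) (op : bil U V W).

Fact slice_lin (F : lhom (tc C D) U) c : linear (fun d => F (tens c d)). Proof. by lin. Qed.
Definition slice (F : lhom (tc C D) U) c : lhom D U := LHom (slice_lin F c).
Lemma sliceE (F : lhom (tc C D) U) c d : slice F c d = F (tens c d).
Proof. by []. Qed.
End PartialConv2.
Section PartialConv2'.
Variables (k : fieldType) (C D E : coalgebra k) (U V W : lmodType k) (op : bil U V W).
Lemma cv_slice (F : lhom (tc C D) U) (G : lhom (tc C D) V) c d :
  cv op F G (tens c d) = teval (fun c1 c2 => cv op (slice F c1) (slice G c2) d) (comul C c).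
Proof. exact: cv_tens. Qed.

End PartialConv2'.

Section PartialConv3.
Variables (k : fieldType) (C D E : coalgebra k) (U V W : lmodType k) (op : bil U V W).

Lemma cv_tens3 (F : lhom (tc C (tc D E)) U) (G : lhom (tc C (tc D E)) V) c d e :
  cv op F G (tens c (tens d e)) = teval (fun c1 c2 => teval (fun d1 d2 => teval (fun e1 e2 =>
     op (F (tens c1 (tens d1 e1))) (G (tens c2 (tens d2 e2)))) (comul E e)) (comul D d)) (comul C c).
Proof. by rewrite cv_slice; apply: eq_teval => c1 c2; rewrite cv_tens. Qed.

Lemma slice_p12 (F : lhom (tc C D) U) c :
  slice (F \c tm (idc C) (pl D E)) c = slice F c \c pl D E.
Proof. by apply: lhom_eq => d; rewrite -[LHS]/(F (tm (idc C) (pl D E) (tens c d))) tmE. Qed.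

Lemma cv_p12l (F : lhom (tc C D) U) (G : lhom (tc C (tc D E)) V) c d e :
  cv op (F \c tm (idc C) (pl D E)) G (tens c (tens d e)) =
  teval (fun c1 c2 => teval (fun d1 d2 => op (F (tens c1 d1)) (G (tens c2 (tens d2 e))))
    (comul D d)) (comul C c).
Proof.
by rewrite cv_slice; apply: eq_teval => c1 c2; rewrite slice_p12 cv_pll.
Qed.

Lemma cv_p12r (F : lhom (tc C D) V) (G : lhom (tc C (tc D E)) U) c d e :
  cv op G (F \c tm (idc C) (pl D E)) (tens c (tens d e)) =
  teval (fun c1 c2 => teval (fun d1 d2 => op (G (tens c1 (tens d1 e))) (F (tens c2 d2)))
    (comul D d)) (comul C c).
Proof.
rewrite cv_slice; apply: eq_teval => c1 c2.
have -> : slice (F \c tm (idc C) (pl D E)) c2 = slice F c2 \c pl D E.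
  by apply: lhom_eq => x; rewrite -[LHS]/(F (tm (idc C) (pl D E) (tens c2 x))) tmE.
by rewrite cv_plr.
Qed.
End PartialConv3.

Section ConvInverse.
Variables (k : fieldType) (C : coalgebra k) (A : algType k).
Implicit Types x y z : lhom C A.

Lemma cvmK x xV y : xV ** x = cm1 -> y ** xV ** x = y.
Proof. by move=> e; rewrite -cvmA e cvm1r. Qed.
Lemma cvmKl x xV y : xV ** x = cm1 -> xV ** (x ** y) = y.
Proof. by move=> e; rewrite cvmA e cvm1l. Qed.
Lemma cvm_invC x xV y : x ** xV = cm1 -> xV ** x = cm1 -> x ** y = y ** x -> xV ** y = y ** xV.
Proof.
move=> e1 e2 c; rewrite -[LHS]cvm1r -e1 -cvmA (cvmA y) -c -(cvmA x) (cvmA xV x) e2 cvm1l //.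
Qed.
Lemma cvm_inv1 x xV : xV ** x = cm1 -> x = cm1 -> xV = cm1.
Proof. by move=> e x1; move: e; rewrite x1 cvm1r. Qed.
Lemma cvm_idem1 x xV : xV ** x = cm1 -> x ** x = x -> x = cm1.
Proof. by move=> e i; rewrite -[x]cvm1l -e -cvmA i e. Qed.
Lemma cvm_invU x y z : x ** y = cm1 -> z ** x = cm1 -> y = z.
Proof. by move=> e1 e2; rewrite -[y]cvm1l -e2 -cvmA e1 cvm1r. Qed.
End ConvInverse.

Section UnitMaps.
Variables (k : fieldType) (H : coquasi_bialgebra k) (C : coalgebra k).
Local Notation one := (hone H).
Fact u1_lin : linear (fun c : C => tens one c). Proof. by lin. Qed.
Fact u1_comul c : comul (tc H C) (LHom u1_lin c)
  = teval (fun x y => tens (LHom u1_lin x) (LHom u1_lin y)) (comul C c).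
Proof. by rewrite -[LHS]teval_id tevaltc ?comul_hone ?teval_tens //; lin. Qed.
Fact u1_counit c : counit (tc H C) (LHom u1_lin c) = counit C c.
Proof. by rewrite counit_tc counit_hone mul1r. Qed.
(** The unit is grouplike, so inserting it is a coalgebra map, and unitality of gamma says that its
    pullbacks along [u1] and [ur] are the convolution unit. *)
Definition u1 : cmap C (tc H C) := CMap u1_comul u1_counit.
Fact ur_lin : linear (fun c : C => tens c one). Proof. by lin. Qed.
Fact ur_comul c : comul (tc C H) (LHom ur_lin c)
  = teval (fun x y => tens (LHom ur_lin x) (LHom ur_lin y)) (comul C c).
Proof.
rewrite -[LHS]teval_id tevaltc; last by lin.
by apply: eq_teval => x y; rewrite comul_hone teval_tens //; lin.
Qed.
Fact ur_counit c : counit (tc C H) (LHom ur_lin c) = counit C c.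
Proof. by rewrite counit_tc counit_hone mulr1. Qed.
Definition ur : cmap C (tc C H) := CMap ur_comul ur_counit.
Lemma u1E c : u1 c = tens one c. Proof. by []. Qed.
Lemma urE c : ur c = tens c one. Proof. by []. Qed.
End UnitMaps.

Lemma hlinZ (k : fieldType) (V W : lmodType k) (F : lhom V W) a u : F (a *: u) = a *: F u.
Proof. by apply: linZ; lin. Qed.

(** * Convolution products along antipodes *)

Section AntipodeSums.
Variables (k : fieldType) (H : coquasi_bialgebra k).
Local Notation T2 := (tc H H).
Local Notation T3 := (tc H (tc H H)).

(** From two halves that are split separately to two outer legs around a split middle one. An
    antihomomorphism makes exactly the two middle legs meet, and the antipode axiom can then be
    applied to their common origin. *)
Lemma coassoc4 (W : lmodType k) (P : H -> H -> H -> H -> W) h :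
  (forall a, trilin (P a)) -> (forall b c d, linear (fun a => P a b c d)) ->
  teval (fun x y => teval (fun x1 x2 => teval (P x1 x2) (comul H y)) (comul H x)) (comul H h)
  = teval (fun h1 h' => teval (fun m h3 => teval (fun a b => P h1 a b h3) (comul H m))
      (comul H h')) (comul H h).
Proof.
move=> tP lP.
rewrite -(coassoc (F := fun x1 x2 y => teval (P x1 x2) (comul H y))).
  by apply: eq_teval => h1 h'; rewrite coassoc.
have b12 a c : linear (fun b => teval (P a b) (comul H c)).
  by apply: lin_tevalF => x y; case: (tP a).
split=> [a b|a c|b c].
- by apply: lin_tevalA; [case: (tP a) => *; split | ]; lin.
- exact: b12.
- by apply: lin_tevalF.
Qed.

Section Anti.
Variable S : lhom H H.
Hypothesis S_comul : forall h,
  comul H (S h) = teval (fun x y => tens (S y) (S x)) (comul H h).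
Local Notation one := (hone H).

Lemma teval_S (W : lmodType k) (P : H -> H -> W) h : bilin P ->
  teval P (comul H (S h)) = teval (fun x y => P (S y) (S x)) (comul H h).
Proof.
move=> bP; rewrite S_comul teval_teval //; apply: eq_teval => x y.
by rewrite teval_tens.
Qed.

Fact idS_lin : linear (fun h => teval (fun x y => tens x (S y)) (comul H h) : T2).
Proof. by lin. Qed.
Definition idS : lhom H T2 := LHom idS_lin.
Fact Sid_lin : linear (fun h => teval (fun x y => tens (S x) y) (comul H h) : T2).
Proof. by lin. Qed.
Definition Sid : lhom H T2 := LHom Sid_lin.
Fact idSid_lin : linear (fun h => teval (fun x y => tens x (Sid y)) (comul H h) : T3).
Proof. by lin. Qed.
Definition idSid : lhom H T3 := LHom idSid_lin.

Lemma idSE h : idS h = teval (fun x y => tens x (S y)) (comul H h). Proof. by []. Qed.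
Lemma SidE h : Sid h = teval (fun x y => tens (S x) y) (comul H h). Proof. by []. Qed.
Lemma idSidE h : idSid h = teval (fun x y => tens x (Sid y)) (comul H h). Proof. by []. Qed.

Section Conv.
Variables (U V W : lmodType k) (op : bil U V W).

(** The map [idS] is not a coalgebra map because [S] reverses coproducts. The legs of a convolution
    product therefore come out nested: here [F] sees the outer pair and [G] the inner one; for [Sid]
    it is the other way round. *)
Lemma cv_idS (F : lhom T2 U) (G : lhom T2 V) h : cv op F G (idS h)
  = teval (fun h1 h' => teval (fun m h3 => op (F (tens h1 (S h3))) (G (idS m))) (comul H h')) (comul H h).
Proof.
transitivity (teval (fun x y => teval (fun x1 x2 => teval (fun y1 y2 =>
   op (F (tens x1 (S y2))) (G (tens x2 (S y1)))) (comul H y)) (comul H x)) (comul H h)).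
  rewrite idSE (teval_map (L := cv op F G)); last by lin.
  apply: eq_teval => x y; rewrite cv_tens; apply: eq_teval => x1 x2.
  by rewrite teval_S; last by lin.
rewrite (coassoc4 (P := fun x1 x2 y1 y2 => op (F (tens x1 (S y2))) (G (tens x2 (S y1)))));
  [|by move=> *; lin|by move=> *; lin].
by do 2 (apply: eq_teval => ? ?); rewrite idSE (teval_map (L := fun t => op _ (G t))); last by lin.
Qed.

Lemma cv_Sid (F : lhom T2 U) (G : lhom T2 V) h : cv op F G (Sid h)
  = teval (fun h1 h' => teval (fun m h3 => op (F (Sid m)) (G (tens (S h1) h3))) (comul H h')) (comul H h).
Proof.
transitivity (teval (fun x y => teval (fun x1 x2 => teval (fun y1 y2 =>
   op (F (tens (S x2) y1)) (G (tens (S x1) y2))) (comul H y)) (comul H x)) (comul H h)).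
  rewrite SidE (teval_map (L := cv op F G)); last by lin.
  by apply: eq_teval => x y; rewrite cv_tens teval_S; last by lin.
rewrite (coassoc4 (P := fun x1 x2 y1 y2 => op (F (tens (S x2) y1)) (G (tens (S x1) y2))));
  [|by move=> *; lin|by move=> *; lin].
by do 2 (apply: eq_teval => ? ?); rewrite SidE (teval_map (L := fun t => op (F t) _)); last by lin.
Qed.

End Conv.

Section Antipode.
Hypothesis S_r : forall h, teval (fun x y => hmul x (S y)) (comul H h) = (counit H h : k) *: one.
Hypothesis S_l : forall h, teval (fun x y => hmul (S x) y) (comul H h) = (counit H h : k) *: one.

Lemma mul_idS h : mulc H (idS h) = (counit H h : k) *: one.
Proof.
rewrite idSE (teval_map (L := mulc H)); last by lin.
by rewrite -S_r; apply: eq_teval => x y; rewrite mulcE.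
Qed.
Lemma mul_Sid h : mulc H (Sid h) = (counit H h : k) *: one.
Proof.
rewrite SidE (teval_map (L := mulc H)); last by lin.
by rewrite -S_l; apply: eq_teval => x y; rewrite mulcE.
Qed.

Section Collapse.
Variables (U V W : lmodType k) (op : bil U V W).

(** Here [F] sits on the inner pair S(h2) (x) h3, whose product is a multiple of the unit by the
    counit. *)
Lemma cv_Sid_mul (F : lhom H U) (G : lhom T2 V) h :
  cv op (F \c mulc H) G (Sid h) = op (F one) (G (Sid h)).
Proof.
rewrite cv_Sid SidE (teval_map (L := fun t => op (F one) (G t))); last by lin.
apply: eq_teval => h1 h'; rewrite -[RHS](counit_l (F := fun h' => op (F one) (G (tens (S h1) h'))));
  last by lin.
apply: eq_teval => m h3; rewrite hcompE mul_Sid !hlinZ.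
by rewrite (linZ _ _ (f := fun x => op x _)); last by lin.
Qed.

Lemma cv_idSid_p12 (F : lhom T3 U) (G : lhom T2 V) h :
  cv op F (G \c p12 H H) (idSid h)
  = teval (fun h1 h' => teval (fun m h3 => op (F (tens h1 (Sid h3))) (G (idS m)))
      (comul H h')) (comul H h).
Proof.
transitivity (teval (fun x y => teval (fun x1 x2 => teval (fun y1 y2 =>
    op (F (tens x1 (Sid y2))) (G (tens x2 (S y1)))) (comul H y)) (comul H x)) (comul H h)).
  rewrite idSidE (teval_map (L := cv op F (G \c p12 H H))); last by lin.
  apply: eq_teval => x y; rewrite cv_slice; apply: eq_teval => x1 x2.
  rewrite cv_Sid; apply: eq_teval => y1 y'.
  rewrite -[RHS](counit_r (F := fun y2 => op (F (tens x1 (Sid y2))) (G (tens x2 (S y1)))));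
    last by lin.
  apply: eq_teval => m y3; rewrite !sliceE [(G \c _) _]hcompE p12E hlinZ.
  by rewrite (linZ _ _ (f := op _)); last by lin.
rewrite (coassoc4 (P := fun x1 x2 y1 y2 => op (F (tens x1 (Sid y2))) (G (tens x2 (S y1)))));
  [|by move=> *; lin|by move=> *; lin].
by do 2 (apply: eq_teval => ? ?); rewrite idSE (teval_map (L := fun t => op _ (G t))); last by lin.
Qed.

(** At h1 (x) S(h2) (x) h3, both multiplying the last two entries and multiplying the first two give
    a counit, so both factors collapse. One side of the cocycle identity [cocycle_gV] has exactly
    this shape. *)
Lemma cv_idSid_mul (F : lhom T2 U) (G : lhom T2 V) h :
  cv op (F \c tm (idc H) (mulc H)) (G \c m12 H H) (idSid h)
  = teval (fun h1 h2 => op (F (tens h1 one)) (G (tens one h2))) (comul H h).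
Proof.
transitivity (teval (fun x y => teval (fun x1 x2 => teval (fun y1 y2 =>
    op (F (tens x1 one)) (G (tens (hmul x2 (S y1)) y2))) (comul H y)) (comul H x)) (comul H h)).
  rewrite idSidE (teval_map (L := cv op _ _)); last by lin.
  apply: eq_teval => x y; rewrite cv_slice; apply: eq_teval => x1 x2.
  have -> : slice (F \c tm (idc H) (mulc H)) x1 = slice F x1 \c mulc H.
    by apply: lhom_eq => t; rewrite sliceE hcompE tmE [RHS]hcompE sliceE.
  rewrite cv_Sid_mul !sliceE hcompE SidE (teval_map (L := fun t => op _ (G (m12 H H (tens x2 t)))));
    last by lin.
  by apply: eq_teval => y1 y2; rewrite m12E.
rewrite (coassoc4 (P := fun x1 x2 y1 y2 => op (F (tens x1 one)) (G (tens (hmul x2 (S y1)) y2))));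
  [|by move=> *; lin|by move=> *; lin].
apply: eq_teval => h1 h'.
rewrite -[RHS](counit_l (F := fun h2 => op (F (tens h1 one)) (G (tens one h2)))); last by lin.
apply: eq_teval => m h3; transitivity (op (F (tens h1 one)) (G (tens ((counit H m : k) *: one) h3))).
  by rewrite -S_r (teval_map (L := fun t => op (F (tens h1 one)) (G (tens t h3)))); last by lin.
by rewrite (linZ _ _ (f := fun t => op (F (tens h1 one)) (G (tens t h3)))); last by lin.
Qed.

End Collapse.
End Antipode.
End Anti.

(** * Mirrored sums, for a map T with h2 T(h1) = eps(h) 1 = T(h2) h1 *)

Section Opposite.
Variable T : lhom H H.
Hypothesis T_comul : forall h,
  comul H (T h) = teval (fun x y => tens (T y) (T x)) (comul H h).
Hypothesis T_r : forall h, teval (fun x y => hmul y (T x)) (comul H h) = (counit H h : k) *: hone H.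
Hypothesis T_l : forall h, teval (fun x y => hmul (T y) x) (comul H h) = (counit H h : k) *: hone H.
Local Notation one := (hone H).

Fact idT_lin : linear (fun h => teval (fun x y => tens y (T x)) (comul H h) : T2).
Proof. by lin. Qed.
Definition idT : lhom H T2 := LHom idT_lin.
Fact Tid_lin : linear (fun h => teval (fun x y => tens (T y) x) (comul H h) : T2).
Proof. by lin. Qed.
Definition Tid : lhom H T2 := LHom Tid_lin.
Fact idTid_lin : linear (fun h => teval (fun x y => tens y (Tid x)) (comul H h) : T3).
Proof. by lin. Qed.
Definition idTid : lhom H T3 := LHom idTid_lin.

Lemma idTE h : idT h = teval (fun x y => tens y (T x)) (comul H h). Proof. by []. Qed.
Lemma TidE h : Tid h = teval (fun x y => tens (T y) x) (comul H h). Proof. by []. Qed.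
Lemma idTidE h : idTid h = teval (fun x y => tens y (Tid x)) (comul H h). Proof. by []. Qed.

Lemma mul_idT h : mulc H (idT h) = (counit H h : k) *: one.
Proof.
rewrite idTE (teval_map (L := mulc H)); last by lin.
by rewrite -T_r; apply: eq_teval => x y; rewrite mulcE.
Qed.
Lemma mul_Tid h : mulc H (Tid h) = (counit H h : k) *: one.
Proof.
rewrite TidE (teval_map (L := mulc H)); last by lin.
by rewrite -T_l; apply: eq_teval => x y; rewrite mulcE.
Qed.

Section Collapse.
Variables (U V W : lmodType k) (op : bil U V W).

Lemma cv_idT (F : lhom T2 U) (G : lhom T2 V) h : cv op F G (idT h)
  = teval (fun h1 h' => teval (fun m h3 => op (F (idT m)) (G (tens h3 (T h1)))) (comul H h')) (comul H h).
Proof.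
transitivity (teval (fun x y => teval (fun x1 x2 => teval (fun y1 y2 =>
   op (F (tens y1 (T x2))) (G (tens y2 (T x1)))) (comul H y)) (comul H x)) (comul H h)).
  rewrite idTE (teval_map (L := cv op F G)); last by lin.
  apply: eq_teval => x y; rewrite cv_tens teval_exch (teval_S T_comul) //.
  by split=> *; apply: lin_tevalF => *; lin.
rewrite (coassoc4 (P := fun x1 x2 y1 y2 => op (F (tens y1 (T x2))) (G (tens y2 (T x1)))));
  [|by move=> *; lin|by move=> *; lin].
by do 2 (apply: eq_teval => ? ?); rewrite idTE (teval_map (L := fun t => op (F t) _)); last by lin.
Qed.

Lemma cv_Tid (F : lhom T2 U) (G : lhom T2 V) h : cv op F G (Tid h)
  = teval (fun h1 h' => teval (fun m h3 => op (F (tens (T h3) h1)) (G (Tid m))) (comul H h')) (comul H h).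
Proof.
transitivity (teval (fun x y => teval (fun x1 x2 => teval (fun y1 y2 =>
   op (F (tens (T y2) x1)) (G (tens (T y1) x2))) (comul H y)) (comul H x)) (comul H h)).
  rewrite TidE (teval_map (L := cv op F G)); last by lin.
  apply: eq_teval => x y; rewrite cv_tens teval_exch; apply: eq_teval => x1 x2.
  by rewrite (teval_S T_comul); last by lin.
rewrite (coassoc4 (P := fun x1 x2 y1 y2 => op (F (tens (T y2) x1)) (G (tens (T y1) x2))));
  [|by move=> *; lin|by move=> *; lin].
by do 2 (apply: eq_teval => ? ?); rewrite TidE (teval_map (L := fun t => op _ (G t))); last by lin.
Qed.

Lemma cv_Tid_mul (F : lhom T2 U) (G : lhom H V) h :
  cv op F (G \c mulc H) (Tid h) = op (F (Tid h)) (G one).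
Proof.
rewrite cv_Tid TidE (teval_map (L := fun t => op (F t) (G one))); last by lin.
apply: eq_teval => h1 h'; rewrite -[RHS](counit_l (F := fun h' => op (F (tens (T h') h1)) (G one)));
  last by lin.
apply: eq_teval => m h3; rewrite hcompE mul_Tid !hlinZ.
by rewrite (linZ _ _ (f := op _)); last by lin.
Qed.

Lemma cv_idTid_p12 (F : lhom T2 U) (G : lhom T3 V) h :
  cv op (F \c p12 H H) G (idTid h)
  = teval (fun h1 h' => teval (fun m h3 => op (F (idT m)) (G (tens h3 (Tid h1))))
      (comul H h')) (comul H h).
Proof.
transitivity (teval (fun x y => teval (fun x1 x2 => teval (fun y1 y2 =>
    op (F (tens y1 (T x2))) (G (tens y2 (Tid x1)))) (comul H y)) (comul H x)) (comul H h)).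
  rewrite idTidE (teval_map (L := cv op (F \c p12 H H) G)); last by lin.
  apply: eq_teval => x y; rewrite cv_slice teval_exch; apply: eq_teval => y1 y2.
  rewrite cv_Tid coassoc; last by lin.
  apply: eq_teval => x1 x3.
  rewrite -[RHS](counit_l (F := fun x1 => op (F (tens y1 (T x3))) (G (tens y2 (Tid x1)))));
    last by lin.
  apply: eq_teval => x0 m; rewrite !sliceE [(F \c _) _]hcompE p12E hlinZ.
  by rewrite (linZ _ _ (f := fun x => op x _)); last by lin.
rewrite (coassoc4 (P := fun x1 x2 y1 y2 => op (F (tens y1 (T x2))) (G (tens y2 (Tid x1)))));
  [|by move=> *; lin|by move=> *; lin].
by do 2 (apply: eq_teval => ? ?); rewrite idTE (teval_map (L := fun t => op (F t) _)); last by lin.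
Qed.

Lemma cv_idTid_mul (F : lhom T2 U) (G : lhom T2 V) h :
  cv op (F \c m12 H H) (G \c tm (idc H) (mulc H)) (idTid h)
  = teval (fun h1 h2 => op (F (tens one h1)) (G (tens h2 one))) (comul H h).
Proof.
transitivity (teval (fun x y => teval (fun x1 x2 => teval (fun y1 y2 =>
    op (F (tens (hmul y1 (T x2)) x1)) (G (tens y2 one))) (comul H y)) (comul H x)) (comul H h)).
  rewrite idTidE (teval_map (L := cv op _ _)); last by lin.
  apply: eq_teval => x y; rewrite cv_slice teval_exch; apply: eq_teval => y1 y2.
  have -> : slice (G \c tm (idc H) (mulc H)) y2 = slice G y2 \c mulc H.
    by apply: lhom_eq => t; rewrite sliceE hcompE tmE [RHS]hcompE sliceE.
  rewrite cv_Tid_mul !sliceE hcompE TidE.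
  rewrite (teval_map (L := fun t => op (F (m12 H H (tens y1 t))) _)); last by lin.
  by apply: eq_teval => x1 x2; rewrite m12E.
rewrite (coassoc4 (P := fun x1 x2 y1 y2 => op (F (tens (hmul y1 (T x2)) x1)) (G (tens y2 one))));
  [|by move=> *; lin|by move=> *; lin].
apply: eq_teval => h1 h'.
rewrite -[RHS](counit_l (F := fun h2 => op (F (tens one h1)) (G (tens h2 one)))); last by lin.
apply: eq_teval => m h3; transitivity (op (F (tens ((counit H m : k) *: one) h1)) (G (tens h3 one))).
  by rewrite -T_r (teval_map (L := fun t => op (F (tens t h1)) (G (tens h3 one)))); last by lin.
by rewrite (linZ _ _ (f := fun t => op (F (tens t h1)) (G (tens h3 one)))); last by lin.
Qed.

End Collapse.
End Opposite.

End AntipodeSums.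

(** * The bimodule B (x) H (x) B *)

Section BoxBimodule.
Variables (k : fieldType) (H : coquasi_bialgebra k) (B : algType k).
Variable act : H -> B -> B.
Hypothesis modalg : is_module_algebra act.

Local Notation M := (BHB H B).
Local Notation D0 := (bhb_bimod act).
Local Notation DC := (bhb_coalg act).
Local Notation T2 := (tc H H).
Local Notation T3 := (tc H (tc H H)).
Local Notation T4 := (tc H (tc H (tc H H))).
Local Notation one := (hone H).

Fact act_bil' : bilin act. Proof. exact: act_bilin modalg. Qed.

Fact box_trilin : trilin (@box k H B). Proof. by rewrite /box; lin. Qed.

Lemma box_evalE (W : lmodType k) (F : B -> H -> B -> W) a h a' :
  trilin F -> box_eval F (box a h a') = F a h a'.
Proof.
move=> tF; have bF x : bilin (F x) by case: tF => *; split.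
by rewrite /box_eval /box !teval_tens //; lin.
Qed.

Lemma box_eval_lin (W : lmodType k) (F : B -> H -> B -> W) :
  trilin F -> linear (box_eval F).
Proof.
move=> tF; have bF x : bilin (F x) by case: tF => *; split.
by rewrite /box_eval; lin.
Qed.

Lemma box_eq (W : lmodType k) (f g : M -> W) : linear f -> linear g ->
  (forall a h a', f (box a h a') = g (box a h a')) -> f =1 g.
Proof.
move=> lf lg fg.
by have := bil_tens_eq (f := LHom lf) (g := LHom lg) fg => /(congr1 (@hfun _ _ _)) /= ->.
Qed.

Local Hint Resolve box_trilin act_bil' : bil.

Lemma lact_box b a h a' : lact D0 b (box a h a') = box (b * a) h a'.
Proof. by rewrite /= box_evalE //; lin. Qed.
Lemma lbact_box b a h a' : lbact D0 b (box a h a') = box a h (a' * b).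
Proof. by rewrite /= box_evalE //; lin. Qed.
Lemma ract_box b a h a' : ract D0 b (box a h a') = \sw[2]_(h1 h2 <- h) box (a * act h1 b) h2 a'.
Proof. by rewrite /= box_evalE //; lin. Qed.
Lemma rbact_box b a h a' : rbact D0 b (box a h a') = \sw[2]_(h1 h2 <- h) box a h1 (act h2 b * a').
Proof. by rewrite /= box_evalE //; lin. Qed.

Fact lact_bil : bilin (lact D0).
Proof.
by split=> [b|X]; [apply: box_eval_lin; lin | rewrite /= /box_eval; lin].
Qed.
Fact lbact_bil : bilin (lbact D0).
Proof.
by split=> [b|X]; [apply: box_eval_lin; lin | rewrite /= /box_eval; lin].
Qed.
Fact ract_bil : bilin (ract D0).
Proof.
by split=> [b|X]; [apply: box_eval_lin; lin | rewrite /= /box_eval; lin].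
Qed.
Fact rbact_bil : bilin (rbact D0).
Proof.
by split=> [b|X]; [apply: box_eval_lin; lin | rewrite /= /box_eval; lin].
Qed.

Definition lB : bil B M M := Bil lact_bil.
Definition lbB : bil B M M := Bil lbact_bil.
Definition rB : bil B M M := Bil ract_bil.
Definition rbB : bil B M M := Bil rbact_bil.
(* The action of the opposite algebra with its scalar on the right, matching the
   order in which the legs of h occur in convolution products [m <| y]. *)
Fact lbS_bil : bilin (fun (m : M) (b : B) => lbB b m). Proof. by lin. Qed.
Definition lbS : bil M B M := Bil lbS_bil.

Fact unitJ_lin : linear (fun h : H => box (1 : B) h (1 : B)). Proof. by lin. Qed.
Definition unitJ : lhom H M := LHom unitJ_lin.
Fact actl_lin b : linear (fun h : H => act h b). Proof. by lin. Qed.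
Definition actl b : lhom H B := LHom (actl_lin b).

Local Notation J := unitJ.
Local Notation A := actl.
Local Notation "x |> m" := (cv lB x m) (at level 44, right associativity).
Local Notation "m <| y" := (cv lbS m y) (at level 43, left associativity).

Lemma lB_box b a h a' : lB b (box a h a') = box (b * a) h a'.
Proof. exact: lact_box. Qed.
Lemma lbB_box b a h a' : lbB b (box a h a') = box a h (a' * b).
Proof. exact: lbact_box. Qed.

Lemma boxJ a h a' : box a h a' = lB a (lbB a' (J h)).
Proof. by rewrite [J h]/= lbB_box lB_box mulr1 mul1r. Qed.

Lemma boxJl a h : box a h 1 = lB a (J h).
Proof. by rewrite [J h]/= lB_box mulr1. Qed.

Lemma boxJr h a' : box 1 h a' = lbB a' (J h).
Proof. by rewrite [J h]/= lbB_box mul1r. Qed.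

Lemma M_eq (W : lmodType k) (f g : M -> W) : linear f -> linear g ->
  (forall a h a', f (lB a (lbB a' (J h))) = g (lB a (lbB a' (J h)))) -> f =1 g.
Proof. by move=> lf lg fg; apply: box_eq => // a h a'; rewrite boxJ. Qed.

Lemma lB1 X : lB 1 X = X.
Proof. by move: X; apply: (box_eq (g := fun X => X)) => [||a h a'];
  [lin|lin|rewrite lB_box mul1r]. Qed.
Lemma lbB1 X : lbB 1 X = X.
Proof. by move: X; apply: (box_eq (g := fun X => X)) => [||a h a'];
  [lin|lin|rewrite lbB_box mulr1]. Qed.
Lemma lBM b c X : lB (b * c) X = lB b (lB c X).
Proof. by move: X; apply: box_eq => [||a h a']; [lin|lin|rewrite !lB_box mulrA]. Qed.
Lemma lbBM b c X : lbB (b * c) X = lbB c (lbB b X).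
Proof. by move: X; apply: box_eq => [||a h a']; [lin|lin|rewrite !lbB_box mulrA]. Qed.
Lemma lB_lbB b c X : lB b (lbB c X) = lbB c (lB b X).
Proof. by move: X; apply: box_eq => [||a h a']; [lin|lin|rewrite !(lB_box, lbB_box)]. Qed.

Lemma rB_box b a h a' : rB b (box a h a') = lB a (lbB a' ((actl b |> J) h)).
Proof.
rewrite [LHS](ract_box b a h a') cvE (teval_map (L := lbB a')); last by lin.
rewrite (teval_map (L := lB a)); last by lin.
by apply: eq_teval => h1 h2; rewrite -boxJl lbB_box lB_box mul1r.
Qed.
Lemma rbB_box b a h a' : rbB b (box a h a') = lB a (lbB a' ((J <| actl b) h)).
Proof.
rewrite [LHS](rbact_box b a h a') cvE (teval_map (L := lbB a')); last by lin.
rewrite (teval_map (L := lB a)); last by lin.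
apply: eq_teval => h1 h2.
by rewrite [lbS _ _](esym (boxJr h1 (actl b h2))) lbB_box lB_box mulr1.
Qed.

Lemma rB_lB b c X : rB b (lB c X) = lB c (rB b X).
Proof. by move: X; apply: box_eq => [||a h a']; [lin|lin|rewrite lB_box !rB_box lBM]. Qed.
Lemma rB_lbB b c X : rB b (lbB c X) = lbB c (rB b X).
Proof. by move: X; apply: box_eq => [||a h a']; [lin|lin|rewrite lbB_box !rB_box lbBM lB_lbB]. Qed.
Lemma rbB_lB b c X : rbB b (lB c X) = lB c (rbB b X).
Proof. by move: X; apply: box_eq => [||a h a']; [lin|lin|rewrite lB_box !rbB_box lBM]. Qed.
Lemma rbB_lbB b c X : rbB b (lbB c X) = lbB c (rbB b X).
Proof. by move: X; apply: box_eq => [||a h a']; [lin|lin|rewrite lbB_box !rbB_box lbBM lB_lbB]. Qed.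

(** A scalar crosses a generator at the cost of letting a leg of h act on it. Through [rBJ] and
    [rbBJ], statements about the right actions turn into convolution identities for [actl b]. *)
Lemma rBJ b : bilr rB b \c J = actl b |> J.
Proof. by apply: lhom_eq => h; rewrite hcompE [bilr _ _ _](rB_box b 1 h 1) lbB1 lB1. Qed.
Lemma rbBJ b : bilr rbB b \c J = J <| actl b.
Proof. by apply: lhom_eq => h; rewrite hcompE [bilr _ _ _](rbB_box b 1 h 1) lbB1 lB1. Qed.

Section BimoduleConv.
Variable C : coalgebra k.
Implicit Types (x y : lhom C B) (m : lhom C M).
Lemma cvlA x y m : x |> y |> m = (x ** y) |> m.
Proof. by symmetry; apply: cvA => u v w; exact: lBM. Qed.
Lemma cvrA x y m : m <| x <| y = m <| (x ** y).
Proof. by apply: cvA => u v w /=; rewrite -[RHS]/(lbB _ _) lbBM. Qed.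
Lemma cvlr x y m : (x |> m) <| y = x |> (m <| y).
Proof. by apply: cvA => u v w /=; rewrite -[LHS]/(lbB _ _) -[RHS]/(lB _ _) lB_lbB. Qed.
Lemma cvl1 m : cm1 |> m = m.
Proof. by apply: lhom_eq => c; rewrite cv_cstl lB1. Qed.
Lemma cvr1 m : m <| cm1 = m.
Proof. by apply: lhom_eq => c; rewrite cv_cstr -[LHS]/(lbB _ _) lbB1. Qed.
Lemma rB_cvl b x m : bilr rB b \c (x |> m) = x |> (bilr rB b \c m).
Proof. by apply: lhom_cvr => u v; exact: rB_lB. Qed.
Lemma rB_cvr b x m : bilr rB b \c (m <| x) = (bilr rB b \c m) <| x.
Proof. by apply: lhom_cvl => u v; exact: rB_lbB. Qed.
Lemma rbB_cvl b x m : bilr rbB b \c (x |> m) = x |> (bilr rbB b \c m).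
Proof. by apply: lhom_cvr => u v; exact: rbB_lB. Qed.
Lemma rbB_cvr b x m : bilr rbB b \c (m <| x) = (bilr rbB b \c m) <| x.
Proof. by apply: lhom_cvl => u v; exact: rbB_lbB. Qed.
End BimoduleConv.

Lemma actlM b c : actl (b * c) = actl b ** actl c.
Proof. by apply: lhom_eq => h; exact: (actM modalg). Qed.
Lemma actl1 : actl 1 = cm1.
Proof. by apply: lhom_eq => h; exact: (act1r modalg). Qed.

(** The right actions and their composites commute with both left actions, so the bimodule laws need
    comparison only on generators, where they say that b |-> [actl b] is multiplicative. *)
Lemma M_eqJ (f g : lhom M M) :
  (forall a X, f (lB a X) = lB a (f X)) -> (forall a X, g (lB a X) = lB a (g X)) ->
  (forall a X, f (lbB a X) = lbB a (f X)) -> (forall a X, g (lbB a X) = lbB a (g X)) ->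
  f \c J = g \c J -> f =1 g.
Proof.
move=> fl gl fr gr /(congr1 (@hfun _ _ _)) fg; apply: M_eq => [||a h a']; try by lin.
by rewrite fl gl fr gr -[f (J h)]/((f \c J) h) fg.
Qed.

Lemma rB1 X : rB 1 X = X.
Proof.
rewrite -[LHS]/(bilr rB 1 X).
apply: (M_eqJ (g := LHom (@lin_id k M))) => [a Y|a Y|a Y|a Y|]; last first.
  by rewrite rBJ actl1 cvl1; apply: lhom_eq.
all: by rewrite ?hcompE /bilr /hfun ?(rB_lB, rB_lbB, rbB_lB, rbB_lbB).
Qed.
Lemma rbB1 X : rbB 1 X = X.
Proof.
rewrite -[LHS]/(bilr rbB 1 X).
apply: (M_eqJ (g := LHom (@lin_id k M))) => [a Y|a Y|a Y|a Y|]; last first.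
  by rewrite rbBJ actl1 cvr1; apply: lhom_eq.
all: by rewrite ?hcompE /bilr /hfun ?(rB_lB, rB_lbB, rbB_lB, rbB_lbB).
Qed.

Lemma rBM b c X : rB (b * c) X = rB c (rB b X).
Proof.
rewrite -[LHS]/(bilr rB (b * c) X) -[RHS]/((bilr rB c \c bilr rB b) X).
apply: M_eqJ => [a Y|a Y|a Y|a Y|]; last first.
  by rewrite hcompA !rBJ rB_cvl rBJ cvlA actlM.
all: by rewrite ?hcompE /bilr /hfun ?(rB_lB, rB_lbB, rbB_lB, rbB_lbB).
Qed.
Lemma rbBM b c X : rbB (b * c) X = rbB b (rbB c X).
Proof.
rewrite -[LHS]/(bilr rbB (b * c) X) -[RHS]/((bilr rbB b \c bilr rbB c) X).
apply: M_eqJ => [a Y|a Y|a Y|a Y|]; last first.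
  by rewrite hcompA !rbBJ rbB_cvr rbBJ cvrA actlM.
all: by rewrite ?hcompE /bilr /hfun ?(rB_lB, rB_lbB, rbB_lB, rbB_lbB).
Qed.
Lemma rB_rbB b c X : rB b (rbB c X) = rbB c (rB b X).
Proof.
rewrite -[LHS]/((bilr rB b \c bilr rbB c) X) -[RHS]/((bilr rbB c \c bilr rB b) X).
apply: M_eqJ => [a Y|a Y|a Y|a Y|]; last first.
  by rewrite !hcompA rBJ rbBJ rbB_cvl rB_cvr rBJ rbBJ cvlr.
all: by rewrite ?hcompE /bilr /hfun ?(rB_lB, rB_lbB, rbB_lB, rbB_lbB).
Qed.

Lemma bhb_is_bimodule : is_bimodule (bhb_bimod act).
Proof.
split; [exact: lact_bil|exact: lbact_bil|exact: ract_bil|exact: rbact_bil|..].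
- exact: lB1.
- exact: lbB1.
- exact: rB1.
- exact: rbB1.
- exact: lBM.
- exact: lbBM.
- exact: rBM.
- exact: rbBM.
- exact: lB_lbB.
- exact: rB_rbB.
- by move=> b c X; rewrite -[LHS]/(lB b (rB c X)) -rB_lB.
- by move=> b c X; rewrite -[LHS]/(lB b (rbB c X)) -rbB_lB.
- by move=> b c X; rewrite -[LHS]/(lbB b (rB c X)) -rB_lbB.
- by move=> b c X; rewrite -[LHS]/(lbB b (rbB c X)) -rbB_lbB.
Qed.

Fact dia_bilin : bilin (dia D0). Proof. exact: btens_bilin. Qed.
Definition diaB : bil M M (diamond D0) := Bil dia_bilin.
Lemma dia_bal b X Y : diaB (lbB b X) Y = diaB X (lB b Y).
Proof. exact: btens_bal. Qed.

(* [goodn F]: the multilinear map F factors through the n-fold product over B. *)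
Definition good2 (V : lmodType k) (F : M -> M -> V) :=
  bilin F /\ forall b X Y, F (lbB b X) Y = F X (lB b Y).
Definition good3 (V : lmodType k) (F : M -> M -> M -> V) :=
  [/\ forall X, good2 (F X), forall Y Z, linear (fun X => F X Y Z)
    & forall b X Y Z, F (lbB b X) Y Z = F X (lB b Y) Z].
Definition good4 (V : lmodType k) (F : M -> M -> M -> M -> V) :=
  [/\ forall X, good3 (F X), forall Y Z W, linear (fun X => F X Y Z W)
    & forall b X Y Z W, F (lbB b X) Y Z W = F X (lB b Y) Z W].
Definition good5 (V : lmodType k) (F : M -> M -> M -> M -> M -> V) :=
  [/\ forall X, good4 (F X), forall Y Z W U, linear (fun X => F X Y Z W U)
    & forall b X Y Z W U, F (lbB b X) Y Z W U = F X (lB b Y) Z W U].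

Lemma good2_dia : good2 (dia D0).
Proof. by split; [exact: dia_bilin | exact: dia_bal]. Qed.

Lemma dia_eval_lin (V : lmodType k) (F : M -> M -> V) : good2 F ->
  linear (dia_eval (M := D0) F).
Proof. by case=> bF bal; apply: beval_lin. Qed.

Lemma dia_evalE (V : lmodType k) (F : M -> M -> V) X Y : good2 F ->
  dia_eval F (dia D0 X Y) = F X Y.
Proof. by case=> bF bal; apply: beval_btens. Qed.

Lemma bhb_comul_lin : linear (bhb_comul act).
Proof.
have ? := dia_bilin; rewrite /bhb_comul; apply: box_eval_lin; lin.
Qed.
Definition Dl : lhom M (diamond D0) := LHom bhb_comul_lin.

Lemma bhb_comul_box a h a' : bhb_comul act (box a h a') =
  teval (fun h1 h2 => dia D0 (box a h1 1) (box 1 h2 a')) (comul H h).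
Proof.
have ? := dia_bilin; rewrite /bhb_comul box_evalE; last by lin.
by [].
Qed.

Lemma swL2_lin (V : lmodType k) (F : M -> M -> V) : good2 F ->
  linear (fun X => dia_eval F (bhb_comul act X)).
Proof. by move=> gF; exact: (lin_comp (dia_eval_lin gF) bhb_comul_lin). Qed.

Lemma swL2E (V : lmodType k) (F : M -> M -> V) a h a' : good2 F ->
  dia_eval F (bhb_comul act (box a h a'))
  = teval (fun h1 h2 => F (box a h1 1) (box 1 h2 a')) (comul H h).
Proof.
move=> gF; rewrite bhb_comul_box teval_map; last exact: dia_eval_lin.
by apply: eq_teval => h1 h2; rewrite dia_evalE.
Qed.

Lemma lin_dia_evalF (U V : lmodType k) (F : U -> M -> M -> V) (t : diamond D0) :
  (forall X Y, linear (fun u => F u X Y)) -> linear (fun u => dia_eval (F u) t).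
Proof. by move=> lF; apply: lin_tevalF => X Y; apply: lF. Qed.

(** The left action on [Y] passes through the coproduct to its first leg. So a balanced [F] summed
    over its last two legs stays balanced between the two variables that remain; iterating this
    handles sums over four and five legs. *)
Lemma good3_sw (V : lmodType k) (F : M -> M -> M -> V) : good3 F ->
  good2 (fun X Y => dia_eval (F X) (bhb_comul act Y)).
Proof.
case=> gF lF bF; split; first split=> [X|Y].
- exact: swL2_lin.
- exact: lin_dia_evalF.
move=> b X; apply: box_eq => [||a h a'].
- exact: swL2_lin.
- by apply: (lin_comp (swL2_lin (gF _))); lin.
rewrite lB_box !swL2E //; apply: eq_teval => h1 h2.
by rewrite bF lB_box.
Qed.

Lemma swL3E (V : lmodType k) (F : M -> M -> M -> V) a h a' : good3 F ->
  \sw[DC, 3]_(X1 X2 X3 <- box a h a') F X1 X2 X3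
  = \sw[3]_(h1 h2 h3 <- h) F (box a h1 1) (box 1 h2 1) (box 1 h3 a').
Proof.
move=> gF; rewrite [LHS](swL2E _ _ _ (good3_sw gF)).
by apply: eq_teval => h1 h2; rewrite swL2E //; case: gF.
Qed.

Lemma swL3_lin (V : lmodType k) (F : M -> M -> M -> V) : good3 F ->
  linear (fun X => \sw[DC, 3]_(X1 X2 X3 <- X) F X1 X2 X3).
Proof. by move=> gF; exact: (swL2_lin (good3_sw gF)). Qed.

Lemma good4_sw (V : lmodType k) (F : M -> M -> M -> M -> V) : good4 F ->
  good2 (fun X Y => \sw[DC, 3]_(X1 X2 X3 <- Y) F X X1 X2 X3).
Proof.
case=> gF lF bF; split; first split=> [X|Y].
- exact: swL3_lin.
- by do 2 (apply: lin_dia_evalF => ? ?).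
move=> b X; apply: box_eq => [||a h a'].
- exact: swL3_lin.
- by apply: (lin_comp (swL3_lin (gF _))); lin.
rewrite lB_box !swL3E //; do 2 apply: eq_teval => ? ?.
by rewrite bF lB_box.
Qed.

Lemma swL4E (V : lmodType k) (F : M -> M -> M -> M -> V) a h a' : good4 F ->
  \sw[DC, 4]_(X1 X2 X3 X4 <- box a h a') F X1 X2 X3 X4
  = \sw[4]_(h1 h2 h3 h4 <- h) F (box a h1 1) (box 1 h2 1) (box 1 h3 1) (box 1 h4 a').
Proof.
move=> gF; rewrite [LHS](swL2E _ _ _ (good4_sw gF)).
by apply: eq_teval => h1 h2; rewrite swL3E //; case: gF.
Qed.

Lemma swL4_lin (V : lmodType k) (F : M -> M -> M -> M -> V) : good4 F ->
  linear (fun X => \sw[DC, 4]_(X1 X2 X3 X4 <- X) F X1 X2 X3 X4).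
Proof. by move=> gF; exact: (swL2_lin (good4_sw gF)). Qed.

Lemma good5_sw (V : lmodType k) (F : M -> M -> M -> M -> M -> V) : good5 F ->
  good2 (fun X Y => \sw[DC, 4]_(X1 X2 X3 X4 <- Y) F X X1 X2 X3 X4).
Proof.
case=> gF lF bF; split; first split=> [X|Y].
- exact: swL4_lin.
- by do 3 (apply: lin_dia_evalF => ? ?).
move=> b X; apply: box_eq => [||a h a'].
- exact: swL4_lin.
- by apply: (lin_comp (swL4_lin (gF _))); lin.
rewrite lB_box !swL4E //; do 3 apply: eq_teval => ? ?.
by rewrite bF lB_box.
Qed.

Lemma swL5E (V : lmodType k) (F : M -> M -> M -> M -> M -> V) a h a' : good5 F ->
  \sw[DC, 5]_(X1 X2 X3 X4 X5 <- box a h a') F X1 X2 X3 X4 X5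
  = \sw[5]_(h1 h2 h3 h4 h5 <- h)
      F (box a h1 1) (box 1 h2 1) (box 1 h3 1) (box 1 h4 1) (box 1 h5 a').
Proof.
move=> gF; rewrite [LHS](swL2E _ _ _ (good5_sw gF)).
by apply: eq_teval => h1 h2; rewrite swL4E //; case: gF.
Qed.

Lemma swL5_lin (V : lmodType k) (F : M -> M -> M -> M -> M -> V) : good5 F ->
  linear (fun X => \sw[DC, 5]_(X1 X2 X3 X4 X5 <- X) F X1 X2 X3 X4 X5).
Proof. by move=> gF; exact: (swL2_lin (good5_sw gF)). Qed.

(* The Takeuchi condition: both sides insert [act h2 b] between the legs. *)
Lemma tk (V : lmodType k) (F : M -> M -> V) b a h a' : good2 F ->
  teval (fun h1 h2 => F (rbB b (box a h1 1)) (box 1 h2 a')) (comul H h)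
  = teval (fun h1 h2 => F (box a h1 1) (rB b (box 1 h2 a'))) (comul H h).
Proof.
case=> bF bal.
have bF' : bilin (fun X Y => F (lB a X) (lbB a' Y)) by lin.
pose F' : bil M M V := Bil bF'.
transitivity (cv F' (J <| A b) J h).
  apply: eq_teval => h1 h2.
  by rewrite rbB_box lbB1 boxJr.
rewrite (cvA (op3 := F') (op4 := lB)); last first.
  move=> X c Y; rewrite -[LHS]/(F (lB a (lbB c X)) (lbB a' Y)).
  by rewrite -[RHS]/(F (lB a X) (lbB a' (lB c Y))) lB_lbB bal lB_lbB.
by apply: eq_teval => h1 h2; rewrite rB_box lB1 boxJl.
Qed.

(** The Takeuchi condition between the first two of three legs, with the third as a spectator;
    coassociativity reduces it to [tk]. *)
Lemma tkh (V : lmodType k) (F : M -> M -> H -> V) b a h :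
  (forall x, good2 (fun X Y => F X Y x)) -> (forall X Y, linear (F X Y)) ->
  teval (fun h1 y => teval (fun h2 h3 => F (rbB b (box a h1 1)) (box 1 h2 1) h3)
    (comul H y)) (comul H h)
  = teval (fun h1 y => teval (fun h2 h3 => F (box a h1 1) (rB b (box 1 h2 1)) h3)
    (comul H y)) (comul H h).
Proof.
move=> gF lF.
have tF : trilin F by split=> // [X x|Y x]; case: (gF x) => [[]].
rewrite !coassoc; try by lin.
by apply: eq_teval => x y; apply: (tk (F := fun X Y => F X Y y)).
Qed.

Section Triple.
Lemma dia3_trilin : trilin (dia3 D0).
Proof. by rewrite /dia3; split=> [X Y|X Y|X Y]; apply: lin_comp; try apply: cls_linear; lin. Qed.
Lemma dia3_good : good3 (dia3 D0).
Proof.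
have [t1 t2 t3] := dia3_trilin.
split=> // [X|b X Y Z]; first split; first by split.
  by move=> b Y Z; apply/cls_eq/gen_submodule_sub; constructor.
by apply/cls_eq/gen_submodule_sub; constructor.
Qed.

Variables (V : lmodType k) (F : M -> M -> M -> V).
Hypothesis gF : good3 F.

Fact dia3_aux_trilin : trilin F.
Proof. by case: gF => g1 l1 _; split=> // [X Y|X Y]; case: (g1 X) => [[]]. Qed.
Local Hint Resolve dia3_aux_trilin : bil.

Lemma dia3_eval_cls t :
  dia3_eval (M := D0) F (cls _ t) = teval (fun X s => teval (F X) s) t.
Proof.
have [gF2 lF bF] := gF.
rewrite /dia3_eval; apply: (quot_modP (f := teval (fun X s => teval (F X) s))).
  by lin.
move=> _ [b X Y Z|b X Y Z]; rewrite addrC -scaleN1r.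
  have -> : forall u v, teval (fun X s => teval (F X) s) (-1 *: u + v) =
     -1 *: teval (fun X s => teval (F X) s) u + teval (fun X s => teval (F X) s) v.
    by apply: teval_linear; lin.
  by rewrite !teval_tens; try lin; rewrite bF scaleN1r addNr.
have -> : forall u v, teval (fun X s => teval (F X) s) (-1 *: u + v) =
     -1 *: teval (fun X s => teval (F X) s) u + teval (fun X s => teval (F X) s) v.
  by apply: teval_linear; lin.
by rewrite !teval_tens; try lin; case: (gF2 X) => _ ->; rewrite scaleN1r addNr.
Qed.

Lemma dia3_evalE X Y Z : dia3_eval F (dia3 D0 X Y Z) = F X Y Z.
Proof. by rewrite dia3_eval_cls !teval_tens //; lin. Qed.

Lemma dia3_eval_lin : linear (dia3_eval (M := D0) F).
Proof.
move=> a u v; rewrite -[u]repK -[v]repK -(cls_linear (diamond3_rel D0)) !dia3_eval_cls.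
by apply: teval_linear; lin.
Qed.
End Triple.

Definition counitM (X : M) : B := bhb_counit X.
Fact counitM_lin : linear counitM.
Proof. by rewrite /counitM /bhb_counit; apply: box_eval_lin; lin. Qed.
Definition epsM : lhom M B := LHom counitM_lin.

Lemma epsM_box a h a' : epsM (box a h a') = counit H h *: (a * a').
Proof. by rewrite /= /counitM /bhb_counit box_evalE //; lin. Qed.
Lemma epsM_lB b X : epsM (lB b X) = b * epsM X.
Proof.
move: X; apply: box_eq => [||a h a']; [by lin|by lin|].
by rewrite lB_box !epsM_box -mulrA scalerAr.
Qed.
Lemma epsM_lbB b X : epsM (lbB b X) = epsM X * b.
Proof.
move: X; apply: box_eq => [||a h a']; [by lin|by lin|].
by rewrite lbB_box !epsM_box mulrA scalerAl.
Qed.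
Lemma epsM_box1l a h X : lB (epsM (box a h 1)) X = counit H h *: lB a X.
Proof. by rewrite epsM_box mulr1 (linZ _ _ (f := fun b => lB b X)) //; lin. Qed.
Lemma epsM_box1r a h X : lbB (epsM (box 1 h a)) X = counit H h *: lbB a X.
Proof. by rewrite epsM_box mul1r (linZ _ _ (f := fun b => lbB b X)) //; lin. Qed.

Lemma good2_counitl : good2 (fun X Y => lB (epsM X) Y).
Proof. by split=> [|b X Y]; [lin | rewrite epsM_lbB lBM]. Qed.
Lemma good2_counitr : good2 (fun X Y => lbB (epsM Y) X).
Proof. by split=> [|b X Y]; [lin | rewrite epsM_lB lbBM]. Qed.

Lemma bhb_comul_takeuchi X : takeuchi (bhb_comul act X).
Proof.
move=> b; have g1 : good2 (fun m n => dia D0 (rbB b m) n).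
  by have [bd bal] := good2_dia; split=> [|c Y Z]; [lin | rewrite rbB_lbB bal].
have g2 : good2 (fun m n => dia D0 m (rB b n)).
  by have [bd bal] := good2_dia; split=> [|c Y Z]; [lin | rewrite rB_lB bal].
move: X; apply: box_eq => [||a h a']; [exact: (swL2_lin g1)|exact: (swL2_lin g2)|].
rewrite (swL2E _ _ _ g1) (swL2E _ _ _ g2); apply: (tk (F := dia D0)).
exact: good2_dia.
Qed.

Lemma bhb_is_coalgebroid : is_coalgebroid (bhb_coalg act).
Proof.
have [bd bal] := good2_dia.
split.
- exact: bhb_is_bimodule.
- exact: bhb_comul_lin.
- exact: bhb_comul_takeuchi.
- move=> b X.
  have g : good2 (fun m n => dia D0 (lB b m) n).
    by split=> [|c Y Z]; [lin | rewrite lB_lbB bal].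
  move: X; apply: box_eq => [||a h a'].
  + by apply: lin_comp; [apply: bhb_comul_lin | by case: lact_bil].
  + exact: (swL2_lin g).
  + rewrite [RHS](swL2E _ _ _ g) [Defs.lact _ _ _]lact_box [LHS]bhb_comul_box.
    by apply: eq_teval => h1 h2; rewrite lB_box.
- move=> b X.
  have g : good2 (fun m n => dia D0 m (lbB b n)).
    by split=> [|c Y Z]; [lin | rewrite -lB_lbB bal].
  move: X; apply: box_eq => [||a h a'].
  + by apply: lin_comp; [apply: bhb_comul_lin | by case: lbact_bil].
  + exact: (swL2_lin g).
  + rewrite [RHS](swL2E _ _ _ g) [Defs.lbact _ _ _]lbact_box [LHS]bhb_comul_box.
    by apply: eq_teval => h1 h2; rewrite lbB_box.
- exact: counitM_lin.
- exact: epsM_lB.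
- exact: epsM_lbB.
- have [g1 l1 b1] := dia3_good.
  have l3 Y : linear (fun X3 => dia_eval (fun X1 X2 => dia3 D0 X1 X2 X3) (bhb_comul act Y)).
    by apply: lin_dia_evalF => X1 X2; case: (g1 X1) => [[]].
  have g2 X3 : good2 (fun X1 X2 => dia3 D0 X1 X2 X3).
    by split=> // ; split=> [X|Y] //; case: (g1 X) => [[]].
  (* One side of coassociativity splits the first leg, so its inner sum must be balanced against X3.
     The opposite action on Y reaches the second leg of Y, which is the neighbour of X3. *)
  have g : good2 (fun Y X3 => dia_eval (fun X1 X2 => dia3 D0 X1 X2 X3) (bhb_comul act Y)).
    split=> [|b Y X3]; first by split=> [X|Y] //; apply: swL2_lin.
    move: Y; apply: box_eq => [||a h a'].
    + by apply: (lin_comp (swL2_lin (g2 _))); lin.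
    + exact: swL2_lin.
    + rewrite lbB_box !swL2E //; apply: eq_teval => h1 h2.
      by rewrite -lbB_box; case: (g1 (box a h1 1)) => _ ->.
  move: {l3} g => g; apply: box_eq => [||a h a'].
  + exact: (swL3_lin dia3_good).
  + exact: (swL2_lin g).
  + rewrite [LHS](swL3E _ _ _ dia3_good) [RHS](swL2E _ _ _ g).
    have ? := dia3_trilin.
    rewrite /swH /= coassoc; last by lin.
    by apply: eq_teval => x y; rewrite swL2E.
- have [g1 l1 b1] := dia3_good.
  have t3 := dia3_trilin.
  have ga b : good3 (fun m p n => dia3 D0 (rbB b m) p n).
    by split=> [X|Y Z|c X Y Z]; [exact: g1 | lin | rewrite rbB_lbB b1].
  have gb b : good3 (fun m p n => dia3 D0 m (rB b p) n).
    split=> [X|Y Z|c X Y Z]; [|lin|by rewrite b1 rB_lB].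
    by split=> [|c Y Z]; [lin | rewrite rB_lbB; case: (g1 X) => _ ->].
  have gc b : good3 (fun m p n => dia3 D0 m (rbB b p) n).
    split=> [X|Y Z|c X Y Z]; [|lin|by rewrite b1 rbB_lB].
    by split=> [|c Y Z]; [lin | rewrite rbB_lbB; case: (g1 X) => _ ->].
  have gd b : good3 (fun m p n => dia3 D0 m p (rB b n)).
    split=> [X|Y Z|c X Y Z]; [|lin|by rewrite b1].
    by split=> [|c Y Z]; [lin | rewrite rB_lB; case: (g1 X) => _ ->].
  (* Evaluating a balanced function on the class of the triple coproduct is the same as summing it
     over the three legs. Both triple Takeuchi conditions thereby become equalities of ordinary
     Sweedler sums. *)
  have ev F X : good3 F -> dia3_eval (M := D0) F
     (\sw[DC, 3]_(X1 X2 X3 <- X) dia3 D0 X1 X2 X3) = \sw[DC, 3]_(X1 X2 X3 <- X) F X1 X2 X3.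
    move=> gF; move: X; apply: box_eq => [||a h a'].
    + exact: (lin_comp (dia3_eval_lin gF) (swL3_lin dia3_good)).
    + exact: (swL3_lin gF).
    + rewrite (swL3E _ _ _ dia3_good) (swL3E _ _ _ gF) /swH /=.
      rewrite teval_map; last exact: dia3_eval_lin.
      apply: eq_teval => h1 h'; rewrite teval_map; last exact: dia3_eval_lin.
      by apply: eq_teval => h2 h3; rewrite dia3_evalE.
  move=> X b; split.
    rewrite [LHS](ev _ _ X (ga b)) [RHS](ev _ _ X (gb b)).
    move: X; apply: box_eq => [||a h a']; [exact: swL3_lin|exact: swL3_lin|].
    rewrite (swL3E _ _ _ (ga b)) (swL3E _ _ _ (gb b)) /swH /=.
    apply: (tkh (F := fun X Y h => dia3 D0 X Y (box 1 h a'))) => [x|X Y]; last by lin.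
    by split=> [|c X Y]; [lin | rewrite b1].
  rewrite [LHS](ev _ _ X (gc b)) [RHS](ev _ _ X (gd b)).
  move: X; apply: box_eq => [||a h a']; [exact: swL3_lin|exact: swL3_lin|].
  rewrite (swL3E _ _ _ (gc b)) (swL3E _ _ _ (gd b)) /swH /=.
  by apply: eq_teval => h1 h'; apply: (tk (F := dia3 D0 (box a h1 1))).
- move=> X; move: X; apply: (box_eq (g := fun X => X)) => [||a h a'];
  [exact: (swL2_lin good2_counitl)|lin|].
  rewrite [LHS](swL2E _ _ _ good2_counitl).
  rewrite -[RHS](counit_l (F := fun h => box a h a')); last by lin.
  by apply: eq_teval => h1 h2; rewrite epsM_box1l lB_box mulr1.
- move=> X; move: X; apply: (box_eq (g := fun X => X)) => [||a h a'];
  [exact: (swL2_lin good2_counitr)|lin|].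
  rewrite [LHS](swL2E _ _ _ good2_counitr).
  rewrite -[RHS](counit_r (F := fun h => box a h a')); last by lin.
  by apply: eq_teval => h1 h2; rewrite epsM_box1r lbB_box mul1r.
Qed.

Local Notation sw X F := (dia_eval F (bhb_comul act X)).
Local Notation sw3 X F := (\sw[DC, 3]_(X1 X2 X3 <- X) F X1 X2 X3).
Local Notation sw4 X F := (\sw[DC, 4]_(X1 X2 X3 X4 <- X) F X1 X2 X3 X4).
Local Notation sw5 X F := (\sw[DC, 5]_(X1 X2 X3 X4 X5 <- X) F X1 X2 X3 X4 X5).
Local Notation J1 := (J (hone H)).
Local Notation eps := epsM.

Definition lgam (g : H -> H -> B) (gb : bilin g) : lhom T2 B := lin2 (Bil gb).

(** * Convolution identities for gamma, phi and Om *)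

Section Deformation.
Variables gam gamV : H -> H -> B.
Hypotheses (gam_bil : bilin gam) (gam_unital : unital2 gam)
  (gam_inv : is_hconv_inverse2 gam gamV) (gam_assoc : associative_type act gam).
Fact gamV_bil : bilin gamV. Proof. by case: gam_inv. Qed.
Local Hint Resolve gam_bil gamV_bil : bil.
Local Notation ga := (lgam gam_bil).
Local Notation gaV := (lgam gamV_bil).
(** The deformed product of two generators, gamma(h1, g1) (x) h2 g2 (x) gamma^-1(h3, g3) as a
    function of h (x) g; see [mu_J]. *)
Local Notation K := (ga |> ((J \c mulc H) <| gaV)).

Lemma lgamE g (gb : bilin g) x y : lgam gb (tens x y) = g x y.
Proof. exact: (lin2E (Bil gb)). Qed.

Lemma lbSJ h b : lbS (J h) b = box 1 h b.
Proof. by rewrite boxJr. Qed.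

Lemma bhb_mulE a h a' b g b' :
  bhb_mul act gam gamV (box a h a') (box b g b')
  = lB a (lbB a' ((((A b \c pl H H) ** ga) |> ((J \c mulc H) <| (gaV ** (A b' \c pl H H))))
      (tens h g))).
Proof.
rewrite /bhb_mul !box_evalE; try by rewrite /box_eval; lin.
rewrite -cvlA cv_pll; unsw.
pullout 2%N; match_teval.
rewrite cv_tens; pullout 2%N; match_teval; match_teval.
rewrite cv_tens; pullout 1%N; match_teval; match_teval.
rewrite cv_plr; match_teval.
by rewrite hcompE mulcE !lgamE lbSJ !lB_box lbB_box lB_box mulr1 !mulrA.
Qed.

Lemma cm1E (C : coalgebra k) (A : algType k) c : (cm1 : lhom C A) c = counit C c *: 1.
Proof. by []. Qed.

Lemma mAE (u v : B) : mA B u v = u * v. Proof. by []. Qed.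
Lemma actlE b h : A b h = act h b. Proof. by []. Qed.
Lemma idcE (C : coalgebra k) (c : C) : idc C c = c. Proof. by []. Qed.

Section Sh.
Variable D : coalgebra k.
Implicit Types F G : lhom D B.
Fact sh_bil F : bilin (fun (h : H) (d : D) => act h (F d)). Proof. by lin. Qed.
(** The passage from Hom(D, B) to Hom(H (x) D, B) is an algebra homomorphism ([shM], [sh1]): this is
    the module algebra axiom, and it is how actions are distributed over products of gamma-terms.
    Iterated on [A b] it gives h |> (g |> b) and its analogue with three arguments. *)
Definition sh F : lhom (tc H D) B := lin2 (Bil (sh_bil F)).
Lemma shE F h d : sh F (tens h d) = act h (F d). Proof. exact: (lin2E (Bil (sh_bil F))). Qed.
Lemma shM F G : sh (F ** G) = sh F ** sh G.
Proof.
apply: lhom_tens_eq => h d; rewrite shE [RHS]cv_tens cvE teval_map; last by lin.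
rewrite teval_exch; apply: eq_teval => d1 d2; rewrite [LHS](actM modalg); unsw.
by apply: eq_teval => h1 h2; rewrite !shE.
Qed.
Lemma sh1 : sh cm1 = cm1.
Proof.
apply: lhom_tens_eq => h d; rewrite shE !cm1E counit_tc (linZ _ _ (f := act h)); last by lin.
by rewrite (act1r modalg) scalerA mulrC.
Qed.
End Sh.
Arguments sh {D} F.
Local Notation A2 b := (sh (A b)).
Local Notation A3 b := (sh (sh (A b))).

Lemma sh_pull (C D : coalgebra k) (p : cmap C D) (F : lhom D B) :
  sh (F \c p) = sh F \c tm (idc H) p.
Proof. by apply: lhom_tens_eq => h d; rewrite hcompE tmE !shE. Qed.

Fact phi_bil : bilin (fun (h : H) (t : T2) => teval (phi h) t).
Proof. by have ? := phi_trilin H; split=> [h|t]; [apply: teval_linear; lin | lin]. Qed.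
Fact phiV_bil : bilin (fun (h : H) (t : T2) => teval (phiV h) t).
Proof. by have ? := phiV_trilin H; split=> [h|t]; [apply: teval_linear; lin | lin]. Qed.
Definition phik : lhom T3 k^o := lin2 (Bil phi_bil).
Definition phikV : lhom T3 k^o := lin2 (Bil phiV_bil).
Lemma phikE h g f : phik (tens h (tens g f)) = phi h g f.
Proof.
have ? := phi_trilin H.
by rewrite [LHS](lin2E (Bil phi_bil)) /= teval_tens //; lin.
Qed.
Lemma phikVE h g f : phikV (tens h (tens g f)) = phiV h g f.
Proof.
have ? := phiV_trilin H.
by rewrite [LHS](lin2E (Bil phiV_bil)) /= teval_tens //; lin.
Qed.
Fact inB_lin : linear (fun a : k^o => (a : k) *: (1 : B)). Proof. by lin. Qed.
Definition inB : lhom k^o B := LHom inB_lin.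
Definition phB := inB \c phik.
Definition phBV := inB \c phikV.

(** The indices record how three arguments enter gamma: [g23] is h |> gamma(g, f), [g1_23] is
    gamma(h, gf), [g12_3V] is gamma^-1(hg, f), and [g12V] is gamma^-1(h, g) with a counit on f. *)
Definition g23 : lhom T3 B := sh ga.
Definition g1_23 : lhom T3 B := ga \c tm (idc H) (mulc H).
Definition g12_3V : lhom T3 B := gaV \c m12 H H.
Definition g12V : lhom T3 B := gaV \c p12 H H.
Definition Om : lhom T3 B := g23 ** g1_23 ** phB ** g12_3V ** g12V.

(* Values at (1 h 1, b g b', c f c') of the balanced extension of F. *)
Definition wrap3 (F : lhom T3 B) b c c' b' : lhom T3 B :=
  (A b \c pl H T2) ** (A2 c \c p12 H H) ** F ** (A2 c' \c p12 H H) ** (A b' \c pl H T2).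

Lemma pl_p12 : pl H H \c p12 H H = pl H T2 :> lhom _ _.
Proof.
apply: bil_tens_eq => h g f; rewrite hcompE p12E (linZ _ _ (f := pl H H)); last by lin.
by rewrite !plE counit_tc scalerA mulrC.
Qed.

Lemma bhb_PhiE a h a' b g b' c f c' :
  bhb_Phi act gam gamV (box a h a') (box b g b') (box c f c')
  = a * wrap3 Om b c c' b' (tens h (tens g f)) * a'.
Proof.
have ? := phi_trilin H.
rewrite /bhb_Phi !box_evalE; try by rewrite /box_eval; lin.
(* The last three factors see only h and g. Grouping them under [p12] avoids splitting f for them,
   and leaves exactly the nine, seven and four legs of the definition. *)
have -> : wrap3 Om b c c' b' = (A b \c pl H T2) ** ((A2 c \c p12 H H) ** (g23 ** (g1_23 **
   (phB ** (g12_3V ** ((gaV ** (A2 c' ** (A b' \c pl H H))) \c p12 H H)))))).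
  by rewrite !cvm_pull hcompA pl_p12 /wrap3 /Om -!cvmA.
unsw.
(* The definition sums over the legs of f, then g, then h, whereas a convolution product splits h
   first; each [pullout] fetches the next leg across the sums in between. *)
rewrite cv_pll; pullout 9%N; match_teval.
rewrite cv_p12l; pullout 9%N; match_teval; pullout 3%N; match_teval.
rewrite cv_tens3; pullout 8%N; match_teval; pullout 3%N; match_teval; match_teval.
rewrite cv_tens3; pullout 6%N; match_teval; pullout 2%N; match_teval; match_teval.
rewrite cv_tens3; pullout 4%N; match_teval; pullout 1%N; match_teval; match_teval.
rewrite cv_p12r; pullout 2%N; match_teval; match_teval.
rewrite cv_tens; pullout 1%N; match_teval; match_teval.
rewrite cv_plr; match_teval.
rewrite /g1_23 /g12_3V /phB !hcompE tmE mulcE m12E !shE !lgamE phikE.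
have -> p : inB p = p *: 1 by [].
rewrite idcE !mAE !actlE -[X in _ = X * a']/(_ * _).
by rewrite -scalerAl mul1r -!(scalerAr, scalerAl) !mulrA.
Qed.

Definition wrap2 (F : lhom T2 B) b b' : lhom T2 B :=
  (A b \c pl H H) ** F ** (A b' \c pl H H).

Lemma GamE a h a' b g b' :
  Gam act gam (box a h a') (box b g b') = a * wrap2 ga b b' (tens h g) * a'.
Proof.
rewrite /Gam !box_evalE; try by rewrite /box_eval; lin.
rewrite /wrap2 -cvmA; unsw.
rewrite cv_pll; match_teval.
rewrite cv_plr; match_teval.
by rewrite lgamE !mAE !actlE !mulrA.
Qed.

Lemma lhom2_eq (V : lmodType k) (F G : lhom T2 V) :
  (forall h g, F (tens h g) = G (tens h g)) -> F = G.
Proof. exact: lhom_tens_eq. Qed.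
Lemma lhom3_eq (V : lmodType k) (F G : lhom T3 V) :
  (forall h g f, F (tens h (tens g f)) = G (tens h (tens g f))) -> F = G.
Proof. exact: bil_tens_eq. Qed.

Lemma cm1_2 h g : (cm1 : lhom T2 B) (tens h g) = (counit H h * counit H g) *: 1.
Proof. by rewrite cm1E counit_tc. Qed.
Lemma cm1_3 h g f : (cm1 : lhom T3 B) (tens h (tens g f))
  = (counit H h * counit H g * counit H f) *: 1.
Proof. by rewrite cm1E counit_tc counit_tc mulrA. Qed.

Lemma gagaV : ga ** gaV = cm1.
Proof.
case: gam_inv => _ e _; apply: lhom2_eq => h g; rewrite cv_tens cm1_2.
rewrite -counit_hmul -[RHS](e h g) /hconv2; unsw.
by apply: eq_teval => h1 h2; apply: eq_teval => g1 g2; rewrite !lgamE.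
Qed.
Lemma gaVga : gaV ** ga = cm1.
Proof.
case: gam_inv => _ _ e; apply: lhom2_eq => h g; rewrite cv_tens cm1_2.
rewrite -counit_hmul -[RHS](e h g) /hconv2; unsw.
by apply: eq_teval => h1 h2; apply: eq_teval => g1 g2; rewrite !lgamE.
Qed.

Lemma A_mulc b : A b \c mulc H = A2 b.
Proof.
apply: lhom2_eq => h g.
by rewrite hcompE mulcE shE !actlE (act_hmul modalg).
Qed.

(** This is associative type read in Hom(H (x) H, B): since (hg) |> b = h |> (g |> b), the map in
    question is [A2 b]. *)
Lemma ga_A2 b : ga ** A2 b = A2 b ** ga.
Proof.
apply: lhom2_eq => h g; rewrite !cv_tens -A_mulc.
have := gam_assoc h g b; unsw => e; transitivity (teval
  (fun h1 h2 => teval (fun g1 g2 => gam h1 g1 * act (hmul h2 g2) b) (comul H g)) (comul H h)).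
  by apply: eq_teval => h1 h2; apply: eq_teval => g1 g2; rewrite hcompE mulcE lgamE.
rewrite e.
by apply: eq_teval => h1 h2; apply: eq_teval => g1 g2; rewrite hcompE mulcE lgamE.
Qed.
Lemma gaV_A2 b : gaV ** A2 b = A2 b ** gaV.
Proof. exact: cvm_invC gagaV gaVga (ga_A2 b). Qed.

Lemma ga_u1 : ga \c u1 H H = cm1.
Proof. by apply: lhom_eq => h; rewrite hcompE u1E lgamE; case: (gam_unital h). Qed.
Lemma ga_ur : ga \c ur H H = cm1.
Proof. by apply: lhom_eq => h; rewrite hcompE urE lgamE; case: (gam_unital h). Qed.
Lemma gaV_u1 : gaV \c u1 H H = cm1.
Proof. by apply: cvm_inv1 ga_u1; rewrite -cvm_pull gaVga cm1_pull. Qed.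
Lemma gaV_ur : gaV \c ur H H = cm1.
Proof. by apply: cvm_inv1 ga_ur; rewrite -cvm_pull gaVga cm1_pull. Qed.

Lemma phBE h g f : phB (tens h (tens g f)) = (phi h g f : k) *: 1.
Proof. by rewrite hcompE phikE. Qed.
Lemma phBVE h g f : phBV (tens h (tens g f)) = (phiV h g f : k) *: 1.
Proof. by rewrite hcompE phikVE. Qed.

Lemma inB_mul (a b : k^o) : inB (a * b) = inB a * inB b.
Proof. by rewrite /= -scalerAl mul1r scalerA. Qed.

Lemma phBphBV : phB ** phBV = cm1.
Proof.
apply: lhom3_eq => h g f; rewrite cv_tens3 cm1_3.
rewrite -[RHS]/(inB _) -phi_phiV; unsw; do 3 match_teval.
by rewrite phBE phBVE inB_mul.
Qed.
Lemma phBVphB : phBV ** phB = cm1.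
Proof.
apply: lhom3_eq => h g f; rewrite cv_tens3 cm1_3.
rewrite -[RHS]/(inB _) -phiV_phi; unsw; do 3 match_teval.
by rewrite phBE phBVE inB_mul.
Qed.

Definition mL : cmap T3 H := ccomp (mulc H) (m12 H H).
Definition mR : cmap T3 H := ccomp (mulc H) (tm (idc H) (mulc H)).
Lemma mLE h g f : mL (tens h (tens g f)) = hmul (hmul h g) f.
Proof. by rewrite [LHS]hcompE m12E mulcE. Qed.
Lemma mRE h g f : mR (tens h (tens g f)) = hmul h (hmul g f).
Proof. by rewrite [LHS]hcompE tmE !mulcE. Qed.

Lemma phi_mLR (t : T3) :
  teval (fun x y => (phik x : k) *: mL y) (comul T3 t)
  = teval (fun x y => (phik y : k) *: mR x) (comul T3 t).
Proof.
move: t; apply: tens3_eq => [||h g f]; [by lin|by lin|].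
have sc : bilin (fun (a : k^o) (x : H) => (a : k) *: x) by lin.
have sc' : bilin (fun (x : H) (a : k^o) => (a : k) *: x) by lin.
rewrite -[LHS]/(cv (Bil sc) phik mL _) -[RHS]/(cv (Bil sc') mR phik _) !cv_tens3.
have := phi_assoc h g f; unsw => e; etransitivity; [|etransitivity; [exact: e|]];
  do 3 (apply: eq_teval => ? ?); rewrite phikE ?mLE ?mRE //.
Qed.

(** Quasi-associativity of [H] tested against a linear map [G]: phi exchanges the two bracketings
    under any function of the triple product. *)
Lemma phB_conv (G : lhom H B) : phB ** (G \c mL) = (G \c mR) ** phB.
Proof.
apply: lhom_eq => t; have /(congr1 G) := phi_mLR t.
rewrite !(teval_map (L := G)); try by lin.
move=> e; etransitivity; [|etransitivity; [exact: e|]]; apply: eq_teval => x y.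
  by rewrite mAE hlinZ -[phB x]/((phik x : k) *: 1) -scalerAl mul1r.
by rewrite mAE hlinZ -[phB y]/((phik y : k) *: 1) -scalerAr mulr1.
Qed.

Definition g23V : lhom T3 B := sh gaV.
Definition g1_23V : lhom T3 B := gaV \c tm (idc H) (mulc H).
Definition g12_3 : lhom T3 B := ga \c m12 H H.
Definition g12 : lhom T3 B := ga \c p12 H H.
Definition OmV : lhom T3 B := g12 ** g12_3 ** phBV ** g1_23V ** g23V.

Lemma g23K : g23 ** g23V = cm1. Proof. by rewrite -shM gagaV sh1. Qed.
Lemma g23VK : g23V ** g23 = cm1. Proof. by rewrite -shM gaVga sh1. Qed.
Lemma g1_23K : g1_23 ** g1_23V = cm1. Proof. by rewrite -cvm_pull gagaV cm1_pull. Qed.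
Lemma g1_23VK : g1_23V ** g1_23 = cm1. Proof. by rewrite -cvm_pull gaVga cm1_pull. Qed.
Lemma g12_3K : g12_3 ** g12_3V = cm1. Proof. by rewrite -cvm_pull gagaV cm1_pull. Qed.
Lemma g12_3VK : g12_3V ** g12_3 = cm1. Proof. by rewrite -cvm_pull gaVga cm1_pull. Qed.
Lemma g12K : g12 ** g12V = cm1. Proof. by rewrite -cvm_pull gagaV cm1_pull. Qed.
Lemma g12VK : g12V ** g12 = cm1. Proof. by rewrite -cvm_pull gaVga cm1_pull. Qed.

Lemma OmOmV : Om ** OmV = cm1.
Proof.
rewrite /Om /OmV -!cvmA (cvmKl _ g12VK) (cvmKl _ g12_3VK) (cvmKl _ phBphBV).
by rewrite (cvmKl _ g1_23K) g23K.
Qed.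
Lemma OmVOm : OmV ** Om = cm1.
Proof.
rewrite /Om /OmV -!cvmA (cvmKl _ g23VK) (cvmKl _ g1_23VK) (cvmKl _ phBVphB).
by rewrite (cvmKl _ g12_3K) g12K.
Qed.

Lemma A_mL d : A d \c mL = A3 d.
Proof.
by apply: lhom3_eq => h g f; rewrite hcompE mLE !shE !actlE !(act_hmul modalg).
Qed.
Lemma A_mR d : A d \c mR = A3 d.
Proof.
by apply: lhom3_eq => h g f; rewrite hcompE mRE !shE !actlE !(act_hmul modalg).
Qed.
Lemma A2_m12 d : A2 d \c m12 H H = A3 d.
Proof. by rewrite -A_mL -A_mulc; apply: lhom_eq. Qed.
Lemma A2_23 d : A2 d \c tm (idc H) (mulc H) = A3 d.
Proof. by rewrite -A_mR -A_mulc; apply: lhom_eq. Qed.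

(** With f fixed, h |> (g |> (f |> d)) is [A2 e] at e = f |> d, so commutation with every [A2 e] is
    enough. *)
Lemma p12_A3 (x : lhom T2 B) d : (forall e, x ** A2 e = A2 e ** x) ->
  (x \c p12 H H) ** A3 d = A3 d ** (x \c p12 H H).
Proof.
move=> c; apply: lhom3_eq => h g f.
have e := congr1 (fun F : lhom T2 B => F (tens h g)) (c (act f d)).
rewrite !cv_tens in e; rewrite cv_p12l cv_p12r; etransitivity; [|etransitivity; [exact: e|]].
all: by do 2 (apply: eq_teval => ? ?); rewrite !shE.
Qed.

(** Each of the five factors commutes with [A3 d]. The gamma-factors do so by associative type, and
    [phB] because both bracketings of the triple product act on d by [A3 d]. This is the source of
    the condition Phi(X, Y, Zb) = Phi(X, Y, Z\bar b). *)
Lemma Om_A3 d : Om ** A3 d = A3 d ** Om.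
Proof.
have e1 : g12V ** A3 d = A3 d ** g12V by apply: p12_A3 => e; apply: gaV_A2.
have e2 : g12_3V ** A3 d = A3 d ** g12_3V by rewrite -A2_m12 -!cvm_pull gaV_A2.
have e3 : phB ** A3 d = A3 d ** phB by rewrite -{1}A_mL phB_conv A_mR.
have e4 : g1_23 ** A3 d = A3 d ** g1_23 by rewrite -A2_23 -!cvm_pull ga_A2.
have e5 : g23 ** A3 d = A3 d ** g23 by rewrite -!shM ga_A2.
rewrite /Om -!cvmA e1 (cvmA _ (A3 d)) e2 -cvmA (cvmA _ (A3 d)) e3 -cvmA.
by rewrite (cvmA _ (A3 d)) e4 -cvmA (cvmA _ (A3 d)) e5 -!cvmA.
Qed.

Section T4Maps.
(** The maps [q1] to [q5] produce the argument triples of the five associators in the pentagon: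
    [q1], [q2] on one side and [q3], [q4], [q5] on the other. *)
Definition q1 : cmap T4 T3 := tm (idc H) (tm (idc H) (mulc H)).
Definition q2 : cmap T4 T3 := m12 H T2.
Definition q3 : cmap T4 T3 := pr H T3.
Definition q4 : cmap T4 T3 := tm (idc H) (m12 H H).
Definition q5 : cmap T4 T3 := tm (idc H) (p12 H H).
Variables h g f l : H.
Local Notation t := (tens h (tens g (tens f l))).
Lemma q1E : q1 t = tens h (tens g (hmul f l)). Proof. by rewrite /q1 !tmE mulcE. Qed.
Lemma q2E : q2 t = tens (hmul h g) (tens f l). Proof. exact: m12E. Qed.
Lemma q3E : q3 t = (counit H h : k) *: tens g (tens f l) :> T3. Proof. exact: prE. Qed.
Lemma q4E : q4 t = tens h (tens (hmul g f) l). Proof. by rewrite /q4 tmE m12E. Qed.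
Lemma q5E : q5 t = (counit H l : k) *: tens h (tens g f) :> T3.
Proof. by rewrite /q5 tmE p12E (linZ _ _ (f := tens h)) //; lin. Qed.
End T4Maps.

Lemma lhom4_eq (V : lmodType k) (F G : lhom T4 V) :
  (forall h g f l, F (tens h (tens g (tens f l))) = G (tens h (tens g (tens f l)))) -> F = G.
Proof. exact: tril_tens_eq. Qed.

Lemma cv_q5r (U V W : lmodType k) (op : bil U V W) (F : lhom T3 V) (G : lhom T4 U) h g f l :
  cv op G (F \c q5) (tens h (tens g (tens f l))) =
  teval (fun h1 h2 => teval (fun g1 g2 => teval (fun f1 f2 =>
    op (G (tens h1 (tens g1 (tens f1 l)))) (F (tens h2 (tens g2 f2))))
    (comul H f)) (comul H g)) (comul H h).
Proof.
rewrite cv_slice; apply: eq_teval => h1 h2.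
have -> : slice (F \c q5) h2 = slice F h2 \c p12 H H.
  by apply: lhom_eq => x; rewrite -[LHS]/(F (tm (idc H) (p12 H H) (tens h2 x))) tmE.
rewrite (cv_p12r op (slice F h2) (slice G h1) g f l).
by do 2 (apply: eq_teval => ? ?); rewrite !sliceE.
Qed.

Lemma cv_tens4 (U V W : lmodType k) (op : bil U V W) (F : lhom T4 U) (G : lhom T4 V) h g f l :
  cv op F G (tens h (tens g (tens f l))) =
  teval (fun h1 h2 => teval (fun g1 g2 => teval (fun f1 f2 => teval (fun l1 l2 =>
    op (F (tens h1 (tens g1 (tens f1 l1)))) (G (tens h2 (tens g2 (tens f2 l2)))))
    (comul H l)) (comul H f)) (comul H g)) (comul H h).
Proof.
rewrite cv_slice; apply: eq_teval => h1 h2; rewrite cv_tens3.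
by do 3 (apply: eq_teval => ? ?); rewrite !sliceE.
Qed.

Lemma pentagon_phi :
  (phB \c q1) ** (phB \c q2) = (phB \c q3) ** ((phB \c q4) ** (phB \c q5)).
Proof.
apply: lhom4_eq => h g f l.
have e := phi_cocycle h g f l; move: e; unsw => e.
etransitivity; [|etransitivity; [exact: (congr1 (hfun inB) e)|]].
  rewrite cv_tens4; do 4 match_teval.
  by rewrite !hcompE q1E q2E !phikE inB_mul.
move=> {e}; symmetry; rewrite (cv_prl (C := H) (D := T3)) tevaltc; last by lin.
etransitivity.
  apply: eq_teval => g1 g2; rewrite tevaltc; last by lin.
  do 2 (apply: eq_teval; intros ? ?); rewrite cv_q5r.
  do 3 (rewrite (teval_map (L := bfun (mA B) _)); [apply: eq_teval; intros ? ? | lin]).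
  reflexivity.
cbv beta; pullout 3%N; match_teval; match_teval.
pullout 2%N; match_teval; match_teval.
pullout 1%N; match_teval; match_teval.
by rewrite !mAE !hcompE q4E !phikE !inB_mul mulrA.
Qed.

Definition i_l : cmap T2 T3 := u1 H T2.
Definition i_m : cmap T2 T3 := tm (idc H) (u1 H H).
Definition i_r : cmap T2 T3 := tm (idc H) (ur H H).
Lemma i_lE h g : i_l (tens h g) = tens (hone H) (tens h g). Proof. by []. Qed.
Lemma i_mE h g : i_m (tens h g) = tens h (tens (hone H) g). Proof. by rewrite /i_m tmE. Qed.
Lemma i_rE h g : i_r (tens h g) = tens h (tens g (hone H)). Proof. by rewrite /i_r tmE. Qed.

Lemma phB_m : phB \c i_m = cm1.
Proof.
apply: lhom2_eq => h g.
by rewrite hcompE i_mE phBE phi1 cm1_2 counit_hmul.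
Qed.

(** Only phi(h, 1, g) is normalised by axiom. The pentagon at (1, 1, h, g) shows that x = phi(1, -,
    -) satisfies x = x x in the convolution algebra, and an invertible idempotent is the unit. *)
Lemma phB_l : phB \c i_l = cm1.
Proof.
have inv : (phBV \c i_l) ** (phB \c i_l) = cm1 by rewrite -cvm_pull phBVphB cm1_pull.
apply: (cvm_idem1 inv).
pose w : cmap T2 T4 := ccomp (u1 H T3) i_l.
have wE h g : w (tens h g) = tens (hone H) (tens (hone H) (tens h g)) by [].
have := congr1 (fun F => F \c w) pentagon_phi; rewrite !cvm_pull.
have -> : phB \c q1 \c w = cm1.
  rewrite -(cm1_pull (mulc H)) -(cm1_pull (u1 H H)) -phB_m; apply: lhom2_eq => h g.
  by rewrite hcompE wE hcompE q1E [RHS]hcompE mulcE [RHS]hcompE u1E [RHS]hcompE i_mE.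
have -> : phB \c q2 \c w = phB \c i_l.
  by apply: lhom2_eq => h g; rewrite hcompE wE [RHS]hcompE hcompE q2E hmul1l.
have -> : phB \c q3 \c w = phB \c i_l.
  by apply: lhom2_eq => h g; rewrite hcompE wE [RHS]hcompE hcompE q3E counit_hone scale1r.
have -> : phB \c q4 \c w = phB \c i_l.
  by apply: lhom2_eq => h g; rewrite hcompE wE [RHS]hcompE hcompE q4E hmul1l.
have -> : phB \c q5 \c w = cm1.
  apply: lhom2_eq => h g; rewrite hcompE wE hcompE q5E hlinZ phBE phi1.
  by rewrite hmul1l cm1_2 scalerA mulrC.
by rewrite cvm1l cvm1r => <-.
Qed.

(** The argument of [phB_l] at (h, g, 1, 1). *)
Lemma phB_r : phB \c i_r = cm1.
Proof.
have inv : (phBV \c i_r) ** (phB \c i_r) = cm1 by rewrite -cvm_pull phBVphB cm1_pull.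
apply: (cvm_idem1 inv).
pose w : cmap T2 T4 := ccomp (tm (idc H) (tm (idc H) (ur H H))) i_r.
have wE h g : w (tens h g) = tens h (tens g (tens (hone H) (hone H))).
  by rewrite [LHS]hcompE i_rE !tmE.
have := congr1 (fun F => F \c w) pentagon_phi; rewrite !cvm_pull.
have -> : phB \c q1 \c w = phB \c i_r.
  by apply: lhom2_eq => h g; rewrite hcompE wE [RHS]hcompE hcompE q1E hmul1r i_rE.
have -> : phB \c q2 \c w = cm1.
  apply: lhom2_eq => h g; rewrite hcompE wE hcompE q2E phBE phi1 cm1_2.
  by rewrite hmul1r counit_hmul.
have -> : phB \c q3 \c w = cm1.
  apply: lhom2_eq => h g; rewrite hcompE wE hcompE q3E hlinZ phBE phi1 cm1_2.
  by rewrite hmul1r scalerA.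
have -> : phB \c q4 \c w = phB \c i_r.
  by apply: lhom2_eq => h g; rewrite hcompE wE [RHS]hcompE hcompE q4E hmul1r i_rE.
have -> : phB \c q5 \c w = phB \c i_r.
  by apply: lhom2_eq => h g; rewrite hcompE wE [RHS]hcompE hcompE q5E counit_hone scale1r i_rE.
by rewrite cvm1l cvm1r => <-.
Qed.

(** A unit argument trivialises phi and two of the gamma-factors; the remaining gamma and gamma^-1
    have the same arguments and cancel. The same happens in [Om_m] and [Om_r], with other factors
    surviving. *)
Lemma Om_l : Om \c i_l = cm1.
Proof.
rewrite /Om !cvm_pull phB_l.
have -> : g23 \c i_l = ga.
  by apply: lhom2_eq => h g; rewrite hcompE i_lE shE (act1l modalg).
have -> : g1_23 \c i_l = cm1.
  rewrite -(cm1_pull (mulc H)) -ga_u1; apply: lhom2_eq => h g.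
  by rewrite !hcompE i_lE tmE.
have -> : g12_3V \c i_l = gaV.
  by apply: lhom2_eq => h g; rewrite !hcompE i_lE m12E hmul1l.
have -> : g12V \c i_l = cm1.
  rewrite -(cm1_pull (pl H H)) -gaV_u1; apply: lhom2_eq => h g.
  by rewrite !hcompE i_lE /p12 tmE.
by rewrite !cvm1r gagaV.
Qed.

Lemma Om_m : Om \c i_m = cm1.
Proof.
rewrite /Om !cvm_pull phB_m.
have -> : g23 \c i_m = cm1.
  rewrite -(sh1 H) -ga_u1; apply: lhom2_eq => h g.
  by rewrite hcompE i_mE !shE.
have -> : g1_23 \c i_m = ga.
  by apply: lhom2_eq => h g; rewrite !hcompE i_mE tmE mulcE hmul1l.
have -> : g12_3V \c i_m = gaV.
  by apply: lhom2_eq => h g; rewrite !hcompE i_mE m12E hmul1r.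
have -> : g12V \c i_m = cm1.
  rewrite -(cm1_pull (pl H H)) -gaV_ur; apply: lhom2_eq => h g.
  by rewrite !hcompE i_mE p12E plE !hlinZ.
by rewrite cvm1l !cvm1r gagaV.
Qed.

Lemma Om_r : Om \c i_r = cm1.
Proof.
rewrite /Om !cvm_pull phB_r.
have -> : g23 \c i_r = cm1.
  rewrite -(sh1 H) -ga_ur; apply: lhom2_eq => h g.
  by rewrite hcompE i_rE !shE.
have -> : g1_23 \c i_r = ga.
  by apply: lhom2_eq => h g; rewrite !hcompE i_rE tmE mulcE hmul1r.
have -> : g12_3V \c i_r = cm1.
  rewrite -(cm1_pull (mulc H)) -gaV_ur; apply: lhom2_eq => h g.
  by rewrite !hcompE i_rE m12E mulcE.
have -> : g12V \c i_r = gaV.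
  by apply: lhom2_eq => h g; rewrite !hcompE i_rE p12E counit_hone scale1r.
by rewrite cvm1l !cvm1r gagaV.
Qed.

(** * Balanced extension of functionals from tensor powers of H to B (x) H (x) B *)

Definition ext2 (F : lhom T2 B) (X Y : M) : B :=
  box_eval (fun b g b' => box_eval (fun a h a' => a * wrap2 F b b' (tens h g) * a') X) Y.
Definition ext3 (F : lhom T3 B) (X Y Z : M) : B :=
  box_eval (fun c f c' => box_eval (fun b g b' => box_eval (fun a h a' =>
    a * wrap3 F b c c' b' (tens h (tens g f)) * a') X) Y) Z.

Lemma cv_op_lin (C : coalgebra k) (S U V W : lmodType k) (op : bil U V W)
   (F : S -> lhom C U) (G : S -> lhom C V) c :
   (forall x y, linear (fun s => op (F s x) (G s y))) ->
   linear (fun s => cv op (F s) (G s) c).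
Proof. by move=> l; apply: lin_tevalF => x y; apply: l. Qed.

Lemma wrap2_linl F b' t : linear (fun b => wrap2 F b b' t).
Proof.
apply: cv_op_lin => x y; apply: lin_b1; first exact: bbil.
apply: cv_op_lin => u v; apply: lin_b1; first exact: bbil.
exact: (act_bil'.1 _).
Qed.
Lemma wrap2_linr F b t : linear (fun b' => wrap2 F b b' t).
Proof.
apply: cv_op_lin => x y; apply: lin_b2; first exact: bbil.
exact: (act_bil'.1 _).
Qed.

Lemma sh_actl_lin x : linear (fun b => sh (A b) x).
Proof.
move=> a u v; move: x; apply: tens_eq => [||h g]; [by lin| |].
  by move=> c y z; rewrite !hlin !scalerDr !scalerA addrACA (mulrC a c).
by rewrite !shE !actlE act_bil'.1 !act_bil'.1.
Qed.

Lemma wrap3_lin1 F c c' b' t : linear (fun b => wrap3 F b c c' b' t).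
Proof.
do 4 (apply: cv_op_lin => ? ?; apply: lin_b1; first exact: bbil).
exact: (act_bil'.1 _).
Qed.
Lemma wrap3_lin2 F b c' b' t : linear (fun c => wrap3 F b c c' b' t).
Proof.
do 3 (apply: cv_op_lin => ? ?; apply: lin_b1; first exact: bbil).
apply: cv_op_lin => ? ?; apply: lin_b2; first exact: bbil.
exact: (sh_actl_lin (p12 H H _)).
Qed.
Lemma wrap3_lin3 F b c b' t : linear (fun c' => wrap3 F b c c' b' t).
Proof.
apply: cv_op_lin => ? ?; apply: lin_b1; first exact: bbil.
apply: cv_op_lin => ? ?; apply: lin_b2; first exact: bbil.
exact: (sh_actl_lin (p12 H H _)).
Qed.
Lemma wrap3_lin4 F b c c' t : linear (fun b' => wrap3 F b c c' b' t).
Proof.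
apply: cv_op_lin => ? ?; apply: lin_b2; first exact: bbil.
exact: (act_bil'.1 _).
Qed.
Local Hint Resolve wrap2_linl wrap2_linr wrap3_lin1 wrap3_lin2 wrap3_lin3 wrap3_lin4 : bil.

Lemma ext2E F a h a' b g b' :
  ext2 F (box a h a') (box b g b') = a * wrap2 F b b' (tens h g) * a'.
Proof.
by rewrite /ext2 !box_evalE // /box_eval; lin.
Qed.

Lemma ext3E F a h a' b g b' c f c' :
  ext3 F (box a h a') (box b g b') (box c f c')
  = a * wrap3 F b c c' b' (tens h (tens g f)) * a'.
Proof. by rewrite /ext3 !box_evalE // /box_eval; lin. Qed.

Lemma ext2_bil F : bilin (ext2 F).
Proof. by rewrite /ext2 /box_eval; lin. Qed.
Lemma ext3_tril F : trilin (ext3 F).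
Proof. by rewrite /ext3 /box_eval; lin. Qed.

Local Hint Resolve ext2_bil ext3_tril : bil.
Local Notation P := (ext3 Om).
Local Notation G12 := (ga \c p12 H T2).
Local Notation G12V := (gaV \c p12 H T2).

Lemma box_eq2 (W : lmodType k) (f g : M -> M -> W) : bilin f -> bilin g ->
  (forall a h a' b x b', f (box a h a') (box b x b') = g (box a h a') (box b x b')) ->
  forall X Y, f X Y = g X Y.
Proof.
move=> bf bg fg X Y; move: X; apply: box_eq => [||a h a']; [by lin|by lin|].
by move: Y; apply: box_eq => [||b x b']; [lin|lin|].
Qed.

Lemma box_eq3 (W : lmodType k) (f g : M -> M -> M -> W) : trilin f -> trilin g ->
  (forall a h a' b x b' c y c',
    f (box a h a') (box b x b') (box c y c') = g (box a h a') (box b x b') (box c y c')) ->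
  forall X Y Z, f X Y Z = g X Y Z.
Proof.
move=> bf bg fg X Y Z; move: X Y; apply: box_eq2 => [||a h a' b x b']; [by lin|by lin|].
by move: Z; apply: box_eq => [||c z c']; [lin|lin|].
Qed.

Lemma ext2_lB F d X Y : ext2 F (lB d X) Y = d * ext2 F X Y.
Proof.
move: X Y; apply: box_eq2 => [||a h a' b x b']; [by lin|by lin|].
by rewrite lB_box !ext2E !mulrA.
Qed.
Lemma ext2_lbB F d X Y : ext2 F (lbB d X) Y = ext2 F X Y * d.
Proof.
move: X Y; apply: box_eq2 => [||a h a' b x b']; [by lin|by lin|].
by rewrite lbB_box !ext2E !mulrA.
Qed.
Lemma ext3_lB F d X Y Z : ext3 F (lB d X) Y Z = d * ext3 F X Y Z.
Proof.
move: X Y Z; apply: box_eq3 => [||a h a' b x b' c y c']; [by lin|by lin|].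
by rewrite lB_box !ext3E !mulrA.
Qed.
Lemma ext3_lbB F d X Y Z : ext3 F (lbB d X) Y Z = ext3 F X Y Z * d.
Proof.
move: X Y Z; apply: box_eq3 => [||a h a' b x b' c y c']; [by lin|by lin|].
by rewrite lbB_box !ext3E !mulrA.
Qed.

Lemma ext2_rB F d X Y : ext2 F (rB d X) Y = ext2 F X (lB d Y).
Proof.
move: X Y; apply: box_eq2 => [||a h a' b g b']; [by lin|by lin|].
rewrite rB_box lB_box ext2E ext2_lB ext2_lbB mulrA; congr (_ * _ * _).
have -> : wrap2 F (d * b) b' = (A d \c pl H H) ** wrap2 F b b'.
  by rewrite /wrap2 actlM cvm_pull -!cvmA.
rewrite [(A d |> J) h]cvE (teval_map (L := fun X => ext2 F X (box b g b'))); last by lin.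
rewrite cv_pll; apply: eq_teval => h1 h2.
by rewrite ext2_lB [J h2]/= ext2E mul1r mulr1.
Qed.

Lemma ext2_rbB F d X Y : ext2 F (rbB d X) Y = ext2 F X (lbB d Y).
Proof.
move: X Y; apply: box_eq2 => [||a h a' b g b']; [by lin|by lin|].
rewrite rbB_box lbB_box ext2E ext2_lB ext2_lbB mulrA; congr (_ * _ * _).
have -> : wrap2 F b (b' * d) = wrap2 F b b' ** (A d \c pl H H).
  by rewrite /wrap2 actlM cvm_pull -!cvmA.
rewrite [(J <| A d) h]cvE (teval_map (L := fun X => ext2 F X (box b g b'))); last by lin.
rewrite cv_plr; apply: eq_teval => h1 h2.
by rewrite -[lbS _ _]/(lbB _ _) ext2_lbB [J h1]/= ext2E mul1r mulr1.
Qed.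

Lemma ext2_hom F : is_hom2 D0 (ext2 F).
Proof.
split; [exact: ext2_bil | exact: ext2_lB | exact: ext2_lbB | exact: ext2_rB | exact: ext2_rbB].
Qed.

Lemma ext3_rB1 F d X Y Z : ext3 F (rB d X) Y Z = ext3 F X (lB d Y) Z.
Proof.
move: X Y Z; apply: box_eq3 => [||a h a' b g b' c f c']; [by lin|by lin|].
rewrite rB_box lB_box ext3E ext3_lB ext3_lbB mulrA; congr (_ * _ * _).
have -> : wrap3 F (d * b) c c' b' = (A d \c pl H T2) ** wrap3 F b c c' b'.
  by rewrite /wrap3 actlM cvm_pull -!cvmA.
rewrite [(A d |> J) h]cvE (teval_map (L := fun X => ext3 F X (box b g b') (box c f c')));
  last by lin.
rewrite cv_pll; apply: eq_teval => h1 h2.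
by rewrite ext3_lB [J h2]/= ext3E mul1r mulr1.
Qed.

Lemma ext3_rbB1 F d X Y Z : ext3 F (rbB d X) Y Z = ext3 F X (lbB d Y) Z.
Proof.
move: X Y Z; apply: box_eq3 => [||a h a' b g b' c f c']; [by lin|by lin|].
rewrite rbB_box lbB_box ext3E ext3_lB ext3_lbB mulrA; congr (_ * _ * _).
have -> : wrap3 F b c c' (b' * d) = wrap3 F b c c' b' ** (A d \c pl H T2).
  by rewrite /wrap3 actlM cvm_pull -!cvmA.
rewrite [(J <| A d) h]cvE (teval_map (L := fun X => ext3 F X (box b g b') (box c f c')));
  last by lin.
rewrite cv_plr; apply: eq_teval => h1 h2.
by rewrite -[lbS _ _]/(lbB _ _) ext3_lbB [J h1]/= ext3E mul1r mulr1.
Qed.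

Lemma ext3_J F h g f : ext3 F (J h) (J g) (J f) = F (tens h (tens g f)).
Proof.
rewrite [LHS]ext3E mul1r mulr1 /wrap3 !actl1 !sh1 !cm1_pull !cvm1l !cvm1r //.
Qed.
Lemma ext2_J F h g : ext2 F (J h) (J g) = F (tens h g).
Proof.
rewrite [LHS]ext2E mul1r mulr1 /wrap2 !actl1 !cm1_pull !cvm1l !cvm1r //.
Qed.

(* By the relations in the first factor, it suffices to move [d] past [1 g 1]. *)
Lemma ext3_rB2 F d X Y Z : ext3 F X (rB d Y) Z = ext3 F X Y (lB d Z).
Proof.
have E h g Z' : ext3 F (J h) (rB d (J g)) Z' = ext3 F (J h) (J g) (lB d Z').
  move: Z'; apply: box_eq => [||c f c']; [by lin|by lin|].
  rewrite -[rB d _]/((bilr rB d \c J) g) rBJ lB_box.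
  rewrite cvE (teval_map (L := fun X => ext3 F (J h) X (box c f c'))); last by lin.
  rewrite [RHS]ext3E mul1r mulr1.
  have -> : wrap3 F 1 (d * c) c' 1 = (A2 d \c p12 H H) ** wrap3 F 1 c c' 1.
    by rewrite /wrap3 actlM shM !actl1 cm1_pull !cvm1l !cvm1r cvm_pull -!cvmA.
  rewrite cv_p12l teval_exch; apply: eq_teval => g1 g2.
  rewrite -ext3_rB1 -[rB _ _]/((bilr rB (A d g1) \c J) h) rBJ.
  rewrite cvE (teval_map (L := fun X => ext3 F X (J g2) (box c f c'))); last by lin.
  by apply: eq_teval => h1 h2; rewrite ext3_lB [J h2]/= [J g2]/= ext3E mul1r mulr1 shE.
have EX X' g Z' : ext3 F X' (rB d (J g)) Z' = ext3 F X' (J g) (lB d Z').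
  by move: X'; apply: M_eq => [||a h a'];
    [lin | lin | rewrite !ext3_lB !ext3_lbB E].
move: Y; apply: M_eq => [||b g b']; [by lin|by lin|].
by rewrite rB_lB rB_lbB -!ext3_rB1 -!ext3_rbB1 EX.
Qed.

Lemma ext3_rbB2 F d X Y Z : ext3 F X (rbB d Y) Z = ext3 F X Y (lbB d Z).
Proof.
have E h g Z' : ext3 F (J h) (rbB d (J g)) Z' = ext3 F (J h) (J g) (lbB d Z').
  move: Z'; apply: box_eq => [||c f c']; [by lin|by lin|].
  rewrite -[rbB d _]/((bilr rbB d \c J) g) rbBJ lbB_box.
  rewrite cvE (teval_map (L := fun X => ext3 F (J h) X (box c f c'))); last by lin.
  rewrite [RHS]ext3E mul1r mulr1.
  have -> : wrap3 F 1 c (c' * d) 1 = wrap3 F 1 c c' 1 ** (A2 d \c p12 H H).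
    by rewrite /wrap3 actlM shM !actl1 cm1_pull !cvm1l !cvm1r cvm_pull -!cvmA.
  rewrite cv_p12r teval_exch; apply: eq_teval => g1 g2.
  rewrite -[lbS _ _]/(lbB _ _).
  rewrite -ext3_rbB1 -[rbB _ _]/((bilr rbB (A d g2) \c J) h) rbBJ.
  rewrite cvE (teval_map (L := fun X => ext3 F X (J g1) (box c f c'))); last by lin.
  apply: eq_teval => h1 h2.
  by rewrite -[lbS _ _]/(lbB _ _) ext3_lbB [J h1]/= [J g1]/= ext3E mul1r mulr1 shE.
have EX X' g Z' : ext3 F X' (rbB d (J g)) Z' = ext3 F X' (J g) (lbB d Z').
  by move: X'; apply: M_eq => [||a h a'];
    [lin | lin | rewrite !ext3_lB !ext3_lbB E].
move: Y; apply: M_eq => [||b g b']; [by lin|by lin|].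
by rewrite rbB_lB rbB_lbB -!ext3_rB1 -!ext3_rbB1 EX.
Qed.

Lemma ext3_hom F : is_hom3 D0 (ext3 F).
Proof.
split; [exact: ext3_tril | exact: ext3_lB | exact: ext3_lbB | exact: ext3_rB1
 | exact: ext3_rbB1 | exact: ext3_rB2 | exact: ext3_rbB2].
Qed.

(** Balancing moves the coefficients of [Y] onto [X], and left linearity strips those of [X]. The
    point is that a convolution inverse known only to exist is the extension of some functional on H
    (x) H. *)
Lemma is_hom2_ext f (fh : is_hom2 D0 f) X Y :
  f X Y = ext2 (lin2 (Bil (ltac:(have fb := hom2_bilin fh; lin) : bilin
    (fun h g => f (J h) (J g))))) X Y.
Proof.
set F := lin2 _.
have fb := hom2_bilin fh.
have fl := hom2_lact fh; have flb := hom2_lbact fh; have fr := hom2_bal fh; have frb := hom2_balb fh.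
have fJ h g : f (J h) (J g) = ext2 F (J h) (J g) by rewrite ext2_J [RHS]lin2E.
have EX X' g : f X' (J g) = ext2 F X' (J g).
  move: X'; apply: M_eq => [||a h a']; [by lin|by lin|].
  by rewrite ext2_lB ext2_lbB [LHS]fl [f _ _]flb fJ.
move: Y; apply: M_eq => [||b g b']; [by lin|by lin|].
by rewrite -[LHS]fr -[LHS]frb EX -ext2_rB -ext2_rbB.
Qed.

Lemma eq_dia_eval (V : lmodType k) (F G : M -> M -> V) (t : diamond D0) :
  (forall X Y, F X Y = G X Y) -> dia_eval F t = dia_eval G t.
Proof. exact: eq_teval. Qed.

(* Relations on the outer variable are turned into right actions on the inner
   one and then cancel by the Takeuchi condition. *)
Lemma nest (V : lmodType k) (G : M -> M -> M -> M -> V) X :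
  (forall Y1 Y2, good2 (fun X1 X2 => G X1 X2 Y1 Y2)) ->
  (forall X1 X2, bilin (G X1 X2)) ->
  (forall d X1 X2 Y1 Y2, G X1 X2 (lbB d Y1) Y2 = G (rbB d X1) X2 Y1 Y2) ->
  (forall d X1 X2 Y1 Y2, G X1 X2 Y1 (lB d Y2) = G X1 (rB d X2) Y1 Y2) ->
  good2 (fun Y1 Y2 => dia_eval (fun X1 X2 => G X1 X2 Y1 Y2) (bhb_comul act X)).
Proof.
move=> gx bG t1 t2; split; first split=> [Y1|Y2].
- by apply: lin_dia_evalF => X1 X2; case: (bG X1 X2).
- by apply: lin_dia_evalF => X1 X2; case: (bG X1 X2).
move=> d Y1 Y2; move: X; apply: box_eq => [||a h a']; [exact: swL2_lin|exact: swL2_lin|].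
rewrite !swL2E //; under eq_teval do rewrite t1.
by under [RHS]eq_teval do rewrite t2; apply: (tk (F := fun X1 X2 => G X1 X2 Y1 Y2)).
Qed.

(** The bialgebroid sums are written with the last argument split outermost, so convolution products
    are needed with their sums in that order as well. *)
Lemma cv_tens2' (C D : coalgebra k) (U V W : lmodType k) (op : bil U V W)
  (F : lhom (tc C D) U) (G : lhom (tc C D) V) c d :
  cv op F G (tens c d) = teval (fun d1 d2 => teval (fun c1 c2 =>
     op (F (tens c1 d1)) (G (tens c2 d2))) (comul C c)) (comul D d).
Proof. by rewrite cv_tens teval_exch. Qed.

Lemma cv_tens3' (C D E : coalgebra k) (U V W : lmodType k) (op : bil U V W)
  (F : lhom (tc C (tc D E)) U) (G : lhom (tc C (tc D E)) V) c d e :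
  cv op F G (tens c (tens d e)) = teval (fun e1 e2 => teval (fun d1 d2 => teval (fun c1 c2 =>
     op (F (tens c1 (tens d1 e1))) (G (tens c2 (tens d2 e2)))) (comul C c)) (comul D d)) (comul E e).
Proof.
rewrite cv_tens3; symmetry; pullout 2%N; apply: eq_teval => c1 c2.
by rewrite teval_exch.
Qed.

(** The coproduct leaves a and b in the first legs and a', b' in the second, so the coefficients to
    the left go entirely to [F] and those to the right to [G]. Extension is thus multiplicative, and
    inverses in Hom(H (x) H, B) extend to inverses. *)
Lemma conv2_ext F G X Y :
  dia_eval (fun Y1 Y2 => dia_eval (fun X1 X2 => ext2 F X1 Y1 * ext2 G X2 Y2)
    (bhb_comul act X)) (bhb_comul act Y) = ext2 (F ** G) X Y.
Proof.
have gx Y1 Y2 : good2 (fun X1 X2 => ext2 F X1 Y1 * ext2 G X2 Y2).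
  by split=> [|d X1 X2]; [lin | rewrite ext2_lbB ext2_lB mulrA].
have gy X0 : good2 (fun Y1 Y2 =>
    dia_eval (fun X1 X2 => ext2 F X1 Y1 * ext2 G X2 Y2) (bhb_comul act X0)).
  apply: (nest (G := fun X1 X2 Y1 Y2 => ext2 F X1 Y1 * ext2 G X2 Y2)) =>
    // [X1 X2|d X1 X2 Y1 Y2|d X1 X2 Y1 Y2].
  - by lin.
  - by rewrite ext2_rbB.
  - by rewrite ext2_rB.
have bl : bilin (fun X Y => dia_eval (fun Y1 Y2 => dia_eval
  (fun X1 X2 => ext2 F X1 Y1 * ext2 G X2 Y2)
    (bhb_comul act X)) (bhb_comul act Y)).
  split=> [X0|Y0]; first exact: swL2_lin.
  by apply: lin_dia_evalF => Y1 Y2; apply: swL2_lin.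
move: X Y; apply: box_eq2 => [//||a h a' b g b']; first by lin.
rewrite swL2E // ext2E.
have -> : wrap2 (F ** G) b b' = wrap2 F b 1 ** wrap2 G 1 b'.
  by rewrite /wrap2 !actl1 cm1_pull cvm1l cvm1r -!cvmA.
rewrite cv_tens2'; match_teval.
rewrite swL2E //; match_teval.
by rewrite !ext2E mulr1 mul1r !mulrA.
Qed.

Lemma conv3_good F G :
  [/\ forall Y1 Y2 Z1 Z2, good2 (fun X1 X2 => ext3 F X1 Y1 Z1 * ext3 G X2 Y2 Z2),
      forall X Z1 Z2, good2 (fun Y1 Y2 => dia_eval (fun X1 X2 =>
        ext3 F X1 Y1 Z1 * ext3 G X2 Y2 Z2) (bhb_comul act X))
    & forall X Y, good2 (fun Z1 Z2 => dia_eval (fun Y1 Y2 => dia_eval (fun X1 X2 =>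
        ext3 F X1 Y1 Z1 * ext3 G X2 Y2 Z2) (bhb_comul act X)) (bhb_comul act Y))].
Proof.
have gx Y1 Y2 Z1 Z2 : good2 (fun X1 X2 => ext3 F X1 Y1 Z1 * ext3 G X2 Y2 Z2).
  by split=> [|d X1 X2]; [lin | rewrite ext3_lbB ext3_lB mulrA].
have gy X Z1 Z2 : good2 (fun Y1 Y2 => dia_eval (fun X1 X2 =>
        ext3 F X1 Y1 Z1 * ext3 G X2 Y2 Z2) (bhb_comul act X)).
  apply: (nest (G := fun X1 X2 Y1 Y2 => ext3 F X1 Y1 Z1 * ext3 G X2 Y2 Z2)) => //.
  - by move=> X1 X2; lin.
  - by move=> d X1 X2 Y1 Y2; rewrite ext3_rbB1.
  - by move=> d X1 X2 Y1 Y2; rewrite ext3_rB1.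
split=> // X Y.
apply: (nest (G := fun Y1 Y2 Z1 Z2 => dia_eval (fun X1 X2 =>
        ext3 F X1 Y1 Z1 * ext3 G X2 Y2 Z2) (bhb_comul act X))) => //.
- by move=> Y1 Y2; split=> [Z1|Z2]; apply: lin_dia_evalF => X1 X2; lin.
- by move=> d Y1 Y2 Z1 Z2; apply: eq_dia_eval => X1 X2; rewrite ext3_rbB2.
- by move=> d Y1 Y2 Z1 Z2; apply: eq_dia_eval => X1 X2; rewrite ext3_rB2.
Qed.

Lemma conv3_ext F G X Y Z :
  dia_eval (fun Z1 Z2 => dia_eval (fun Y1 Y2 => dia_eval (fun X1 X2 =>
     ext3 F X1 Y1 Z1 * ext3 G X2 Y2 Z2)
    (bhb_comul act X)) (bhb_comul act Y)) (bhb_comul act Z) = ext3 (F ** G) X Y Z.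
Proof.
have [gx gy gz] := conv3_good F G.
move: X Y Z; apply: box_eq3 => [||a h a' b g b' c f c'].
- split=> [X Y|X Z|Y Z].
  + exact: swL2_lin.
  + by apply: lin_dia_evalF => Z1 Z2; apply: swL2_lin.
  + by do 2 (apply: lin_dia_evalF => ? ?); apply: swL2_lin.
- by lin.
rewrite swL2E // ext3E.
have -> : wrap3 (F ** G) b c c' b' = wrap3 F b c 1 1 ** wrap3 G 1 1 c' b'.
  by rewrite /wrap3 !actl1 !sh1 !cm1_pull !cvm1l !cvm1r -!cvmA.
rewrite cv_tens3'; match_teval.
rewrite swL2E //; match_teval.
rewrite swL2E //; match_teval.
by rewrite !ext3E mulr1 mul1r !mulrA.
Qed.

Section HomV.
Variables (V : lmodType k) (opl opr : B -> V -> V).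

(** No laws are imposed on [opl] and [opr]; for the uniqueness principle below it suffices that the
    two functions compared transform by the same operators. The targets used are [B], B (x) H (x) B
    and the diamond product. *)
Record hom2V (f : M -> M -> V) : Prop := Hom2V {
  hom2V_bil : bilin f;
  hom2V_l : forall a X Y, f (lB a X) Y = opl a (f X Y);
  hom2V_r : forall a X Y, f (lbB a X) Y = opr a (f X Y);
  hom2V_bal : forall d X Y, f (rB d X) Y = f X (lB d Y);
  hom2V_balb : forall d X Y, f (rbB d X) Y = f X (lbB d Y) }.

Record hom3V (f : M -> M -> M -> V) : Prop := Hom3V {
  hom3V_tril : trilin f;
  hom3V_l : forall a X Y Z, f (lB a X) Y Z = opl a (f X Y Z);
  hom3V_r : forall a X Y Z, f (lbB a X) Y Z = opr a (f X Y Z);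
  hom3V_bal : forall d X Y Z, f (rB d X) Y Z = f X (lB d Y) Z;
  hom3V_balb : forall d X Y Z, f (rbB d X) Y Z = f X (lbB d Y) Z;
  hom3V_bal2 : forall d X Y Z, f X (rB d Y) Z = f X Y (lB d Z);
  hom3V_balb2 : forall d X Y Z, f X (rbB d Y) Z = f X Y (lbB d Z) }.

Record hom4V (f : M -> M -> M -> M -> V) : Prop := Hom4V {
  hom4V_tril : forall X, trilin (f X);
  hom4V_lin : forall Y Z W, linear (fun X => f X Y Z W);
  hom4V_l : forall a X Y Z W, f (lB a X) Y Z W = opl a (f X Y Z W);
  hom4V_r : forall a X Y Z W, f (lbB a X) Y Z W = opr a (f X Y Z W);
  hom4V_bal : forall d X Y Z W, f (rB d X) Y Z W = f X (lB d Y) Z W;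
  hom4V_balb : forall d X Y Z W, f (rbB d X) Y Z W = f X (lbB d Y) Z W;
  hom4V_bal2 : forall d X Y Z W, f X (rB d Y) Z W = f X Y (lB d Z) W;
  hom4V_balb2 : forall d X Y Z W, f X (rbB d Y) Z W = f X Y (lbB d Z) W;
  hom4V_bal3 : forall d X Y Z W, f X Y (rB d Z) W = f X Y Z (lB d W);
  hom4V_balb3 : forall d X Y Z W, f X Y (rbB d Z) W = f X Y Z (lbB d W) }.

(** A scalar to the left of [Y] is one to the right of [X], so [Y] may be taken to be a generator;
    the coefficients of [X] are then removed by [opl] and [opr]. *)
Lemma hom2V_eq f f' : hom2V f -> hom2V f' ->
  (forall h g, f (J h) (J g) = f' (J h) (J g)) -> forall X Y, f X Y = f' X Y.
Proof.
case=> b1 l1 r1 m1 n1 [b2 l2 r2 m2 n2] E X Y.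
have EX X' g : f X' (J g) = f' X' (J g).
  move: X'; apply: M_eq => [||a h a']; [by lin|by lin|].
  by rewrite l1 r1 l2 r2 E.
move: Y; apply: M_eq => [||b g b']; [by lin|by lin|].
by rewrite -m1 -n1 -m2 -n2 EX.
Qed.

Lemma hom3V_eq f f' : hom3V f -> hom3V f' ->
  (forall h g x, f (J h) (J g) (J x) = f' (J h) (J g) (J x)) ->
  forall X Y Z, f X Y Z = f' X Y Z.
Proof.
case=> b1 l1 r1 m1 n1 s1 t1 [b2 l2 r2 m2 n2 s2 t2] E X Y Z.
have EX X' Y' x : f X' Y' (J x) = f' X' Y' (J x).
  move: X' Y'; apply: hom2V_eq => //; split=> //; by lin.
move: Z; apply: M_eq => [||c x c']; [by lin|by lin|].
by rewrite -s1 -t1 -s2 -t2 EX.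
Qed.

Lemma hom4V_eq f f' : hom4V f -> hom4V f' ->
  (forall h g x y, f (J h) (J g) (J x) (J y) = f' (J h) (J g) (J x) (J y)) ->
  forall X Y Z W, f X Y Z W = f' X Y Z W.
Proof.
case=> b1 c1 l1 r1 m1 n1 s1 t1 u1 v1 [b2 c2 l2 r2 m2 n2 s2 t2 u2 v2] E X Y Z W.
have EX X' Y' Z' y : f X' Y' Z' (J y) = f' X' Y' Z' (J y).
  move: X' Y' Z'; apply: hom3V_eq => //; split=> //.
    by split=> // X' Y'; [case: (b1 X') => _ + _; apply | case: (b1 X') => _ _; apply].
  by split=> // X' Y'; [case: (b2 X') => _ + _; apply | case: (b2 X') => _ _; apply].
move: W; apply: M_eq => [||c x c'].
- by case: (b1 X) => l _ _; apply: l.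
- by case: (b2 X) => l _ _; apply: l.
by rewrite -u1 -v1 -u2 -v2 EX.
Qed.
End HomV.

Section SwBal.

Variables (V : lmodType k) (F : M -> M -> V).
Hypothesis gF : good2 F.

Let gbil : bilin F. Proof. by case: gF. Qed.
Let SF_lin := swL2_lin gF.

Lemma sw_lB d X : dia_eval F (bhb_comul act (lB d X))
  = dia_eval (fun X1 X2 => F (lB d X1) X2) (bhb_comul act X).
Proof.
have [bF bal] := gF.
have g : good2 (fun X1 X2 => F (lB d X1) X2).
  by split=> [|c X1 X2]; [lin | rewrite lB_lbB bal].
move: X; apply: box_eq => [||a h a']; [by apply: (lin_comp SF_lin); lin|exact: swL2_lin|].
by rewrite lB_box !swL2E //; apply: eq_teval => h1 h2; rewrite lB_box.
Qed.

Lemma sw_lbB d X : dia_eval F (bhb_comul act (lbB d X))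
  = dia_eval (fun X1 X2 => F X1 (lbB d X2)) (bhb_comul act X).
Proof.
have [bF bal] := gF.
have g : good2 (fun X1 X2 => F X1 (lbB d X2)).
  by split=> [|c X1 X2]; [lin | rewrite -lB_lbB bal].
move: X; apply: box_eq => [||a h a']; [by apply: (lin_comp SF_lin); lin|exact: swL2_lin|].
by rewrite lbB_box !swL2E //; apply: eq_teval => h1 h2; rewrite lbB_box.
Qed.

(** The leg of h that acts on [d] is split off in front, and coassociativity places it inside the
    first leg of the coproduct. *)
Lemma sw_rB d X : dia_eval F (bhb_comul act (rB d X))
  = dia_eval (fun X1 X2 => F (rB d X1) X2) (bhb_comul act X).
Proof.
have [bF bal] := gF.
have g : good2 (fun X1 X2 => F (rB d X1) X2).
  by split=> [|c X1 X2]; [lin | rewrite rB_lbB bal].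
move: X; apply: box_eq => [||a h a']; [by apply: (lin_comp SF_lin); lin|exact: swL2_lin|].
rewrite swL2E // [rB d _](ract_box); unsw.
rewrite (teval_map (L := fun X => dia_eval F (bhb_comul act X))) //.
transitivity (teval (fun h1 y => teval (fun h2 h3 => F (box (a * act h1 d) h2 1) (box 1 h3 a'))
   (comul H y)) (comul H h)).
  by apply: eq_teval => x y; rewrite swL2E.
rewrite coassoc; last by lin.
apply: eq_teval => x y; rewrite [rB d _](ract_box); unsw.
by rewrite (teval_map (L := fun X => F X _)) //; lin.
Qed.

Lemma sw_rbB d X : dia_eval F (bhb_comul act (rbB d X))
  = dia_eval (fun X1 X2 => F X1 (rbB d X2)) (bhb_comul act X).
Proof.
have [bF bal] := gF.
have g : good2 (fun X1 X2 => F X1 (rbB d X2)).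
  by split=> [|c X1 X2]; [lin | rewrite rbB_lB bal].
move: X; apply: box_eq => [||a h a']; [by apply: (lin_comp SF_lin); lin|exact: swL2_lin|].
rewrite swL2E // [rbB d _](rbact_box); unsw.
rewrite (teval_map (L := fun X => dia_eval F (bhb_comul act X))) //.
transitivity (teval (fun x y => teval (fun h1 h2 => F (box a h1 1) (box 1 h2 (act y d * a')))
   (comul H x)) (comul H h)).
  by apply: eq_teval => x y; rewrite swL2E.
rewrite -(coassoc (F := fun h1 h2 y => F (box a h1 1) (box 1 h2 (act y d * a')))); last by lin.
apply: eq_teval => x y; rewrite [rbB d _](rbact_box); unsw.
by rewrite (teval_map (L := fun X => F _ X)) //; lin.
Qed.
End SwBal.

(** * The product deformed by gamma *)

Definition bmul : M -> M -> M := bhb_mul act gam gamV.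

Definition muK (b b' : B) : lhom T2 M := (A b \c pl H H) |> (K <| (A b' \c pl H H)).

Lemma muE a h a' b g b' :
  bmul (box a h a') (box b g b') = lB a (lbB a' (muK b b' (tens h g))).
Proof.
rewrite [LHS](bhb_mulE); congr (lB _ (lbB _ (_ (tens h g)))).
by rewrite /muK -cvlA cvlr cvrA.
Qed.

Lemma mu_bil : bilin bmul.
Proof.
by rewrite /bmul /bhb_mul /box_eval; lin.
Qed.
Local Hint Resolve mu_bil : bil.

Lemma muK1 : muK 1 1 = K.
Proof. by rewrite /muK !actl1 cm1_pull cvl1 cvr1. Qed.

Lemma mu_box h b g b' : bmul (J h) (box b g b') = muK b b' (tens h g).
Proof. by rewrite [LHS]muE lB1 lbB1. Qed.
Lemma mu_J h g : bmul (J h) (J g) = K (tens h g).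
Proof. by rewrite -muK1 [LHS]mu_box. Qed.

Lemma mu_lB d X Y : bmul (lB d X) Y = lB d (bmul X Y).
Proof.
move: X Y; apply: box_eq2 => [||a h a' b x b']; [by lin|by lin|].
by rewrite lB_box !muE lBM.
Qed.
Lemma mu_lbB d X Y : bmul (lbB d X) Y = lbB d (bmul X Y).
Proof.
move: X Y; apply: box_eq2 => [||a h a' b x b']; [by lin|by lin|].
by rewrite lbB_box !muE lbBM -!lB_lbB.
Qed.

Lemma mu_rB d X Y : bmul (rB d X) Y = bmul X (lB d Y).
Proof.
move: X Y; apply: box_eq2 => [||a h a' b g b']; [by lin|by lin|].
rewrite rB_box lB_box muE mu_lB mu_lbB; congr (lB _ (lbB _ _)).
have -> : muK (d * b) b' = (A d \c pl H H) |> muK b b'.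
  by rewrite /muK actlM cvm_pull -!cvlA.
rewrite [(A d |> J) h]cvE (teval_map (L := fun X => bmul X (box b g b'))); last by lin.
by rewrite cv_pll; apply: eq_teval => h1 h2; rewrite mu_lB mu_box.
Qed.

Lemma mu_rbB d X Y : bmul (rbB d X) Y = bmul X (lbB d Y).
Proof.
move: X Y; apply: box_eq2 => [||a h a' b g b']; [by lin|by lin|].
rewrite rbB_box lbB_box muE mu_lB mu_lbB; congr (lB _ (lbB _ _)).
have -> : muK b (b' * d) = muK b b' <| (A d \c pl H H).
  by rewrite /muK actlM cvm_pull -cvrA -cvlr.
rewrite [(J <| A d) h]cvE (teval_map (L := fun X => bmul X (box b g b'))); last by lin.
rewrite cv_plr; apply: eq_teval => h1 h2.
by rewrite -[lbS _ _]/(lbB _ _) mu_lbB mu_box.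
Qed.

Lemma rBJm d : bilr rB d \c (J \c mulc H) = A2 d |> (J \c mulc H).
Proof. by rewrite -hcompA rBJ cv_pull A_mulc. Qed.
Lemma rbBJm d : bilr rbB d \c (J \c mulc H) = (J \c mulc H) <| A2 d.
Proof. by rewrite -hcompA rbBJ cv_pull A_mulc. Qed.

(** Associative type enters here. On generators, right multiplication of the product puts [A2 d]
    behind [ga], while multiplying the second factor puts it in front. For the opposite action the
    same is said of [gaV]. *)
Lemma mu_rB2 d X Y : bmul X (rB d Y) = rB d (bmul X Y).
Proof.
have E h g : bmul (J h) (rB d (J g)) = rB d (bmul (J h) (J g)).
  rewrite mu_J -[RHS]/((bilr rB d \c K) _) rB_cvl rB_cvr rBJm cvlr cvlA ga_A2.
  rewrite -cvlA -[rB d _]/((bilr rB d \c J) g) rBJ [(A d |> J) g]cvE.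
  rewrite (teval_map (L := bmul (J h))); last by lin.
  rewrite (cv_tens2' (D := H) (C := H)); apply: eq_teval => g1 g2.
  rewrite -mu_rB -[rB _ _]/((bilr rB (A d g1) \c J) h) rBJ cvE.
  rewrite (teval_map (L := fun X => bmul X (J g2))); last by lin.
  by apply: eq_teval => h1 h2; rewrite mu_lB mu_J shE.
have EX X' g : bmul X' (rB d (J g)) = rB d (bmul X' (J g)).
  move: X'; apply: M_eq => [||a h a']; [by lin|by lin|].
  by rewrite !mu_lB !mu_lbB rB_lB rB_lbB E.
move: Y; apply: M_eq => [||b g b']; [by lin|by lin|].
by rewrite rB_lB rB_lbB -!mu_rB -!mu_rbB EX.
Qed.

Lemma mu_rbB2 d X Y : bmul X (rbB d Y) = rbB d (bmul X Y).
Proof.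
have E h g : bmul (J h) (rbB d (J g)) = rbB d (bmul (J h) (J g)).
  rewrite mu_J -[RHS]/((bilr rbB d \c K) _) rbB_cvl rbB_cvr rbBJm cvrA.
  rewrite -gaV_A2 -cvrA -cvlr.
  rewrite -[rbB d _]/((bilr rbB d \c J) g) rbBJ [(J <| A d) g]cvE.
  rewrite (teval_map (L := bmul (J h))); last by lin.
  rewrite (cv_tens2' (D := H) (C := H)); apply: eq_teval => g1 g2.
  rewrite -[lbS _ _]/(lbB _ _) -mu_rbB -[rbB _ _]/((bilr rbB (A d g2) \c J) h) rbBJ cvE.
  rewrite (teval_map (L := fun X => bmul X (J g1))); last by lin.
  by apply: eq_teval => h1 h2; rewrite -[lbS _ _]/(lbB _ _) mu_lbB mu_J shE.
have EX X' g : bmul X' (rbB d (J g)) = rbB d (bmul X' (J g)).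
  move: X'; apply: M_eq => [||a h a']; [by lin|by lin|].
  by rewrite !mu_lB !mu_lbB rbB_lB rbB_lbB E.
move: Y; apply: M_eq => [||b g b']; [by lin|by lin|].
by rewrite rbB_lB rbB_lbB -!mu_rB -!mu_rbB EX.
Qed.

Lemma rB_J1 d : rB d J1 = lB d J1.
Proof.
rewrite -[rB d _]/((bilr rB d \c J) (hone H)) rBJ cvE comul_hone teval_tens; last by lin.
by rewrite actlE (act1l modalg).
Qed.
Lemma rbB_J1 d : rbB d J1 = lbB d J1.
Proof.
rewrite -[rbB d _]/((bilr rbB d \c J) (hone H)) rbBJ cvE comul_hone teval_tens; last by lin.
by rewrite actlE (act1l modalg).
Qed.

Lemma mu1l X : bmul J1 X = X.
Proof.
move: X; apply: (M_eq (g := fun X => X)) => [||b g b']; [by lin|by lin|].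
rewrite -mu_rB rB_J1 mu_lB -mu_rbB rbB_J1 mu_lbB; congr (lB _ (lbB _ _)).
rewrite mu_J -[K _]/((K \c u1 H H) g) !cv_pull ga_u1.
rewrite gaV_u1 cvl1 cvr1.
by rewrite !hcompE u1E mulcE hmul1l.
Qed.
Lemma mu1r X : bmul X J1 = X.
Proof.
move: X; apply: (M_eq (g := fun X => X)) => [||b g b']; [by lin|by lin|].
rewrite mu_lB mu_lbB; congr (lB _ (lbB _ _)).
rewrite mu_J -[K _]/((K \c ur H H) g) !cv_pull ga_ur.
rewrite gaV_ur cvl1 cvr1.
by rewrite !hcompE urE mulcE hmul1r.
Qed.

Lemma eps_cvl (C : coalgebra k) (x : lhom C B) m : eps \c (x |> m) = x ** (eps \c m).
Proof. by apply: lhom_cvr => u v; exact: epsM_lB. Qed.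
Lemma eps_cvr (C : coalgebra k) (x : lhom C B) m : eps \c (m <| x) = (eps \c m) ** x.
Proof. by apply: lhom_cvl => u v; exact: epsM_lbB. Qed.
Lemma eps_J : eps \c J = cm1.
Proof. by apply: lhom_eq => h; rewrite [LHS]epsM_box mulr1. Qed.

Lemma eps_K : eps \c K = cm1.
Proof. by rewrite eps_cvl eps_cvr -hcompA eps_J cm1_pull cvm1l gagaV. Qed.

Section ProductCoproduct.

(** With [dlbB], this is the left module structure of the diamond product, which serves as [opl] and
    [opr] when two maps into it are compared on generators. *)
Definition dlB : bil B (diamond D0) (diamond D0).
Proof.
apply: (@Bil _ _ _ _ (fun b t => dia_eval (fun X Y => dia D0 (lB b X) Y) t)).
have [bd bal] := good2_dia; split=> [b|t].
- apply: (dia_eval_lin (F := fun X Y => dia D0 (lB b X) Y)); split=> [|d X Y]; first by lin.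
  by rewrite lB_lbB bal.
- by apply: lin_dia_evalF => X Y; lin.
Defined.

Definition dlbB : bil B (diamond D0) (diamond D0).
Proof.
apply: (@Bil _ _ _ _ (fun b t => dia_eval (fun X Y => dia D0 X (lbB b Y)) t)).
have [bd bal] := good2_dia; split=> [b|t].
- apply: (dia_eval_lin (F := fun X Y => dia D0 X (lbB b Y))); split=> [|d X Y]; first by lin.
  by rewrite -lB_lbB bal.
- by apply: lin_dia_evalF => X Y; lin.
Defined.

Lemma dlB_dia b X Y : dlB b (dia D0 X Y) = dia D0 (lB b X) Y.
Proof.
have [bd bal] := good2_dia; apply: (dia_evalE (F := fun X Y => dia D0 (lB b X) Y)).
by split=> [|d X' Y']; [lin | rewrite lB_lbB bal].
Qed.
Lemma dlbB_dia b X Y : dlbB b (dia D0 X Y) = dia D0 X (lbB b Y).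
Proof.
have [bd bal] := good2_dia; apply: (dia_evalE (F := fun X Y => dia D0 X (lbB b Y))).
by split=> [|d X' Y']; [lin | rewrite -lB_lbB bal].
Qed.

Lemma dia_eval_map (V W : lmodType k) (L : V -> W) (F : M -> M -> V) (t : diamond D0) :
  linear L -> L (dia_eval F t) = dia_eval (fun X Y => L (F X Y)) t.
Proof. exact: teval_map. Qed.

Lemma diaeval_id (t : diamond D0) : dia_eval (dia D0) t = t.
Proof.
apply: (btens_eq (G := fun t => t)) => [||X Y]; [exact: (dia_eval_lin good2_dia)|by lin|].
exact: (dia_evalE _ _ good2_dia).
Qed.

Lemma Dl_lB b X : bhb_comul act (lB b X) = dlB b (bhb_comul act X).
Proof. by rewrite -[LHS]diaeval_id (sw_lB good2_dia). Qed.
Lemma Dl_lbB b X : bhb_comul act (lbB b X) = dlbB b (bhb_comul act X).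
Proof. by rewrite -[LHS]diaeval_id (sw_lbB good2_dia). Qed.

Local Notation dB := diaB.
Lemma Dl_J : Dl \c J = cv dB J J.
Proof. by apply: lhom_eq => h; rewrite hcompE [LHS](bhb_comul_box). Qed.

Fact dlbS_bil : bilin (fun t b => dlbB b t). Proof. by lin. Qed.
Definition dlbS : bil (diamond D0) B (diamond D0) := Bil dlbS_bil.

(** In K (x) K, the gamma^-1 that ends the first factor may cross the diamond product, where it
    cancels the gamma that begins the second. What remains is the coproduct of J(hg) between gamma
    and gamma^-1. *)
Lemma Dl_K : Dl \c K = cv dB K K.
Proof.
have E1 : cv dB (ga |> ((J \c mulc H) <| gaV)) K
  = cv dB (ga |> (J \c mulc H)) ((J \c mulc H) <| gaV).
  rewrite -{1}cvlr (cvA (op3 := dB) (op4 := lB)); last by move=> u v w; exact: dia_bal.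
  by rewrite cvlA gaVga cvl1.
rewrite E1 (lhom_cvr (op' := dlB) (g := Dl)); last by move=> u v; exact: Dl_lB.
rewrite (lhom_cvl (op' := dlbS) (g := Dl)); last by move=> u v; exact: Dl_lbB.
rewrite -hcompA Dl_J cv_pull.
rewrite (cvA (op3 := dB) (op4 := lbS)); last by move=> u v w; exact: dlbB_dia.
by rewrite -(cvA (op1 := dB) (op2 := lB)) // => u v w; exact: (esym (dlB_dia u v w)).
Qed.

Local Notation comulM_rhs X Y := (dia_eval (fun Y1 Y2 => dia_eval (fun X1 X2 =>
  dia D0 (bmul X1 Y1) (bmul X2 Y2)) (bhb_comul act X)) (bhb_comul act Y)).

Lemma mu_comul X Y : bhb_comul act (bmul X Y) = comulM_rhs X Y.
Proof.
have [bd bal] := good2_dia.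
have gx Y1 Y2 : good2 (fun X1 X2 => dia D0 (bmul X1 Y1) (bmul X2 Y2)).
  by split=> [|d X1 X2]; [lin | rewrite mu_lbB mu_lB bal].
have gy X' : good2 (fun Y1 Y2 => dia_eval (fun X1 X2 =>
    dia D0 (bmul X1 Y1) (bmul X2 Y2)) (bhb_comul act X')).
  apply: (nest (G := fun X1 X2 Y1 Y2 => dia D0 (bmul X1 Y1) (bmul X2 Y2))) => //.
  - by move=> X1 X2; lin.
  - by move=> d X1 X2 Y1 Y2; rewrite mu_rbB.
  - by move=> d X1 X2 Y1 Y2; rewrite mu_rB.
move: X Y; apply: (hom2V_eq (opl := dlB) (opr := dlbB)).
- split=> [|a X Y|a X Y|d X Y|d X Y].
  + by split=> [X|Y]; apply: (lin_comp bhb_comul_lin); lin.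
  + by rewrite mu_lB Dl_lB.
  + by rewrite mu_lbB Dl_lbB.
  + by rewrite mu_rB.
  + by rewrite mu_rbB.
- split=> [|a X Y|a X Y|d X Y|d X Y].
  + split=> [X|Y]; first exact: swL2_lin.
    by apply: lin_dia_evalF => Y1 Y2; apply: swL2_lin.
  + rewrite (dia_eval_map (L := dlB a)); last by lin.
    apply: eq_dia_eval => Y1 Y2; rewrite sw_lB // (dia_eval_map (L := dlB a)); last by lin.
    by apply: eq_dia_eval => X1 X2; rewrite dlB_dia mu_lB.
  + rewrite (dia_eval_map (L := dlbB a)); last by lin.
    apply: eq_dia_eval => Y1 Y2; rewrite sw_lbB // (dia_eval_map (L := dlbB a)); last by lin.
    by apply: eq_dia_eval => X1 X2; rewrite dlbB_dia mu_lbB.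
  + rewrite sw_lB //; apply: eq_dia_eval => Y1 Y2; rewrite sw_rB //.
    by apply: eq_dia_eval => X1 X2; rewrite mu_rB.
  + rewrite sw_lbB //; apply: eq_dia_eval => Y1 Y2; rewrite sw_rbB //.
    by apply: eq_dia_eval => X1 X2; rewrite mu_rbB.
- move=> h g; rewrite mu_J -[LHS]/((Dl \c K) _) Dl_K (cv_tens2' (D := H) (C := H)).
  rewrite [RHS](swL2E _ _ _ (gy _)); apply: eq_teval => g1 g2.
  rewrite [RHS](swL2E _ _ _ (gx _ _)); apply: eq_teval => h1 h2.
  by rewrite -!mu_J.
Qed.

End ProductCoproduct.

Section ProductCounit.

Definition mulB (a v : B) := a * v.
Definition mulBr (a v : B) := v * a.

Lemma ext2_hom2V F : hom2V mulB mulBr (ext2 F).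
Proof. by split; [exact: ext2_bil|exact: ext2_lB|exact: ext2_lbB|exact: ext2_rB|exact: ext2_rbB]. Qed.
Lemma ext3_hom3V F : hom3V mulB mulBr (ext3 F).
Proof.
by split; [exact: ext3_tril|exact: ext3_lB|exact: ext3_lbB|exact: ext3_rB1|exact: ext3_rbB1
  |exact: ext3_rB2|exact: ext3_rbB2].
Qed.

Lemma eps_mu X Y : eps (bmul X Y) = ext2 cm1 X Y.
Proof.
move: X Y; apply: (hom2V_eq _ (ext2_hom2V cm1)).
- split=> [|a X Y|a X Y|d X Y|d X Y]; first by lin.
  + by rewrite mu_lB epsM_lB.
  + by rewrite mu_lbB epsM_lbB.
  + by rewrite mu_rB.
  + by rewrite mu_rbB.
- by move=> h g; rewrite ext2_J mu_J -[LHS]/((eps \c K) _) eps_K.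
Qed.

Lemma ext2_cm1_J X f : ext2 cm1 X (J f) = counit H f *: eps X.
Proof.
have bl := ext2_bil cm1.
move: X; apply: M_eq => [||a h a']; [by lin|by lin|].
rewrite ext2_lB ext2_lbB epsM_lB epsM_lbB ext2_J -[eps (J h)]/((eps \c J) h) eps_J.
by rewrite cm1E counit_tc cm1E scalerAr scalerAl scalerA mulrC.
Qed.

Lemma eps_mu3 X Y Z : eps (bmul (bmul X Y) Z) = ext3 cm1 X Y Z.
Proof.
move: X Y Z; apply: (hom3V_eq _ (ext3_hom3V cm1)).
- split=> [|a X Y Z|a X Y Z|d X Y Z|d X Y Z|d X Y Z|d X Y Z]; first by lin.
  + by rewrite !mu_lB epsM_lB.
  + by rewrite !mu_lbB epsM_lbB.
  + by rewrite mu_rB.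
  + by rewrite mu_rbB.
  + by rewrite mu_rB2 mu_rB.
  + by rewrite mu_rbB2 mu_rbB.
- move=> h g f; rewrite ext3_J eps_mu mu_J ext2_cm1_J -[eps _]/((eps \c K) _) eps_K.
  by rewrite cm1E counit_tc cm1_3 scalerA mulrC.
Qed.

Lemma bhb_Phi_ext : bhb_Phi act gam gamV = ext3 Om.
Proof.
apply/funext => X; apply/funext => Y; apply/funext => Z.
have pt := phi_trilin H.
move: X Y Z; apply: box_eq3 => [||a h a' b g b' c f c'].
- by rewrite /bhb_Phi /box_eval; lin.
- exact: ext3_tril.
- by rewrite ext3E; apply: bhb_PhiE.
Qed.

(** On a generator both right actions by d have counit h |> d. *)
Lemma eps_rB d X : eps (rB d X) = eps (rbB d X).
Proof.
move: X; apply: M_eq => [||a h a']; [by lin|by lin|].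
rewrite rB_lB rB_lbB rbB_lB rbB_lbB !epsM_lB !epsM_lbB; congr (_ * (_ * _)).
rewrite -[rB d _]/((bilr rB d \c J) h) rBJ -[rbB d _]/((bilr rbB d \c J) h) rbBJ.
by rewrite -[LHS]/((eps \c _) h) eps_cvl -[RHS]/((eps \c _) h) eps_cvr eps_J cvm1l cvm1r.
Qed.

Lemma rB_mu d X : rB d X = bmul X (lB d J1).
Proof. by rewrite -mu_rB mu1r. Qed.
Lemma rbB_mu d X : rbB d X = bmul X (lbB d J1).
Proof. by rewrite -mu_rbB mu1r. Qed.

Lemma eps_src X Y : eps (rB (eps Y) X) = eps (bmul X Y).
Proof.
have E h g : eps (rB (eps (J g)) (J h)) = eps (bmul (J h) (J g)).
  rewrite -[eps (J g)]/((eps \c J) g) eps_J cm1E (linZ _ _ (f := fun b => eps (rB b (J h))));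
    last by lin.
  by rewrite rB1 eps_mu ext2_cm1_J.
have EX X' g : eps (rB (eps (J g)) X') = eps (bmul X' (J g)).
  move: X'; apply: M_eq => [||a h a']; [by lin|by lin|].
  by rewrite rB_lB rB_lbB !epsM_lB !epsM_lbB mu_lB mu_lbB epsM_lB epsM_lbB E.
move: Y; apply: M_eq => [||b g b']; [by lin|by lin|].
(* The coefficients of [Y] are balanced onto [X]; [eps_rB] turns the outermost right action by b'
   into the opposite one, which commutes with the others. *)
rewrite epsM_lB epsM_lbB -mu_rB -mu_rbB -EX (mulrA b (eps (J g)) b').
rewrite (rBM (b * eps (J g)) b' X) (rBM b (eps (J g)) X).
by rewrite eps_rB -rB_rbB.
Qed.

Lemma eps_tgt X Y : eps (rbB (eps Y) X) = eps (bmul X Y).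
Proof. by rewrite -eps_rB eps_src. Qed.

Lemma ext3_Om1 Y Z : ext3 Om J1 Y Z = eps (bmul Y Z).
Proof.
rewrite eps_mu; move: Y Z; apply: (hom2V_eq _ (ext2_hom2V cm1)).
- have tr := ext3_tril Om; split=> [|a X Y|a X Y|d X Y|d X Y]; first by lin.
  + by rewrite -ext3_rB1 rB_J1 ext3_lB.
  + by rewrite -ext3_rbB1 rbB_J1 ext3_lbB.
  + by rewrite ext3_rB2.
  + by rewrite ext3_rbB2.
- by move=> h g; rewrite ext3_J ext2_J -[LHS]/((Om \c i_l) (tens h g)) Om_l.
Qed.

Lemma ext3_Om2 X Z : ext3 Om X J1 Z = eps (bmul X Z).
Proof.
rewrite eps_mu; move: X Z; apply: (hom2V_eq _ (ext2_hom2V cm1)).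
- have tr := ext3_tril Om; split=> [|a X Y|a X Y|d X Y|d X Y]; first by lin.
  + by rewrite ext3_lB.
  + by rewrite ext3_lbB.
  + by rewrite ext3_rB1 -rB_J1 ext3_rB2.
  + by rewrite ext3_rbB1 -rbB_J1 ext3_rbB2.
- by move=> h g; rewrite ext3_J ext2_J -i_mE -[LHS]/((Om \c i_m) (tens h g)) Om_m.
Qed.

Lemma ext3_Om3 X Y : ext3 Om X Y J1 = eps (bmul X Y).
Proof.
rewrite eps_mu; move: X Y; apply: (hom2V_eq _ (ext2_hom2V cm1)).
- have tr := ext3_tril Om; split=> [|a X Y|a X Y|d X Y|d X Y]; first by lin.
  + by rewrite ext3_lB.
  + by rewrite ext3_lbB.
  + by rewrite ext3_rB1.
  + by rewrite ext3_rbB1.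
- by move=> h g; rewrite ext3_J ext2_J -i_rE -[LHS]/((Om \c i_r) (tens h g)) Om_r.
Qed.

(** On generators the two sides are the products of [Om] with [A3 d] placed in front and behind, so
    this is [Om_A3]. *)
Lemma ext3_Om_right X Y Z d : ext3 Om X Y (rB d Z) = ext3 Om X Y (rbB d Z).
Proof.
have tr := ext3_tril Om.
move: X Y Z; apply: (hom3V_eq (opl := mulB) (opr := mulBr)).
- split=> [|a X Y Z|a X Y Z|e X Y Z|e X Y Z|e X Y Z|e X Y Z]; first by lin.
  + by rewrite ext3_lB.
  + by rewrite ext3_lbB.
  + by rewrite ext3_rB1.
  + by rewrite ext3_rbB1.
  + by rewrite ext3_rB2 rB_lB.
  + by rewrite ext3_rbB2 rB_lbB.
- split=> [|a X Y Z|a X Y Z|e X Y Z|e X Y Z|e X Y Z|e X Y Z]; first by lin.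
  + by rewrite ext3_lB.
  + by rewrite ext3_lbB.
  + by rewrite ext3_rB1.
  + by rewrite ext3_rbB1.
  + by rewrite ext3_rB2 rbB_lB.
  + by rewrite ext3_rbB2 rbB_lbB.
move=> h g f; transitivity ((A3 d ** Om) (tens h (tens g f))).
  rewrite -[rB d _]/((bilr rB d \c J) f) rBJ cvE (teval_map (L := ext3 Om (J h) (J g)));
    last by lin.
  rewrite (cv_tens3' (C := H) (D := H) (E := H)); apply: eq_teval => f1 f2.
  rewrite -boxJl [LHS]ext3E mul1r mulr1 /wrap3 !actl1 !sh1 !cm1_pull cvm1l !cvm1r.
  rewrite cv_p12l teval_exch; do 2 (apply: eq_teval => ? ?).
  by rewrite !shE.
rewrite -Om_A3 -[rbB d _]/((bilr rbB d \c J) f) rbBJ [(J <| A d) f]cvE.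
rewrite (teval_map (L := ext3 Om (J h) (J g))); last by lin.
rewrite (cv_tens3' (C := H) (D := H) (E := H)); apply: eq_teval => f1 f2.
rewrite -[lbS _ _]/(lbB _ _) -boxJr [RHS]ext3E mul1r mulr1 /wrap3 !actl1 !sh1 !cm1_pull !cvm1l cvm1r.
rewrite cv_p12r teval_exch; do 2 (apply: eq_teval => ? ?).
by rewrite !shE.
Qed.

End ProductCounit.

(** * Iterated Sweedler sums over several arguments *)

Section NestedSums.

Variables (V : lmodType k) (opl opr : B -> V -> V).
Hypotheses (opl_lin : forall a, linear (opl a)) (opr_lin : forall a, linear (opr a)).

Section Three.
Variable G : M -> M -> M -> M -> M -> M -> V.
Definition S3 X Y Z := sw Z (fun Z1 Z2 => sw Y (fun Y1 Y2 => sw X (fun X1 X2 =>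
  G X1 X2 Y1 Y2 Z1 Z2))).
(** Balance is required outright only between the two legs of X. For Y and Z it follows through
    [nest]: a scalar on a leg of Y passes to X, crosses there by the Takeuchi condition and comes
    back, and likewise from Z through Y. *)
Record bal3 : Prop := Bal3 {
  bal3_X : forall Y1 Y2 Z1 Z2, good2 (fun X1 X2 => G X1 X2 Y1 Y2 Z1 Z2);
  bal3_Y : forall X1 X2 Z1 Z2, bilin (fun Y1 Y2 => G X1 X2 Y1 Y2 Z1 Z2);
  bal3_Z : forall X1 X2 Y1 Y2, bilin (G X1 X2 Y1 Y2);
  bal3_l : forall a X1 X2 Y1 Y2 Z1 Z2, G (lB a X1) X2 Y1 Y2 Z1 Z2 = opl a (G X1 X2 Y1 Y2 Z1 Z2);
  bal3_r : forall a X1 X2 Y1 Y2 Z1 Z2, G X1 (lbB a X2) Y1 Y2 Z1 Z2 = opr a (G X1 X2 Y1 Y2 Z1 Z2);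
  bal3_XY1 : forall d X1 X2 Y1 Y2 Z1 Z2, G (rB d X1) X2 Y1 Y2 Z1 Z2 = G X1 X2 (lB d Y1) Y2 Z1 Z2;
  bal3_XYb1 : forall d X1 X2 Y1 Y2 Z1 Z2, G (rbB d X1) X2 Y1 Y2 Z1 Z2 = G X1 X2 (lbB d Y1) Y2 Z1 Z2;
  bal3_XY2 : forall d X1 X2 Y1 Y2 Z1 Z2, G X1 (rB d X2) Y1 Y2 Z1 Z2 = G X1 X2 Y1 (lB d Y2) Z1 Z2;
  bal3_XYb2 : forall d X1 X2 Y1 Y2 Z1 Z2, G X1 (rbB d X2) Y1 Y2 Z1 Z2 = G X1 X2 Y1 (lbB d Y2) Z1 Z2;
  bal3_YZ1 : forall d X1 X2 Y1 Y2 Z1 Z2, G X1 X2 (rB d Y1) Y2 Z1 Z2 = G X1 X2 Y1 Y2 (lB d Z1) Z2;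
  bal3_YZb1 : forall d X1 X2 Y1 Y2 Z1 Z2, G X1 X2 (rbB d Y1) Y2 Z1 Z2 = G X1 X2 Y1 Y2 (lbB d Z1) Z2;
  bal3_YZ2 : forall d X1 X2 Y1 Y2 Z1 Z2, G X1 X2 Y1 (rB d Y2) Z1 Z2 = G X1 X2 Y1 Y2 Z1 (lB d Z2);
  bal3_YZb2 : forall d X1 X2 Y1 Y2 Z1 Z2, G X1 X2 Y1 (rbB d Y2) Z1 Z2
    = G X1 X2 Y1 Y2 Z1 (lbB d Z2) }.
Hypothesis bG : bal3.

Lemma bal3_goodY X Z1 Z2 : good2 (fun Y1 Y2 => sw X (fun X1 X2 => G X1 X2 Y1 Y2 Z1 Z2)).
Proof.
case: bG => gX gY gZ _ _ _ XYb1 XY2 _ _ _ _ _.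
by apply: (nest (G := fun X1 X2 Y1 Y2 => G X1 X2 Y1 Y2 Z1 Z2)).
Qed.

Lemma bal3_goodZ X Y : good2 (fun Z1 Z2 => sw Y (fun Y1 Y2 => sw X (fun X1 X2 =>
  G X1 X2 Y1 Y2 Z1 Z2))).
Proof.
case: bG => gX gY gZ _ _ _ _ _ _ _ YZb1 YZ2 _.
apply: (nest (G := fun Y1 Y2 Z1 Z2 => sw X (fun X1 X2 => G X1 X2 Y1 Y2 Z1 Z2))).
- by move=> Z1 Z2; apply: bal3_goodY.
- by move=> Y1 Y2; split=> [Z1|Z2]; apply: lin_dia_evalF => X1 X2; case: (gZ X1 X2 Y1 Y2).
- by move=> d Y1 Y2 Z1 Z2; apply: eq_dia_eval => X1 X2.
- by move=> d Y1 Y2 Z1 Z2; apply: eq_dia_eval => X1 X2.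
Qed.

Lemma S3_hom : hom3V opl opr S3.
Proof.
have gZ := bal3_goodZ; have gY := bal3_goodY.
case: bG => gX _ _ Gl Gr XY1 XYb1 XY2 XYb2 YZ1 YZb1 YZ2 YZb2.
split=> [|a X Y Z|a X Y Z|d X Y Z|d X Y Z|d X Y Z|d X Y Z].
- split=> [X Y|X Z|Y Z]; first exact: swL2_lin.
    by apply: lin_dia_evalF => Z1 Z2; apply: swL2_lin.
  by do 2 (apply: lin_dia_evalF => ? ?); apply: swL2_lin.
- rewrite /S3 (dia_eval_map (L := opl a)) //; apply: eq_dia_eval => Z1 Z2.
  rewrite (dia_eval_map (L := opl a)) //; apply: eq_dia_eval => Y1 Y2.
  by rewrite sw_lB // (dia_eval_map (L := opl a)) //; apply: eq_dia_eval.
- rewrite /S3 (dia_eval_map (L := opr a)) //; apply: eq_dia_eval => Z1 Z2.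
  rewrite (dia_eval_map (L := opr a)) //; apply: eq_dia_eval => Y1 Y2.
  by rewrite sw_lbB // (dia_eval_map (L := opr a)) //; apply: eq_dia_eval.
- apply: eq_dia_eval => Z1 Z2; rewrite sw_lB //; apply: eq_dia_eval => Y1 Y2.
  by rewrite sw_rB //; apply: eq_dia_eval.
- apply: eq_dia_eval => Z1 Z2; rewrite sw_lbB //; apply: eq_dia_eval => Y1 Y2.
  by rewrite sw_rbB //; apply: eq_dia_eval.
- rewrite /S3 sw_lB //; apply: eq_dia_eval => Z1 Z2; rewrite sw_rB //.
  by do 2 (apply: eq_dia_eval => ? ?).
- rewrite /S3 sw_lbB //; apply: eq_dia_eval => Z1 Z2; rewrite sw_rbB //.
  by do 2 (apply: eq_dia_eval => ? ?).
Qed.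

Lemma S3_J h g f : S3 (J h) (J g) (J f) = teval (fun f1 f2 => teval (fun g1 g2 =>
  teval (fun h1 h2 => G (J h1) (J h2) (J g1) (J g2) (J f1) (J f2))
  (comul H h)) (comul H g)) (comul H f).
Proof.
rewrite [LHS]swL2E; last exact: bal3_goodZ.
apply: eq_teval => f1 f2; rewrite [LHS]swL2E; last exact: bal3_goodY.
apply: eq_teval => g1 g2; rewrite [LHS]swL2E; last exact: (bal3_X bG).
exact: eq_teval.
Qed.
End Three.

Section Four.
Variable G : M -> M -> M -> M -> M -> M -> M -> M -> V.
Definition S4 X Y Z W := sw W (fun W1 W2 => S3 (fun X1 X2 Y1 Y2 Z1 Z2 =>
  G X1 X2 Y1 Y2 Z1 Z2 W1 W2) X Y Z).
Record bal4 : Prop := Bal4 {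
  bal4_3 : forall W1 W2, bal3 (fun X1 X2 Y1 Y2 Z1 Z2 => G X1 X2 Y1 Y2 Z1 Z2 W1 W2);
  bal4_W : forall X1 X2 Y1 Y2 Z1 Z2, bilin (G X1 X2 Y1 Y2 Z1 Z2);
  bal4_ZW1 : forall d X1 X2 Y1 Y2 Z1 Z2 W1 W2,
    G X1 X2 Y1 Y2 (rB d Z1) Z2 W1 W2 = G X1 X2 Y1 Y2 Z1 Z2 (lB d W1) W2;
  bal4_ZWb1 : forall d X1 X2 Y1 Y2 Z1 Z2 W1 W2,
    G X1 X2 Y1 Y2 (rbB d Z1) Z2 W1 W2 = G X1 X2 Y1 Y2 Z1 Z2 (lbB d W1) W2;
  bal4_ZW2 : forall d X1 X2 Y1 Y2 Z1 Z2 W1 W2,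
    G X1 X2 Y1 Y2 Z1 (rB d Z2) W1 W2 = G X1 X2 Y1 Y2 Z1 Z2 W1 (lB d W2);
  bal4_ZWb2 : forall d X1 X2 Y1 Y2 Z1 Z2 W1 W2,
    G X1 X2 Y1 Y2 Z1 (rbB d Z2) W1 W2 = G X1 X2 Y1 Y2 Z1 Z2 W1 (lbB d W2) }.
Hypothesis bG : bal4.

Lemma bal4_goodW X Y Z : good2 (fun W1 W2 => S3 (fun X1 X2 Y1 Y2 Z1 Z2 =>
  G X1 X2 Y1 Y2 Z1 Z2 W1 W2) X Y Z).
Proof.
case: bG => g3 bW _ ZWb1 ZW2 _.
apply: (nest (G := fun Z1 Z2 W1 W2 => sw Y (fun Y1 Y2 => sw X (fun X1 X2 =>
  G X1 X2 Y1 Y2 Z1 Z2 W1 W2)))).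
- by move=> W1 W2; apply: (bal3_goodZ (g3 W1 W2)).
- move=> Z1 Z2; split=> [W1|W2]; do 2 (apply: lin_dia_evalF => ? ?).
    exact: (proj1 (bW _ _ _ _ _ _)).
  exact: (proj2 (bW _ _ _ _ _ _)).
- by move=> d Z1 Z2 W1 W2; do 2 (apply: eq_dia_eval => ? ?).
- by move=> d Z1 Z2 W1 W2; do 2 (apply: eq_dia_eval => ? ?).
Qed.

Lemma S4_hom : hom4V opl opr S4.
Proof.
have gW := bal4_goodW.
have h3 W1 W2 := S3_hom (bal4_3 bG W1 W2).
have gZ W1 W2 X Y := bal3_goodZ (bal4_3 bG W1 W2) X Y.
case: bG => g3 bW ZW1 ZWb1 ZW2 ZWb2.
split=> [X|Y Z W|a X Y Z W|a X Y Z W|d X Y Z W|d X Y Z W|d X Y Z W|d X Y Z W|d X Y Z W|d X Y Z W].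
- split=> [Y Z|Y W|Z W]; first exact: swL2_lin.
    by apply: lin_dia_evalF => W1 W2; case: (hom3V_tril (h3 W1 W2)).
  by apply: lin_dia_evalF => W1 W2; case: (hom3V_tril (h3 W1 W2)).
- by apply: lin_dia_evalF => W1 W2; case: (hom3V_tril (h3 W1 W2)).
- rewrite /S4 (dia_eval_map (L := opl a)) //; apply: eq_dia_eval => W1 W2.
  exact: (hom3V_l (h3 W1 W2)).
- rewrite /S4 (dia_eval_map (L := opr a)) //; apply: eq_dia_eval => W1 W2.
  exact: (hom3V_r (h3 W1 W2)).
- by apply: eq_dia_eval => W1 W2; apply: (hom3V_bal (h3 W1 W2)).
- by apply: eq_dia_eval => W1 W2; apply: (hom3V_balb (h3 W1 W2)).
- by apply: eq_dia_eval => W1 W2; apply: (hom3V_bal2 (h3 W1 W2)).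
- by apply: eq_dia_eval => W1 W2; apply: (hom3V_balb2 (h3 W1 W2)).
- rewrite /S4 sw_lB //; apply: eq_dia_eval => W1 W2; rewrite /S3 sw_rB //.
  by do 3 (apply: eq_dia_eval => ? ?).
- rewrite /S4 sw_lbB //; apply: eq_dia_eval => W1 W2; rewrite /S3 sw_rbB //.
  by do 3 (apply: eq_dia_eval => ? ?).
Qed.

Lemma S4_J h g f l : S4 (J h) (J g) (J f) (J l) = teval (fun l1 l2 => teval (fun f1 f2 =>
  teval (fun g1 g2 => teval (fun h1 h2 =>
    G (J h1) (J h2) (J g1) (J g2) (J f1) (J f2) (J l1) (J l2))
  (comul H h)) (comul H g)) (comul H f)) (comul H l).
Proof.
rewrite [LHS]swL2E; last exact: bal4_goodW.
by apply: eq_teval => l1 l2; apply: (S3_J (bal4_3 bG _ _)).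
Qed.
End Four.
End NestedSums.

Section Balanced.

Lemma assoc_l_bal : bal3 lB lbB (fun X1 X2 Y1 Y2 Z1 Z2 => lB (P X1 Y1 Z1) (bmul (bmul X2 Y2) Z2)).
Proof.
have tr := ext3_tril Om; split=> *; try by lin.
- split=> [|d X1 X2]; first by lin.
  by rewrite ext3_lbB lBM !mu_lB.
- by rewrite ext3_lB lBM.
- by rewrite !mu_lbB lB_lbB.
- by rewrite ext3_rB1.
- by rewrite ext3_rbB1.
- by rewrite mu_rB.
- by rewrite mu_rbB.
- by rewrite ext3_rB2.
- by rewrite ext3_rbB2.
- by rewrite mu_rB2 mu_rB.
- by rewrite mu_rbB2 mu_rbB.
Qed.

Lemma assoc_r_bal : bal3 lB lbB (fun X1 X2 Y1 Y2 Z1 Z2 => lbB (P X2 Y2 Z2) (bmul X1 (bmul Y1 Z1))).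
Proof.
have tr := ext3_tril Om; split=> *; try by lin.
- split=> [|d X1 X2]; first by lin.
  by rewrite ext3_lB lbBM mu_lbB.
- by rewrite mu_lB lB_lbB.
- by rewrite ext3_lbB lbBM.
- by rewrite mu_rB mu_lB.
- by rewrite mu_rbB mu_lbB.
- by rewrite ext3_rB1.
- by rewrite ext3_rbB1.
- by rewrite mu_rB.
- by rewrite mu_rbB.
- by rewrite ext3_rB2.
- by rewrite ext3_rbB2.
Qed.

End Balanced.

Section Associativity.

Lemma muK_E b b' h g : muK b b' (tens h g) = teval (fun h1 h' => teval (fun h2 h3 =>
  lB (act h1 b) (lbB (act h3 b') (K (tens h2 g)))) (comul H h')) (comul H h).
Proof.
rewrite /muK cv_pll; apply: eq_teval => h1 h'.
rewrite cv_plr (teval_map (L := lB _)); last by lin.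
exact: eq_teval.
Qed.

Lemma mu_assoc_l h g f :
  bmul (bmul (J h) (J g)) (J f) = (g12 |> ((K \c m12 H H) <| g12V)) (tens h (tens g f)).
Proof.
rewrite mu_J.
have l1 : linear (fun X => bmul X (J f)) by lin.
rewrite -[LHS]/((LHom l1 \c K) (tens h g)).
rewrite (lhom_cvr (op' := lB) (g := LHom l1)); last by move=> u v; exact: mu_lB.
rewrite (lhom_cvl (op' := lbS) (g := LHom l1)); last by move=> u v; exact: mu_lbB.
rewrite [LHS]cv_tens cv_p12l; do 2 (apply: eq_teval => ? ?).
rewrite [(_ <| gaV) _]cv_tens cv_p12r; congr (lB _ _); do 2 (apply: eq_teval => ? ?).
congr (lbS _ _); rewrite [RHS]hcompE m12E -mu_J.
by rewrite -[LHS]/(bmul (J (mulc H _)) (J f)) mulcE.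
Qed.

Lemma mu_assoc_r h g f :
  bmul (J h) (bmul (J g) (J f))
  = (g23 |> ((K \c tm (idc H) (mulc H)) <| g23V)) (tens h (tens g f)).
Proof.
rewrite mu_J cvE (teval_map (L := bmul (J h))); last by lin.
etransitivity.
  apply: eq_teval => t1 t'; rewrite cvE (teval_map (L := fun X =>
    bmul (J h) (lB (ga t1) X))); last by lin.
  apply: eq_teval => t2 t3; rewrite hcompE -[lbS _ _]/(lbB _ _) -boxJ mu_box muK_E.
  reflexivity.
cbv beta; rewrite [RHS](cv_tens (C := H) (D := T2)); pullout 2%N; do 2 match_teval.
rewrite [(_ <| g23V) _](cv_tens (C := H) (D := T2)); pullout 1%N; do 2 match_teval.
by rewrite [(K \c tm (idc H) (mulc H)) _]hcompE tmE !shE.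
Qed.

(** The counterpart of [phB_conv] with the generator map in place of a functional; the scalar phi
    may stand on either side of the bimodule. *)
Lemma phB_J : phB |> (J \c mL) = (J \c mR) <| phB.
Proof.
apply: lhom_eq => t; have /(congr1 J) := phi_mLR t.
rewrite !(teval_map (L := J)); try by lin.
move=> e; etransitivity; [|etransitivity; [exact: e|]]; apply: eq_teval => x y.
  rewrite hlinZ -[phB x]/((phik x : k) *: 1) (linZ _ _ (f := fun b => lB b _)); last by lin.
  by rewrite lB1.
rewrite hlinZ -[phB y]/((phik y : k) *: 1) -[lbS _ _]/(lbB _ _).
rewrite (linZ _ _ (f := fun b => lbB b _)); last by lin.
by rewrite lbB1.
Qed.

Lemma Om_g12 : Om ** g12 ** g12_3 = g23 ** g1_23 ** phB.
Proof.
by rewrite /Om -!cvmA (cvmKl _ g12VK) g12_3VK cvm1r.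
Qed.
Lemma g23V_Om : g1_23V ** g23V ** Om = phB ** g12_3V ** g12V.
Proof.
by rewrite /Om -!cvmA (cvmKl _ g23VK) (cvmKl _ g1_23VK).
Qed.

Lemma K_m12 : K \c m12 H H = g12_3 |> ((J \c mL) <| g12_3V).
Proof. by rewrite !cv_pull hcompA. Qed.
Lemma K_23 : K \c tm (idc H) (mulc H) = g1_23 |> ((J \c mR) <| g1_23V).
Proof. by rewrite !cv_pull hcompA. Qed.

(** The cancellation behind [Om_assoc] in abstract form: x is [Om], m and n are generators at the
    two bracketings, f is phi. Of the five factors of [Om], the two inverse ones cancel against the
    product on one side and the two gammas against that on the other, leaving phi. *)
Lemma bimod_shift (C : coalgebra k) (x a b c d p q r s f : lhom C B) (m n : lhom C M) :
  x ** a ** b = p ** q ** f -> r ** s ** x = f ** c ** d -> f |> m = n <| f ->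
  x |> (a |> ((b |> (m <| c)) <| d)) = (p |> ((q |> (n <| r)) <| s)) <| x.
Proof.
move=> e1 e2 e3.
rewrite (cvlr b d) (cvrA c d) (cvlA a b) (cvlA x (a ** b)) cvmA e1.
rewrite (cvlr q s) (cvrA r s) (cvlA p q) (cvlr (p ** q) x).
rewrite (cvrA (r ** s) x) e2 -(cvlA (p ** q) f) -(cvlr f) e3.
by rewrite (cvrA f) cvmA.
Qed.

Lemma Om_assoc : Om |> (g12 |> ((K \c m12 H H) <| g12V))
  = (g23 |> ((K \c tm (idc H) (mulc H)) <| g23V)) <| Om.
Proof.
rewrite K_m12 K_23; apply: bimod_shift Om_g12 _ phB_J.
exact: g23V_Om.
Qed.

Lemma mu_Phi_assoc X Y Z :
  sw Z (fun Z1 Z2 => sw Y (fun Y1 Y2 => sw X (fun X1 X2 =>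
    lB (P X1 Y1 Z1) (bmul (bmul X2 Y2) Z2))))
  = sw Z (fun Z1 Z2 => sw Y (fun Y1 Y2 => sw X (fun X1 X2 =>
    lbB (P X2 Y2 Z2) (bmul X1 (bmul Y1 Z1))))).
Proof.
have ll a : linear (lB a) by lin.
have lr a : linear (lbB a) by lin.
have hl := S3_hom ll lr assoc_l_bal; have hr := S3_hom ll lr assoc_r_bal.
apply: (hom3V_eq hl hr) => h g f; rewrite !(S3_J assoc_l_bal) !(S3_J assoc_r_bal).
have e := congr1 (fun F : lhom T3 M => F (tens h (tens g f))) Om_assoc; move: e.
rewrite !cv_tens3' => e; etransitivity; [|etransitivity; [exact: e|]].
  by do 3 (apply: eq_teval => ? ?); rewrite ext3_J mu_assoc_l.
by do 3 (apply: eq_teval => ? ?); rewrite ext3_J mu_assoc_r.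
Qed.

End Associativity.

(** * The pentagon for Om *)

Section Pentagon.

(** The letters f are the five copies of phi. On one side [e1] makes room for the gamma-factors to
    cancel in pairs; on the other they cancel as they stand. The rest is to slide phi past two
    surviving factors by [e8] and [e9], and to use the pentagon [e10] of phi. *)
Lemma pentagon_calc (C : coalgebra k)
   (x1 x2 x3 f1 y1 GV x1V G y1' f2 z1 z2 f3 w u u' w' v f4 r s s' f5 : lhom C B) :
  GV ** x1V = x1V ** GV -> GV ** G = cm1 -> x1V ** x1 = cm1 -> y1 ** y1' = cm1 ->
  u ** u' = cm1 -> w ** w' = cm1 -> s ** s' = cm1 -> f3 ** v = x3 ** f3 ->
  r ** f5 = f5 ** z1 -> f1 ** f2 = f3 ** (f4 ** f5) ->
  x1 ** (x2 ** x3 ** f1 ** y1 ** GV) ** x1V ** G ** (x1 ** y1' ** f2 ** z1 ** z2) ** GV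
  = (x1 ** x2 ** f3 ** w ** u) ** u' ** (w' ** v ** f4 ** r ** s) ** u
    ** (u' ** s' ** f5 ** z2 ** GV).
Proof.
move=> e1 e2 e3 e4 e5 e6 e7 e8 e9 e10.
rewrite -!cvmA (cvmA GV x1V) e1 -(cvmA x1V GV) (cvmKl _ e2) (cvmKl _ e3) (cvmKl _ e4).
rewrite (cvmKl _ e5) (cvmKl _ e6) (cvmKl _ e5) (cvmKl _ e7).
rewrite (cvmA f1 f2) e10 (cvmA f3 v) e8 (cvmA r f5) e9 -!cvmA //.
Qed.

(** As in [p12_A3], now with the fixed element [F f] in the innermost place. *)
Lemma p12_sh (D : coalgebra k) (x : lhom T2 B) (F : lhom D B) :
  (forall e, x ** A2 e = A2 e ** x) ->
  (x \c p12 H D) ** sh (sh F) = sh (sh F) ** (x \c p12 H D).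
Proof.
move=> c; apply: bil_tens_eq => h g f.
have e := congr1 (fun F : lhom T2 B => F (tens h g)) (c (F f)).
rewrite !cv_tens in e; rewrite cv_p12l cv_p12r; etransitivity; [|etransitivity; [exact: e|]].
all: by do 2 (apply: eq_teval => ? ?); rewrite !shE.
Qed.

Lemma cv_q5l (U V W : lmodType k) (op : bil U V W) (F : lhom T3 U) (G : lhom T4 V) h g f l :
  cv op (F \c q5) G (tens h (tens g (tens f l))) =
  teval (fun h1 h2 => teval (fun g1 g2 => teval (fun f1 f2 =>
    op (F (tens h1 (tens g1 f1))) (G (tens h2 (tens g2 (tens f2 l)))))
    (comul H f)) (comul H g)) (comul H h).
Proof.
rewrite cv_slice; apply: eq_teval => h1 h2.
have -> : slice (F \c q5) h1 = slice F h1 \c p12 H H.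
  by apply: lhom_eq => x; rewrite -[LHS]/(F (tm (idc H) (p12 H H) (tens h1 x))) tmE.
rewrite (cv_p12l op (slice F h1) (slice G h2) g f l).
by do 2 (apply: eq_teval => ? ?); rewrite !sliceE.
Qed.

(** Sliding phi(g, f, l) past gamma(h, -) changes (gf)l into g(fl): this is [phB_conv] for the
    functional gamma(h, -). *)
Lemma phB_v : (phB \c q3) ** (g1_23 \c q4) = (g1_23 \c q1) ** (phB \c q3).
Proof.
apply: lhom4_eq => h g f l.
rewrite (cv_prl (C := H) (D := T3)) (cv_prr (C := H) (D := T3)).
have e := congr1 (fun F : lhom T3 B => F (tens g (tens f l))) (phB_conv (slice ga h)).
etransitivity; [|etransitivity; [exact: e|]]; clear e.
  rewrite cvE; congr (teval _ _); apply/funext => x; apply/funext => y.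
  congr (mA B _ _); move: y; apply: tens3_eq => [||y1 y2 y3]; [by lin|by lin|].
  by rewrite hcompE q4E [LHS]hcompE tmE mulcE [RHS]hcompE mLE sliceE.
rewrite cvE; congr (teval _ _); apply/funext => x; apply/funext => y.
congr (mA B _ _); move: x; apply: tens3_eq => [||y1 y2 y3]; [by lin|by lin|].
by rewrite [RHS]hcompE q1E [RHS]hcompE tmE mulcE [LHS]hcompE mRE sliceE.
Qed.

Fact fixr_lin (F : lhom T2 B) l : linear (fun x => F (tens x l)). Proof. by lin. Qed.
Definition fixr (F : lhom T2 B) l : lhom H B := LHom (fixr_lin F l).

(** The analogue for phi(h, g, f) and the functional gamma^-1(-, l). *)
Lemma phB_r5 : (g12_3V \c q4) ** (phB \c q5) = (phB \c q5) ** (g12_3V \c q2).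
Proof.
apply: lhom4_eq => h g f l; rewrite cv_q5l cv_q5r; symmetry.
have e := congr1 (fun F : lhom T3 B => F (tens h (tens g f))) (phB_conv (fixr gaV l)).
rewrite !cv_tens3 in e; etransitivity; [|etransitivity; [exact: e|]]; clear e.
  do 3 (apply: eq_teval => ? ?); congr (mA B _ _).
  by rewrite hcompE q2E [LHS]hcompE m12E [RHS]hcompE mLE.
do 3 (apply: eq_teval => ? ?); congr (mA B _ _).
by rewrite [RHS]hcompE q4E [RHS]hcompE m12E [LHS]hcompE mRE.
Qed.

(** In these five expansions, factors that occur in two associators under different names are given
    a common one, so that their cancellation becomes visible. Here gamma^-1(hg, fl) is written to
    match the gamma(hg, fl) contained in [Om_q2]. *)
Lemma Om_q1 : Om \c q1 = sh g1_23 ** (g1_23 \c q1) ** (phB \c q1) ** (g1_23V \c q2) ** G12V.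
Proof.
rewrite /Om !cvm_pull -sh_pull.
have -> : g12_3V \c q1 = g1_23V \c q2.
  apply: lhom4_eq => h g f l; rewrite hcompE q1E [RHS]hcompE q2E.
  by rewrite hcompE m12E [RHS]hcompE tmE mulcE.
have -> // : g12V \c q1 = G12V.
apply: lhom4_eq => h g f l; rewrite hcompE q1E [LHS]hcompE p12E [RHS]hcompE p12E counit_tc.
by rewrite counit_hmul.
Qed.

Lemma Om_q2 : Om \c q2
  = sh (sh ga) ** (g1_23 \c q2) ** (phB \c q2) ** (g12_3V \c q2) ** (g12V \c q2).
Proof.
rewrite /Om !cvm_pull.
have -> // : g23 \c q2 = sh (sh ga).
by apply: lhom4_eq => h g f l; rewrite hcompE q2E !shE (act_hmul modalg).
Qed.

Lemma sh_Om : sh Om = sh (sh ga) ** sh g1_23 ** (phB \c q3) ** sh g12_3V ** sh g12V.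
Proof.
rewrite /Om !shM.
have -> // : sh phB = phB \c q3.
apply: lhom4_eq => h g f l; rewrite shE phBE hcompE q3E hlinZ phBE.
by rewrite (linZ _ _ (f := act h)); [rewrite (act1r modalg) !scalerA mulrC | lin].
Qed.

Lemma Om_q4 : Om \c q4
  = sh g12_3 ** (g1_23 \c q4) ** (phB \c q4) ** (g12_3V \c q4) ** (g1_23V \c q5).
Proof.
rewrite /Om !cvm_pull -sh_pull.
have -> // : g12V \c q4 = g1_23V \c q5.
apply: lhom4_eq => h g f l; rewrite hcompE q4E [RHS]hcompE q5E.
by rewrite hcompE p12E !hlinZ [in RHS]hcompE tmE mulcE.
Qed.

Lemma Om_q5 : Om \c q5
  = sh g12 ** (g1_23 \c q5) ** (phB \c q5) ** (g12V \c q2) ** G12V.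
Proof.
rewrite /Om !cvm_pull -sh_pull.
have -> : g12_3V \c q5 = g12V \c q2.
  apply: lhom4_eq => h g f l; rewrite hcompE q5E [RHS]hcompE q2E.
  by rewrite hlinZ hcompE m12E [RHS]hcompE p12E hlinZ.
have -> // : g12V \c q5 = G12V.
apply: lhom4_eq => h g f l; rewrite [RHS]hcompE p12E counit_tc hcompE q5E hlinZ hcompE p12E.
by rewrite !hlinZ scalerA mulrC.
Qed.

(** The additional gamma-factors are the coefficients that a product of two generators carries
    around J(hg), once it is inserted as an argument of Phi; see [Phi_left], [Phi_mid] and
    [Phi_right]. *)
Lemma Om_pentagon :
  sh (sh ga) ** (Om \c q1) ** sh (sh gaV) ** G12 ** (Om \c q2) ** G12V
  = sh Om ** sh g12 ** (Om \c q4) ** sh g12V ** (Om \c q5).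
Proof.
rewrite Om_q1 Om_q2 sh_Om Om_q4 Om_q5; apply: pentagon_calc.
- by apply: p12_sh => e; apply: gaV_A2.
- by rewrite -cvm_pull gaVga cm1_pull.
- by rewrite -!shM gaVga !sh1.
- by rewrite -cvm_pull g1_23VK cm1_pull.
- by rewrite -shM g12VK sh1.
- by rewrite -shM g12_3VK sh1.
- by rewrite -cvm_pull g1_23VK cm1_pull.
- exact: phB_v.
- exact: phB_r5.
- exact: pentagon_phi.
Qed.

End Pentagon.

(** * The associator Phi^gamma *)

Section AssociatorValues.

Section PhiOnBoxes.
Variable F : lhom T3 B.
Let tr := ext3_tril F.

Lemma ext3_mid h m f x y : ext3 F (J h) (lB x (lbB y (J m))) (J f)
  = teval (fun h1 h' => teval (fun h2 h3 =>
      act h1 x * F (tens h2 (tens m f)) * act h3 y) (comul H h')) (comul H h).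
Proof.
rewrite -boxJ [LHS]ext3E mul1r mulr1.
rewrite /wrap3 !actl1 !sh1 !cm1_pull cvm1r -!cvmA cvm1l cv_pll; match_teval.
rewrite cv_plr (teval_map (L := bfun (mA B) _)); last by lin.
by apply: eq_teval => h2 h3; rewrite !mAE mulrA.
Qed.

Lemma ext3_last h g m x y : ext3 F (J h) (J g) (lB x (lbB y (J m)))
  = teval (fun h1 h' => teval (fun g1 g' => teval (fun h2 h3 => teval (fun g2 g3 =>
      act h1 (act g1 x) * F (tens h2 (tens g2 m)) * act h3 (act g3 y))
      (comul H g')) (comul H h')) (comul H g)) (comul H h).
Proof.
rewrite -boxJ [LHS]ext3E mul1r mulr1.
rewrite /wrap3 !actl1 !cm1_pull cvm1r cvm1l -cvmA cv_p12l; do 2 match_teval.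
rewrite cv_p12r (teval_map (L := bfun (mA B) _)); last by lin.
apply: eq_teval => h2 h3; rewrite (teval_map (L := bfun (mA B) _)); last by lin.
by apply: eq_teval => g2 g3; rewrite !mAE !shE mulrA.
Qed.
End PhiOnBoxes.

Let tr := ext3_tril Om.
Lemma KE h g : K (tens h g) = teval (fun h1 h' => teval (fun g1 g' => teval (fun h2 h3 =>
  teval (fun g2 g3 => lB (ga (tens h1 g1)) (lbB (gaV (tens h3 g3)) (J (hmul h2 g2))))
  (comul H g')) (comul H h')) (comul H g)) (comul H h).
Proof.
rewrite cv_tens; do 2 match_teval; rewrite cv_tens (teval_map (L := lB _)); last by lin.
apply: eq_teval => h2 h3; rewrite (teval_map (L := lB _)); last by lin.
by apply: eq_teval => g2 g3; rewrite hcompE mulcE.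
Qed.

Lemma slice_sh12 (F : lhom T2 B) h : slice (sh (F \c p12 H H)) h = slice (sh F) h \c p12 H H.
Proof. by apply: lhom3_eq => g f l; rewrite sliceE shE [RHS]hcompE sliceE hcompE shE. Qed.

(** The coefficients of the product of generators leave the first argument by left linearity, with
    no action on them. In the middle and last arguments they must pass one or two generators, whence
    the [sh] in the next two lemmas. *)
Lemma Phi_left h g f l : P (bmul (J h) (J g)) (J f) (J l)
  = (G12 ** (Om \c q2) ** G12V) (tens h (tens g (tens f l))).
Proof.
rewrite mu_J.
have l1 : linear (fun X => P X (J f) (J l)) by lin.
rewrite -[LHS]/((LHom l1 \c K) (tens h g)).
rewrite (lhom_cvr (op' := mA B) (g := LHom l1)); last by move=> u v; exact: ext3_lB.
rewrite (lhom_cvl (op' := mA B) (g := LHom l1)); last by move=> u v; exact: ext3_lbB.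
rewrite -cvmA [LHS]cv_tens cv_p12l; do 2 (apply: eq_teval => ? ?).
rewrite [cv (mA B) _ gaV _]cv_tens cv_p12r; congr (mA B _ _); do 2 (apply: eq_teval => ? ?).
congr (mA B _ _); rewrite [RHS]hcompE q2E -[RHS](ext3_J).
by rewrite -[LHS]/(P (J (mulc H _)) (J f) (J l)) mulcE.
Qed.

Lemma Phi_mid h g f l : P (J h) (bmul (J g) (J f)) (J l)
  = (sh g12 ** (Om \c q4) ** sh g12V) (tens h (tens g (tens f l))).
Proof.
rewrite mu_J KE (teval_map (L := fun X => P (J h) X (J l))); last by lin.
etransitivity.
  do 3 (apply: eq_teval => ? ?; rewrite (teval_map (L := fun X => P (J h) X (J l))); last by lin).
  apply: eq_teval => ? ?; rewrite ext3_mid; reflexivity.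
cbv beta; pullout 4%N.
rewrite -cvmA (cv_slice (C := H) (D := T3)); match_teval.
rewrite slice_sh12 cv_p12l; do 2 match_teval; rewrite !sliceE.
rewrite (cv_slice (C := H) (D := T3)) (teval_map (L := bfun (mA B) _)); last by lin.
pullout 2%N; apply: eq_teval => h2 h3.
rewrite slice_sh12 cv_p12r.
do 2 (rewrite (teval_map (L := bfun (mA B) _)); [apply: eq_teval => ? ? | lin]).
by rewrite !sliceE !mAE !shE hcompE q4E mulrA.
Qed.

Lemma Phi_right h g f l : P (J h) (J g) (bmul (J f) (J l))
  = (sh (sh ga) ** (Om \c q1) ** sh (sh gaV)) (tens h (tens g (tens f l))).
Proof.
rewrite mu_J KE (teval_map (L := fun X => P (J h) (J g) X)); last by lin.
etransitivity.
  do 3 (apply: eq_teval => ? ?; rewrite (teval_map (L := fun X => P (J h) (J g) X)); last by lin).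
  apply: eq_teval => ? ?; rewrite ext3_last; reflexivity.
cbv beta; pullout 4%N.
rewrite -cvmA cv_tens4; match_teval.
pullout 4%N; match_teval.
do 2 match_teval; rewrite cv_tens4 (teval_map (L := bfun (mA B) _)); last by lin.
pullout 2%N; apply: eq_teval => h2 h3.
rewrite (teval_map (L := bfun (mA B) _)); last by lin.
pullout 2%N; apply: eq_teval => g2 g3.
do 2 (rewrite (teval_map (L := bfun (mA B) _)); [apply: eq_teval => ? ? | lin]).
by rewrite !mAE !shE hcompE q1E mulrA.
Qed.
End AssociatorValues.

(** * Balance of the two sides of the cocycle condition *)

Section CocycleSides.

Section Legs.
Variables (V : lmodType k).

Lemma sw_tk (F : M -> M -> V) b X : good2 F ->
  sw X (fun X1 X2 => F (rbB b X1) X2) = sw X (fun X1 X2 => F X1 (rB b X2)).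
Proof.
move=> gF; have [bF bal] := gF.
have g1 : good2 (fun X1 X2 => F (rbB b X1) X2).
  by split=> [|c Y Z]; [lin | rewrite rbB_lbB bal].
have g2 : good2 (fun X1 X2 => F X1 (rB b X2)).
  by split=> [|c Y Z]; [lin | rewrite rB_lB bal].
move: X; apply: box_eq => [||a h a']; [exact: swL2_lin|exact: swL2_lin|].
by rewrite !swL2E //; apply: tk.
Qed.

Variable F : M -> M -> M -> V.
Hypothesis gF : good3 F.
Let gs := good3_sw gF.
Let gF2 X1 : good2 (F X1). Proof. by case: gF. Qed.

Lemma sw3_lB d X : sw3 (lB d X) F = sw3 X (fun X1 X2 X3 => F (lB d X1) X2 X3).
Proof. exact: (sw_lB gs d X). Qed.
Lemma sw3_rB d X : sw3 (rB d X) F = sw3 X (fun X1 X2 X3 => F (rB d X1) X2 X3).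
Proof. exact: (sw_rB gs d X). Qed.
Lemma sw3_lbB d X : sw3 (lbB d X) F = sw3 X (fun X1 X2 X3 => F X1 X2 (lbB d X3)).
Proof.
rewrite [LHS](sw_lbB gs d X); apply: eq_dia_eval => X1 X'.
exact: (sw_lbB (gF2 X1) d X').
Qed.
Lemma sw3_rbB d X : sw3 (rbB d X) F = sw3 X (fun X1 X2 X3 => F X1 X2 (rbB d X3)).
Proof.
rewrite [LHS](sw_rbB gs d X); apply: eq_dia_eval => X1 X'.
exact: (sw_rbB (gF2 X1) d X').
Qed.
Lemma sw3_tk12 d X : sw3 X (fun X1 X2 X3 => F (rbB d X1) X2 X3)
  = sw3 X (fun X1 X2 X3 => F X1 (rB d X2) X3).
Proof.
rewrite [LHS](sw_tk d X gs); apply: eq_dia_eval => X1 X'.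
exact: (sw_rB (gF2 X1) d X').
Qed.
Lemma sw3_tk23 d X : sw3 X (fun X1 X2 X3 => F X1 (rbB d X2) X3)
  = sw3 X (fun X1 X2 X3 => F X1 X2 (rB d X3)).
Proof. by apply: eq_dia_eval => X1 X'; apply: sw_tk. Qed.
End Legs.

Lemma eq_sw3 (V : lmodType k) (F G : M -> M -> M -> V) X :
  (forall X1 X2 X3, F X1 X2 X3 = G X1 X2 X3) -> sw3 X F = sw3 X G.
Proof. by move=> e; do 2 (apply: eq_dia_eval => ? ?). Qed.
Lemma lin_sw3F (U V : lmodType k) (F : U -> M -> M -> M -> V) X :
  (forall X1 X2 X3, linear (fun u => F u X1 X2 X3)) -> linear (fun u => sw3 X (F u)).
Proof. by move=> e; do 2 (apply: lin_dia_evalF => ? ?). Qed.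
Lemma sw3_map (U V : lmodType k) (L : U -> V) (F : M -> M -> M -> U) X : linear L ->
  L (sw3 X F) = sw3 X (fun X1 X2 X3 => L (F X1 X2 X3)).
Proof.
move=> lL; rewrite [LHS](dia_eval_map (L := L)) //; apply: eq_dia_eval => X1 X'.
by rewrite [LHS](dia_eval_map (L := L)).
Qed.

Let tr := ext3_tril Om.

Lemma cocycle_l_bal : bal4 mulB mulBr (fun X1 X2 Y1 Y2 Z1 Z2 W1 W2 =>
  P X1 Y1 (bmul Z1 W1) * P (bmul X2 Y2) Z2 W2).
Proof.
rewrite /mulB /mulBr.
split=> [W1 W2|*|*|*|*|*]; last first.
- by rewrite ext3_rbB2.
- by rewrite ext3_rB2.
- by rewrite mu_rbB.
- by rewrite mu_rB.
- by lin.
split=> *; try by lin.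
- split=> [|d X1 X2]; first by lin.
  by rewrite ext3_lbB mu_lB ext3_lB mulrA.
- by rewrite ext3_lB mulrA.
- by rewrite mu_lbB ext3_lbB mulrA.
- by rewrite ext3_rB1.
- by rewrite ext3_rbB1.
- by rewrite mu_rB.
- by rewrite mu_rbB.
- by rewrite ext3_rB2 mu_lB.
- by rewrite ext3_rbB2 mu_lbB.
- by rewrite mu_rB2 ext3_rB1.
- by rewrite mu_rbB2 ext3_rbB1.
Qed.

(** Here Y and Z are split into three legs, which the pattern of [S4] does not cover, so balance is
    checked leg by leg with the Takeuchi rules [sw3_tk12] and [sw3_tk23]. *)
Definition coc_r X1 X2 Y1 Y2 Y3 Z1 Z2 Z3 W1 W2 : B :=
  P X1 (lB (P Y1 Z1 W1) (bmul Y2 Z2)) W2 * P X2 Y3 Z3.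
Definition cocR X Y Z W := sw W (fun W1 W2 => sw3 Z (fun Z1 Z2 Z3 =>
  sw3 Y (fun Y1 Y2 Y3 => sw X (fun X1 X2 => coc_r X1 X2 Y1 Y2 Y3 Z1 Z2 Z3 W1 W2)))).

Lemma coc_goodX Y1 Y2 Y3 Z1 Z2 Z3 W1 W2 :
  good2 (fun X1 X2 => coc_r X1 X2 Y1 Y2 Y3 Z1 Z2 Z3 W1 W2).
Proof.
rewrite /coc_r; split=> [|d X1 X2]; first by lin.
by rewrite ext3_lbB ext3_lB mulrA.
Qed.

Lemma coc_goodY X Z1 Z2 Z3 W1 W2 : good3 (fun Y1 Y2 Y3 =>
  sw X (fun X1 X2 => coc_r X1 X2 Y1 Y2 Y3 Z1 Z2 Z3 W1 W2)).
Proof.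
have gX := coc_goodX.
split=> [Y1|Y2 Y3|d Y1 Y2 Y3].
- split=> [|d Y2 Y3].
    by split=> [Y2|Y3]; apply: lin_dia_evalF => X1 X2; rewrite /coc_r; lin.
  transitivity (sw X (fun X1 X2 => coc_r (rbB d X1) X2 Y1 Y2 Y3 Z1 Z2 Z3 W1 W2)).
    by apply: eq_dia_eval => X1 X2; rewrite /coc_r mu_lbB lB_lbB ext3_rbB1.
  rewrite (sw_tk _ _ (gX _ _ _ _ _ _ _ _)); apply: eq_dia_eval => X1 X2.
  by rewrite /coc_r ext3_rB1.
- by apply: lin_dia_evalF => X1 X2; rewrite /coc_r; lin.
- by apply: eq_dia_eval => X1 X2; rewrite /coc_r ext3_lbB mu_lB lBM.
Qed.

Lemma coc_goodZ X Y W1 W2 : good3 (fun Z1 Z2 Z3 => sw3 Y (fun Y1 Y2 Y3 =>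
  sw X (fun X1 X2 => coc_r X1 X2 Y1 Y2 Y3 Z1 Z2 Z3 W1 W2))).
Proof.
have gY := coc_goodY.
split=> [Z1|Z2 Z3|d Z1 Z2 Z3].
- split=> [|d Z2 Z3].
    split=> [Z2|Z3]; apply: lin_sw3F => Y1 Y2 Y3;
    by apply: lin_dia_evalF => X1 X2; rewrite /coc_r; lin.
  transitivity (sw3 Y (fun Y1 Y2 Y3 => sw X (fun X1 X2 =>
       coc_r X1 X2 Y1 (rbB d Y2) Y3 Z1 Z2 Z3 W1 W2))).
    by apply: eq_sw3 => Y1 Y2 Y3; apply: eq_dia_eval => X1 X2; rewrite /coc_r mu_rbB.
  rewrite (sw3_tk23 (gY _ _ _ _ _ _)); apply: eq_sw3 => Y1 Y2 Y3; apply: eq_dia_eval => X1 X2.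
  by rewrite /coc_r ext3_rB2.
- by apply: lin_sw3F => Y1 Y2 Y3; apply: lin_dia_evalF => X1 X2; rewrite /coc_r; lin.
- transitivity (sw3 Y (fun Y1 Y2 Y3 => sw X (fun X1 X2 =>
       coc_r X1 X2 (rbB d Y1) Y2 Y3 Z1 Z2 Z3 W1 W2))).
    by apply: eq_sw3 => Y1 Y2 Y3; apply: eq_dia_eval => X1 X2; rewrite /coc_r ext3_rbB1.
  rewrite (sw3_tk12 (gY _ _ _ _ _ _)); apply: eq_sw3 => Y1 Y2 Y3; apply: eq_dia_eval => X1 X2.
  by rewrite /coc_r mu_rB.
Qed.

Lemma coc_goodW X Y Z : good2 (fun W1 W2 => sw3 Z (fun Z1 Z2 Z3 =>
  sw3 Y (fun Y1 Y2 Y3 => sw X (fun X1 X2 => coc_r X1 X2 Y1 Y2 Y3 Z1 Z2 Z3 W1 W2)))).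
Proof.
have gZ := coc_goodZ.
split=> [|d W1 W2].
  split=> [W1|W2]; apply: lin_sw3F => Z1 Z2 Z3; apply: lin_sw3F => Y1 Y2 Y3;
  by apply: lin_dia_evalF => X1 X2; rewrite /coc_r; lin.
transitivity (sw3 Z (fun Z1 Z2 Z3 => sw3 Y (fun Y1 Y2 Y3 => sw X (fun X1 X2 =>
       coc_r X1 X2 Y1 Y2 Y3 (rbB d Z1) Z2 Z3 W1 W2)))).
  apply: eq_sw3 => Z1 Z2 Z3; apply: eq_sw3 => Y1 Y2 Y3; apply: eq_dia_eval => X1 X2.
  by rewrite /coc_r ext3_rbB2.
rewrite (sw3_tk12 (gZ _ _ _ _)); apply: eq_sw3 => Z1 Z2 Z3.
apply: eq_sw3 => Y1 Y2 Y3; apply: eq_dia_eval => X1 X2.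
by rewrite /coc_r mu_rB2 -rB_lB ext3_rB2.
Qed.

Lemma cocR_hom : hom4V mulB mulBr cocR.
Proof.
have gX := coc_goodX; have gY := coc_goodY; have gZ := coc_goodZ; have gW := coc_goodW.
have lX Y1 Y2 Y3 Z1 Z2 Z3 W1 W2 := swL2_lin (gX Y1 Y2 Y3 Z1 Z2 Z3 W1 W2).
have lY X Z1 Z2 Z3 W1 W2 := swL3_lin (gY X Z1 Z2 Z3 W1 W2).
have lZ X Y W1 W2 := swL3_lin (gZ X Y W1 W2).
split=> [X|Y Z W|a X Y Z W|a X Y Z W|d X Y Z W|d X Y Z W|d X Y Z W|d X Y Z W|d X Y Z W|d X Y Z W].
- split=> [Y Z|Y W|Z W]; first exact: swL2_lin.
    by apply: lin_dia_evalF => W1 W2; apply: lZ.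
  by apply: lin_dia_evalF => W1 W2; apply: lin_sw3F => Z1 Z2 Z3; apply: lY.
- apply: lin_dia_evalF => W1 W2; apply: lin_sw3F => Z1 Z2 Z3; apply: lin_sw3F => Y1 Y2 Y3.
  exact: lX.
- have lm : linear (mulB a : B -> B) by rewrite /mulB; lin.
  rewrite /cocR (dia_eval_map (L := mulB a)) //; apply: eq_dia_eval => W1 W2.
  rewrite sw3_map //; apply: eq_sw3 => Z1 Z2 Z3; rewrite sw3_map //; apply: eq_sw3 => Y1 Y2 Y3.
  rewrite (sw_lB (gX _ _ _ _ _ _ _ _)) (dia_eval_map (L := mulB a)) //; apply: eq_dia_eval => X1 X2.
  by rewrite /coc_r /mulB ext3_lB mulrA.
- have lm : linear (mulBr a : B -> B) by rewrite /mulBr; lin.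
  rewrite /cocR (dia_eval_map (L := mulBr a)) //; apply: eq_dia_eval => W1 W2.
  rewrite sw3_map //; apply: eq_sw3 => Z1 Z2 Z3; rewrite sw3_map //; apply: eq_sw3 => Y1 Y2 Y3.
  rewrite (sw_lbB (gX _ _ _ _ _ _ _ _)) (dia_eval_map (L := mulBr a)) //;
    apply: eq_dia_eval => X1 X2.
  by rewrite /coc_r /mulBr ext3_lbB mulrA.
- apply: eq_dia_eval => W1 W2; apply: eq_sw3 => Z1 Z2 Z3; rewrite (sw3_lB (gY _ _ _ _ _ _)).
  apply: eq_sw3 => Y1 Y2 Y3; rewrite (sw_rB (gX _ _ _ _ _ _ _ _)); apply: eq_dia_eval => X1 X2.
  by rewrite /coc_r ext3_rB1 ext3_lB lBM.
- apply: eq_dia_eval => W1 W2; apply: eq_sw3 => Z1 Z2 Z3; rewrite (sw3_lbB (gY _ _ _ _ _ _)).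
  apply: eq_sw3 => Y1 Y2 Y3; rewrite (sw_rbB (gX _ _ _ _ _ _ _ _)); apply: eq_dia_eval => X1 X2.
  by rewrite /coc_r ext3_rbB1.
- apply: eq_dia_eval => W1 W2; rewrite (sw3_lB (gZ _ _ _ _)); apply: eq_sw3 => Z1 Z2 Z3.
  rewrite (sw3_rB (gY _ _ _ _ _ _)); apply: eq_sw3 => Y1 Y2 Y3; apply: eq_dia_eval => X1 X2.
  by rewrite /coc_r ext3_rB1.
- apply: eq_dia_eval => W1 W2; rewrite (sw3_lbB (gZ _ _ _ _)); apply: eq_sw3 => Z1 Z2 Z3.
  rewrite (sw3_rbB (gY _ _ _ _ _ _)); apply: eq_sw3 => Y1 Y2 Y3; apply: eq_dia_eval => X1 X2.
  by rewrite /coc_r ext3_rbB2.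
- rewrite /cocR (sw_lB (gW _ _ _)); apply: eq_dia_eval => W1 W2.
  rewrite (sw3_rB (gZ _ _ _ _)); apply: eq_sw3 => Z1 Z2 Z3.
  apply: eq_sw3 => Y1 Y2 Y3; apply: eq_dia_eval => X1 X2.
  by rewrite /coc_r ext3_rB2.
- rewrite /cocR (sw_lbB (gW _ _ _)); apply: eq_dia_eval => W1 W2.
  rewrite (sw3_rbB (gZ _ _ _ _)).
  (* The scalar stands on Z3 but has to reach W2, whose neighbour is Z2. As Z3 is the last argument
     of Phi, the opposite action may be replaced by the ordinary one, and this crosses back to Z2 by
     the Takeuchi condition. *)
  transitivity (sw3 Z (fun Z1 Z2 Z3 => sw3 Y (fun Y1 Y2 Y3 => sw X (fun X1 X2 =>
       coc_r X1 X2 Y1 Y2 Y3 Z1 Z2 (rB d Z3) W1 W2)))).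
    apply: eq_sw3 => Z1 Z2 Z3; apply: eq_sw3 => Y1 Y2 Y3; apply: eq_dia_eval => X1 X2.
    by rewrite /coc_r ext3_Om_right.
  rewrite -(sw3_tk23 (gZ _ _ _ _)); apply: eq_sw3 => Z1 Z2 Z3.
  apply: eq_sw3 => Y1 Y2 Y3; apply: eq_dia_eval => X1 X2.
  by rewrite /coc_r mu_rbB2 -rbB_lB ext3_rbB2.
Qed.

Lemma cocR_J h g f l : cocR (J h) (J g) (J f) (J l)
  = teval (fun l1 l2 => teval (fun f1 f' => teval (fun f2 f3 => teval (fun g1 g' =>
    teval (fun g2 g3 => teval (fun h1 h2 =>
      coc_r (J h1) (J h2) (J g1) (J g2) (J g3) (J f1) (J f2) (J f3) (J l1) (J l2))
    (comul H h)) (comul H g')) (comul H g)) (comul H f')) (comul H f)) (comul H l).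
Proof.
rewrite [LHS](swL2E _ _ _ (coc_goodW _ _ _)); apply: eq_teval => l1 l2.
rewrite [LHS](swL3E _ _ _ (coc_goodZ _ _ _ _)); do 2 (apply: eq_teval => ? ?).
rewrite [LHS](swL3E _ _ _ (coc_goodY _ _ _ _ _ _)); do 2 (apply: eq_teval => ? ?).
by rewrite [LHS](swL2E _ _ _ (coc_goodX _ _ _ _ _ _ _ _)).
Qed.

End CocycleSides.

Section Cocycle.

Let tr := ext3_tril Om.

Lemma Phi_mid_lB h p g f l : P (J h) (lB p (bmul (J g) (J f))) (J l)
  = teval (fun h1 h2 => act h1 p * (sh g12 ** (Om \c q4) ** sh g12V) (tens h2 (tens g (tens f l))))
    (comul H h).
Proof.
rewrite -ext3_rB1 -[rB p _]/((bilr rB p \c J) h) rBJ cvE.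
rewrite (teval_map (L := fun X => P X _ _)); last by lin.
by apply: eq_teval => h1 h2; rewrite ext3_lB Phi_mid.
Qed.

Lemma coc_r_J h g1 g2 g3 f1 f2 f3 l1 l2 :
  teval (fun h1 h2 => coc_r (J h1) (J h2) (J g1) (J g2) (J g3) (J f1) (J f2) (J f3) (J l1) (J l2))
    (comul H h)
  = teval (fun h1 h' => teval (fun h2 h3 => act h1 (Om (tens g1 (tens f1 l1))) *
      ((sh g12 ** (Om \c q4) ** sh g12V) (tens h2 (tens g2 (tens f2 l2)))
       * Om (tens h3 (tens g3 f3)))) (comul H h')) (comul H h).
Proof.
rewrite coassoc; last by lin.
apply: eq_teval => h1 h2.
rewrite /coc_r Phi_mid_lB !ext3_J (teval_map (L := fun b => b * _)); last by lin.
by apply: eq_teval => h11 h12; rewrite mulrA.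
Qed.

(** Both sides are left linear and balanced in all four arguments, hence determined on generators,
    where they are the two sides of [Om_pentagon]. *)
Lemma Phi_cocycle X Y Z W :
  sw W (fun W1 W2 => sw Z (fun Z1 Z2 => sw Y (fun Y1 Y2 => sw X (fun X1 X2 =>
    P X1 Y1 (bmul Z1 W1) * P (bmul X2 Y2) Z2 W2))))
  = sw W (fun W1 W2 => sw3 Z (fun Z1 Z2 Z3 => sw3 Y (fun Y1 Y2 Y3 => sw X (fun X1 X2 =>
    P X1 (lB (P Y1 Z1 W1) (bmul Y2 Z2)) W2 * P X2 Y3 Z3)))).
Proof.
have ll a : linear (mulB a) by rewrite /mulB; lin.
have lr a : linear (mulBr a) by rewrite /mulBr; lin.
apply: (hom4V_eq (S4_hom ll lr cocycle_l_bal) cocR_hom) => h g f l.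
rewrite (S4_J cocycle_l_bal) cocR_J.
transitivity ((sh (sh ga) ** (Om \c q1) ** sh (sh gaV) ** G12 ** (Om \c q2) ** G12V)
  (tens h (tens g (tens f l)))).
  rewrite -!cvmA !cvmA -(cvmA _ G12) -(cvmA _ _ G12V) cv_tens4; symmetry.
  pullout 3%N; match_teval; pullout 2%N; match_teval; pullout 1%N; match_teval; match_teval.
  by rewrite -Phi_right -Phi_left.
rewrite Om_pentagon.
rewrite -!cvmA (cvmA (sh g12)) (cvmA _ (sh g12V)) cv_tens4; symmetry.
etransitivity.
  do 5 (apply: eq_teval => ? ?); rewrite coc_r_J; reflexivity.
cbv beta; pullout 5%N; match_teval.
pullout 3%N; match_teval; pullout 1%N; match_teval; match_teval.
rewrite cv_q5r (teval_map (L := bfun (mA B) _)); last by lin.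
pullout 2%N; apply: eq_teval => ? ?.
rewrite (teval_map (L := bfun (mA B) _)); last by lin.
rewrite teval_exch; apply: eq_teval => ? ?.
rewrite (teval_map (L := bfun (mA B) _)); last by lin.
by apply: eq_teval => ? ?; rewrite !mAE shE.
Qed.
End Cocycle.

(** * The coquasi-bialgebroid axioms *)

Section Bialgebroid.

Let tr := ext3_tril Om.

Lemma boxB1 b : box b (hone H) 1 = lB b J1. Proof. exact: boxJl. Qed.
Lemma box1B b : box 1 (hone H) b = lbB b J1. Proof. exact: boxJr. Qed.

Lemma bhb_is_coquasi_bialgebroid : is_coquasi_bialgebroid (bhb act gam gamV).
Proof.
have lbl : linear (fun b => lB b J1) by lin.
have lbr : linear (fun b => lbB b J1) by lin.
split.
- exact: mu_bil.
- exact: mu1l.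
- exact: mu1r.
- by move=> a b c /=; rewrite !boxB1; apply: lbl.
- by [].
- by move=> b c; rewrite [LHS]boxB1 [csrc _ b]boxB1 [csrc _ c]boxB1 [RHS]mu_lB mu1l lBM.
- by move=> a b c /=; rewrite !box1B; apply: lbr.
- by [].
- by move=> b c; rewrite [LHS]box1B [ctgt _ b]box1B [ctgt _ c]box1B [RHS]mu_lbB mu1l lbBM.
- by move=> b c; rewrite [csrc _ b]boxB1 [ctgt _ c]box1B [LHS]mu_lB [RHS]mu_lbB !mu1l lB_lbB.
- by move=> b X; rewrite [csrc _ b]boxB1 [RHS]mu_lB mu1l.
- by move=> b X; rewrite [ctgt _ b]box1B [RHS]mu_lbB mu1l.
- by move=> b X; rewrite [csrc _ b]boxB1; apply: rB_mu.
- by move=> b X; rewrite [ctgt _ b]box1B; apply: rbB_mu.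
- exact: bhb_is_coalgebroid.
- exact: mu_comul.
- have bd := dia_bilin.
  by rewrite [LHS]bhb_comul_box comul_hone teval_tens; last by lin.
- by rewrite -[LHS]/(epsM J1) epsM_box counit_hone scale1r mulr1.
- exact: eps_src.
- exact: eps_tgt.
- by rewrite [cPhi _]bhb_Phi_ext; apply: ext3_hom.
(* Extension is multiplicative, and the counit of a triple product is the extension of the
   convolution unit. *)
- exists (ext3 OmV); split=> [|X Y Z|X Y Z]; first exact: ext3_hom.
  + by rewrite [cPhi _]bhb_Phi_ext [LHS]conv3_ext OmOmV [RHS]eps_mu3.
  + by rewrite [cPhi _]bhb_Phi_ext [LHS]conv3_ext OmVOm [RHS]eps_mu3.
- by move=> X Y; rewrite [cPhi _]bhb_Phi_ext; apply: ext3_Om1.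
- by move=> X Y; rewrite [cPhi _]bhb_Phi_ext; apply: ext3_Om2.
- by move=> X Y; rewrite [cPhi _]bhb_Phi_ext; apply: ext3_Om3.
- by move=> X Y Z b; rewrite [cPhi _]bhb_Phi_ext; apply: ext3_Om_right.
- by move=> X Y Z W; rewrite [cPhi _]bhb_Phi_ext; apply: Phi_cocycle.
- by move=> X Y Z; rewrite [cPhi _]bhb_Phi_ext; apply: mu_Phi_assoc.
Qed.

End Bialgebroid.

Section Legs.

Notation sw4 X F := (\sw[DC, 4]_(X1 X2 X3 X4 <- X) F X1 X2 X3 X4).
Notation sw5 X F := (\sw[DC, 5]_(X1 X2 X3 X4 X5 <- X) F X1 X2 X3 X4 X5).

Lemma eq_sw4 (V : lmodType k) (F G : M -> M -> M -> M -> V) X :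
  (forall X1 X2 X3 X4, F X1 X2 X3 X4 = G X1 X2 X3 X4) -> sw4 X F = sw4 X G.
Proof. by move=> e; do 3 (apply: eq_dia_eval => ? ?). Qed.
Lemma lin_sw4F (U V : lmodType k) (F : U -> M -> M -> M -> M -> V) X :
  (forall X1 X2 X3 X4, linear (fun u => F u X1 X2 X3 X4)) -> linear (fun u => sw4 X (F u)).
Proof. by move=> e; do 3 (apply: lin_dia_evalF => ? ?). Qed.
Lemma sw4_map (U V : lmodType k) (L : U -> V) (F : M -> M -> M -> M -> U) X : linear L ->
  L (sw4 X F) = sw4 X (fun X1 X2 X3 X4 => L (F X1 X2 X3 X4)).
Proof.
move=> lL; rewrite [LHS](dia_eval_map (L := L)) //; apply: eq_dia_eval => X1 X'.
exact: (sw3_map (F X1) X' lL).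
Qed.
Lemma eq_sw5 (V : lmodType k) (F G : M -> M -> M -> M -> M -> V) X :
  (forall X1 X2 X3 X4 X5, F X1 X2 X3 X4 X5 = G X1 X2 X3 X4 X5) -> sw5 X F = sw5 X G.
Proof. by move=> e; do 4 (apply: eq_dia_eval => ? ?). Qed.
Lemma lin_sw5F (U V : lmodType k) (F : U -> M -> M -> M -> M -> M -> V) X :
  (forall X1 X2 X3 X4 X5, linear (fun u => F u X1 X2 X3 X4 X5)) -> linear (fun u => sw5 X (F u)).
Proof. by move=> e; do 4 (apply: lin_dia_evalF => ? ?). Qed.
Lemma sw5_map (U V : lmodType k) (L : U -> V) (F : M -> M -> M -> M -> M -> U) X : linear L ->
  L (sw5 X F) = sw5 X (fun X1 X2 X3 X4 X5 => L (F X1 X2 X3 X4 X5)).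
Proof.
move=> lL; rewrite [LHS](dia_eval_map (L := L)) //; apply: eq_dia_eval => X1 X'.
exact: (sw4_map (F X1) X' lL).
Qed.

Section FourLegs.
Variables (V : lmodType k) (F : M -> M -> M -> M -> V).
Hypothesis gF : good4 F.
Let gs := good4_sw gF.
Let gF3 X1 : good3 (F X1). Proof. by case: gF. Qed.

Lemma sw4_lB d X : sw4 (lB d X) F = sw4 X (fun X1 X2 X3 X4 => F (lB d X1) X2 X3 X4).
Proof. exact: (sw_lB gs d X). Qed.
Lemma sw4_rB d X : sw4 (rB d X) F = sw4 X (fun X1 X2 X3 X4 => F (rB d X1) X2 X3 X4).
Proof. exact: (sw_rB gs d X). Qed.
Lemma sw4_lbB d X : sw4 (lbB d X) F = sw4 X (fun X1 X2 X3 X4 => F X1 X2 X3 (lbB d X4)).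
Proof.
rewrite [LHS](sw_lbB gs d X); apply: eq_dia_eval => X1 X'.
exact: (sw3_lbB (gF3 X1) d X').
Qed.
Lemma sw4_rbB d X : sw4 (rbB d X) F = sw4 X (fun X1 X2 X3 X4 => F X1 X2 X3 (rbB d X4)).
Proof.
rewrite [LHS](sw_rbB gs d X); apply: eq_dia_eval => X1 X'.
exact: (sw3_rbB (gF3 X1) d X').
Qed.
Lemma sw4_tk12 d X : sw4 X (fun X1 X2 X3 X4 => F (rbB d X1) X2 X3 X4)
  = sw4 X (fun X1 X2 X3 X4 => F X1 (rB d X2) X3 X4).
Proof.
rewrite [LHS](sw_tk d X gs); apply: eq_dia_eval => X1 X'.
exact: (sw3_rB (gF3 X1) d X').
Qed.
Lemma sw4_tk23 d X : sw4 X (fun X1 X2 X3 X4 => F X1 (rbB d X2) X3 X4)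
  = sw4 X (fun X1 X2 X3 X4 => F X1 X2 (rB d X3) X4).
Proof. by apply: eq_dia_eval => X1 X'; apply: (sw3_tk12 (gF3 X1)). Qed.
Lemma sw4_tk34 d X : sw4 X (fun X1 X2 X3 X4 => F X1 X2 (rbB d X3) X4)
  = sw4 X (fun X1 X2 X3 X4 => F X1 X2 X3 (rB d X4)).
Proof. by apply: eq_dia_eval => X1 X'; apply: (sw3_tk23 (gF3 X1)). Qed.
End FourLegs.

Section FiveLegs.
Variables (V : lmodType k) (F : M -> M -> M -> M -> M -> V).
Hypothesis gF : good5 F.
Let gs := good5_sw gF.
Let gF4 X1 : good4 (F X1). Proof. by case: gF. Qed.

Lemma sw5_lB d X : sw5 (lB d X) F = sw5 X (fun X1 X2 X3 X4 X5 => F (lB d X1) X2 X3 X4 X5).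
Proof. exact: (sw_lB gs d X). Qed.
Lemma sw5_rB d X : sw5 (rB d X) F = sw5 X (fun X1 X2 X3 X4 X5 => F (rB d X1) X2 X3 X4 X5).
Proof. exact: (sw_rB gs d X). Qed.
Lemma sw5_lbB d X : sw5 (lbB d X) F = sw5 X (fun X1 X2 X3 X4 X5 => F X1 X2 X3 X4 (lbB d X5)).
Proof.
rewrite [LHS](sw_lbB gs d X); apply: eq_dia_eval => X1 X'.
exact: (sw4_lbB (gF4 X1) d X').
Qed.
Lemma sw5_rbB d X : sw5 (rbB d X) F = sw5 X (fun X1 X2 X3 X4 X5 => F X1 X2 X3 X4 (rbB d X5)).
Proof.
rewrite [LHS](sw_rbB gs d X); apply: eq_dia_eval => X1 X'.
exact: (sw4_rbB (gF4 X1) d X').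
Qed.
Lemma sw5_tk12 d X : sw5 X (fun X1 X2 X3 X4 X5 => F (rbB d X1) X2 X3 X4 X5)
  = sw5 X (fun X1 X2 X3 X4 X5 => F X1 (rB d X2) X3 X4 X5).
Proof.
rewrite [LHS](sw_tk d X gs); apply: eq_dia_eval => X1 X'.
exact: (sw4_rB (gF4 X1) d X').
Qed.
Lemma sw5_tk23 d X : sw5 X (fun X1 X2 X3 X4 X5 => F X1 (rbB d X2) X3 X4 X5)
  = sw5 X (fun X1 X2 X3 X4 X5 => F X1 X2 (rB d X3) X4 X5).
Proof. by apply: eq_dia_eval => X1 X'; apply: (sw4_tk12 (gF4 X1)). Qed.
Lemma sw5_tk34 d X : sw5 X (fun X1 X2 X3 X4 X5 => F X1 X2 (rbB d X3) X4 X5)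
  = sw5 X (fun X1 X2 X3 X4 X5 => F X1 X2 X3 (rB d X4) X5).
Proof. by apply: eq_dia_eval => X1 X'; apply: (sw4_tk23 (gF4 X1)). Qed.
Lemma sw5_tk45 d X : sw5 X (fun X1 X2 X3 X4 X5 => F X1 X2 X3 (rbB d X4) X5)
  = sw5 X (fun X1 X2 X3 X4 X5 => F X1 X2 X3 X4 (rB d X5)).
Proof. by apply: eq_dia_eval => X1 X'; apply: (sw4_tk34 (gF4 X1)). Qed.
End FiveLegs.

(** On generators the ordinary action contributes [A2 d] before [F], the opposite one after it.
    Commutation with [A2 d] is thus what the last condition in C^2 amounts to. *)
Lemma ext2_right F d X Y : F ** A2 d = A2 d ** F -> ext2 F X (rB d Y) = ext2 F X (rbB d Y).
Proof.
move=> cF; have bl := ext2_bil F.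
move: X Y; apply: (hom2V_eq (opl := mulB) (opr := mulBr)).
- split=> [|a X Y|a X Y|e X Y|e X Y]; first by lin.
  + by rewrite ext2_lB.
  + by rewrite ext2_lbB.
  + by rewrite ext2_rB rB_lB.
  + by rewrite ext2_rbB rB_lbB.
- split=> [|a X Y|a X Y|e X Y|e X Y]; first by lin.
  + by rewrite ext2_lB.
  + by rewrite ext2_lbB.
  + by rewrite ext2_rB rbB_lB.
  + by rewrite ext2_rbB rbB_lbB.
move=> h g; transitivity ((A2 d ** F) (tens h g)).
  rewrite -[rB d _]/((bilr rB d \c J) g) rBJ cvE (teval_map (L := ext2 F (J h))); last by lin.
  rewrite (cv_tens2' (C := H) (D := H)); apply: eq_teval => g1 g2.
  rewrite -ext2_rB -[rB _ _]/((bilr rB (A d g1) \c J) h) rBJ cvE.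
  rewrite (teval_map (L := fun X => ext2 F X (J g2))); last by lin.
  by apply: eq_teval => h1 h2; rewrite ext2_lB ext2_J shE.
rewrite -cF -[rbB d _]/((bilr rbB d \c J) g) rbBJ [(J <| A d) g]cvE.
rewrite (teval_map (L := ext2 F (J h))); last by lin.
rewrite (cv_tens2' (C := H) (D := H)); apply: eq_teval => g1 g2.
rewrite -[lbS _ _]/(lbB _ _) -ext2_rbB -[rbB _ _]/((bilr rbB (A d g2) \c J) h) rbBJ cvE.
rewrite (teval_map (L := fun X => ext2 F X (J g1))); last by lin.
by apply: eq_teval => h1 h2; rewrite -[lbS _ _]/(lbB _ _) ext2_lbB ext2_J shE.
Qed.

Lemma Gam_ext : Gam act gam = ext2 ga.
Proof.
have gb := gam_bil.
apply/funext => X; apply/funext => Y; move: X Y; apply: box_eq2 => [||a h a' b g b'].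
- by rewrite /Gam /box_eval; lin.
- exact: ext2_bil.
- by rewrite ext2E; apply: GamE.
Qed.

Lemma ext2_ga1 X : ext2 ga J1 X = eps X.
Proof.
have bl := ext2_bil ga.
move: X; apply: M_eq => [||b g b']; [by lin|by lin|].
rewrite -ext2_rB rB_J1 ext2_lB -ext2_rbB rbB_J1 ext2_lbB epsM_lB epsM_lbB; congr (_ * (_ * _)).
by rewrite ext2_J -[LHS]/((ga \c u1 H H) g) ga_u1 -eps_J.
Qed.
Lemma ext2_gar X : ext2 ga X J1 = eps X.
Proof.
have bl := ext2_bil ga.
move: X; apply: M_eq => [||b g b']; [by lin|by lin|].
rewrite ext2_lB ext2_lbB epsM_lB epsM_lbB; congr (_ * (_ * _)).
by rewrite ext2_J -[LHS]/((ga \c ur H H) g) ga_ur -eps_J.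
Qed.

End Legs.

(** * Trivial phi and a 2-cocycle gamma *)

Section Associative.
Hypotheses (phi_triv : forall h g f : H, phi h g f = counit H h * counit H g * counit H f)
  (gam_cocycle : two_cocycle act gam).

Lemma phB1 : phB = cm1.
Proof. by apply: lhom3_eq => h g f; rewrite phBE phi_triv cm1_3. Qed.

Lemma cocycle_g : g23 ** g1_23 = g12 ** g12_3.
Proof.
apply: lhom3_eq => h g f; have := gam_cocycle h g f; unsw => e.
rewrite cv_tens3 cv_p12l; etransitivity; [|etransitivity; [exact: e|]].
  by do 3 (apply: eq_teval => ? ?); rewrite mAE shE !lgamE hcompE tmE mulcE lgamE.
by do 2 (apply: eq_teval => ? ?); rewrite mAE hcompE m12E !lgamE.
Qed.

Lemma Om1 : Om = cm1.
Proof. by rewrite /Om phB1 cvm1r cocycle_g (cvmK _ g12_3K) ?g12K -?cvmA ?g12_3K ?cvm1r ?g12K. Qed.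

(** The cocycle identity rearranged so that [g1_23] and [g12_3V] stand together: at h1 (x) S(h2) (x)
    h3 both collapse, which computes the other side there. *)
Lemma cocycle_gV : g23V ** g12 = g1_23 ** g12_3V.
Proof.
rewrite -[LHS](cvm1r) -g12_3K cvmA -(cvmA _ g12) -cocycle_g (cvmA g23V).
by rewrite g23VK cvm1l.
Qed.

Lemma cocycle_gV' : g12V ** g23 = g12_3 ** g1_23V.
Proof.
rewrite -[LHS](cvm1r) -g1_23K cvmA -(cvmA _ g23) cocycle_g (cvmA g12V).
by rewrite g12VK cvm1l.
Qed.

Lemma bhb_left_bialgebroid : is_left_bialgebroid (bhb act gam gamV).
Proof.
split=> [|X Y Z]; first exact: bhb_is_coquasi_bialgebroid.
by rewrite [cPhi _]bhb_Phi_ext Om1 [RHS]eps_mu3.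
Qed.

Lemma mu_assoc X Y Z : bmul (bmul X Y) Z = bmul X (bmul Y Z).
Proof.
move: X Y Z; apply: (hom3V_eq (opl := lB) (opr := lbB)).
- split=> [|a X Y Z|a X Y Z|d X Y Z|d X Y Z|d X Y Z|d X Y Z]; first by lin.
  + by rewrite !mu_lB.
  + by rewrite !mu_lbB.
  + by rewrite mu_rB.
  + by rewrite mu_rbB.
  + by rewrite mu_rB2 mu_rB.
  + by rewrite mu_rbB2 mu_rbB.
- split=> [|a X Y Z|a X Y Z|d X Y Z|d X Y Z|d X Y Z|d X Y Z]; first by lin.
  + by rewrite mu_lB.
  + by rewrite mu_lbB.
  + by rewrite mu_rB mu_lB.
  + by rewrite mu_rbB mu_lbB.
  + by rewrite mu_rB.
  + by rewrite mu_rbB.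
move=> h g f; rewrite mu_assoc_l mu_assoc_r.
by have := Om_assoc; rewrite Om1 cvl1 cvr1 => ->.
Qed.

Lemma sh_pl a : sh (A a \c pl H H) = A2 a \c p12 H H.
Proof.
apply: lhom3_eq => h g f; rewrite shE hcompE plE hlinZ [RHS]hcompE p12E hlinZ shE.
by rewrite (linZ _ _ (f := act h)); last by lin.
Qed.

Lemma muK_1l a : muK 1 a = K <| (A a \c pl H H).
Proof. by rewrite /muK actl1 cm1_pull cvl1. Qed.
Lemma muK_1r a : muK a 1 = (A a \c pl H H) |> K.
Proof. by rewrite /muK actl1 cm1_pull cvr1. Qed.

Lemma K_ga : K <| ga = ga |> (J \c mulc H).
Proof. by rewrite cvlr cvrA gaVga cvr1. Qed.
Lemma gaV_K : gaV |> K = (J \c mulc H) <| gaV.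
Proof. by rewrite cvlA gaVga cvl1. Qed.

(** * The Galois maps *)

Section LeftHopf.
Variable S : lhom H H.
Hypothesis S_comul : forall h,
  comul H (S h) = teval (fun x y => tens (S y) (S x)) (comul H h).
Hypothesis S_r : forall h,
  teval (fun x y => hmul x (S y)) (comul H h) = (counit H h : k) *: hone H.
Hypothesis S_l : forall h,
  teval (fun x y => hmul (S x) y) (comul H h) = (counit H h : k) *: hone H.
Local Notation idS := (idS S).
Local Notation Sid := (Sid S).
Local Notation idSid := (idSid S).

(** In Sweedler form [ev] is gamma(h1, S h2), [fv] is gamma^-1(S h1, h2), and [fa a] is gamma^-1(S
    h2, h3) (S h1 |> a), the coefficient produced when S cancels a generator in front of a
    scalar. *)
Definition ev := ga \c idS.
Definition fv := gaV \c Sid.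
Definition fa a : lhom H B := (gaV ** (A a \c pl H H)) \c Sid.

Lemma g12_A2 a : g12 ** (A2 a \c p12 H H) = (A2 a \c p12 H H) ** g12.
Proof. by rewrite /g12 -!cvm_pull ga_A2. Qed.

Lemma p12_m12 a : A2 a \c p12 H H = (A a \c pl H H) \c m12 H H.
Proof.
apply: lhom3_eq => h g f; rewrite hcompE p12E hlinZ shE [RHS]hcompE m12E hcompE plE hlinZ.
by rewrite !actlE (act_hmul modalg).
Qed.

Lemma ga_r1 h : ga (tens h one) = counit H h *: 1.
Proof. by rewrite -[LHS]/((ga \c ur H H) h) ga_ur. Qed.
Lemma ga_l1 h : ga (tens one h) = counit H h *: 1.
Proof. by rewrite -[LHS]/((ga \c u1 H H) h) ga_u1. Qed.
Lemma gaV_r1 h : gaV (tens h one) = counit H h *: 1.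
Proof. by rewrite -[LHS]/((gaV \c ur H H) h) gaV_ur. Qed.
Lemma gaV_l1 h : gaV (tens one h) = counit H h *: 1.
Proof. by rewrite -[LHS]/((gaV \c u1 H H) h) gaV_u1. Qed.

Lemma pl_u1 a : (A a \c pl H H) \c u1 H H = ccst H a.
Proof.
by apply: lhom_eq => h; rewrite hcompE u1E hcompE plE hlinZ actlE (act1l modalg).
Qed.
Lemma gaV_pl1 a h : (gaV ** (A a \c pl H H)) (tens one h) = counit H h *: a.
Proof.
rewrite -[LHS]/(((gaV ** (A a \c pl H H)) \c u1 H H) h) cvm_pull gaV_u1 cvm1l pl_u1 //.
Qed.
Lemma pl_ga1 a h : ((A a \c pl H H) ** ga) (tens one h) = counit H h *: a.
Proof.
rewrite -[LHS]/((((A a \c pl H H) ** ga) \c u1 H H) h) cvm_pull ga_u1 cvm1r pl_u1 //.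
Qed.

Lemma counit_dup (a : B) h :
  teval (fun x y => (counit H x *: (1 : B)) * (counit H y *: a)) (comul H h) = counit H h *: a.
Proof.
rewrite -[RHS](counit_l (F := fun h => counit H h *: a)); last by lin.
by apply: eq_teval => x y; rewrite -scalerAl mul1r.
Qed.

(** The sum is h |> (gamma^-1(g, f) (g |> a)) times gamma(h, g), evaluated at h1 (x) S(h2) (x) h3.
    The scalar a commutes to the outside by associative type, and [cocycle_gV] collapses the
    rest. *)
Lemma fa_ev a h : teval (fun h1 h' => teval (fun m h3 => act h1 (fa a h3) * ev m)
   (comul H h')) (comul H h) = counit H h *: a.
Proof.
transitivity ((sh (gaV ** (A a \c pl H H)) ** g12) (idSid h)).
  rewrite (cv_idSid_p12 S_comul); do 2 (apply: eq_teval => ? ?).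
  by rewrite shE.
rewrite shM sh_pl -cvmA -g12_A2 cvmA cocycle_gV -cvmA p12_m12.
rewrite -cvm_pull (cv_idSid_mul S_comul S_r S_l) -[RHS]counit_dup.
by apply: eq_teval => x y; rewrite ga_r1 gaV_pl1.
Qed.

Lemma g23V_g12_idSid h : (g23V ** g12) (idSid h) = counit H h *: 1.
Proof.
rewrite cocycle_gV (cv_idSid_mul S_comul S_r S_l) -[RHS]counit_dup.
by apply: eq_teval => x y; rewrite ga_r1 gaV_l1.
Qed.

(** Left multiplication of [Z] by gamma^-1(S z2, z3) J(S z1), which plays the part of an antipode of
    the generator J(z). *)
Definition anti_act z Z := teval (fun z1 z2 => lB (fv z2) (bmul (J (S z1)) Z)) (comul H z).

Fact nm_bil : bilin anti_act. Proof. by rewrite /anti_act; lin. Qed.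
Let anti_act_bil' := nm_bil.

Lemma mu_J_lB h c Y Z : bmul (J h) (lB c (bmul Y Z)) = bmul (bmul (J h) (lB c Y)) Z.
Proof. by rewrite mu_assoc mu_lB. Qed.
Lemma mu_J_lbB h c Y Z : bmul (J h) (lbB c (bmul Y Z)) = bmul (bmul (J h) (lbB c Y)) Z.
Proof. by rewrite mu_assoc mu_lbB. Qed.

(** One of two inverse relations between [anti_act] and multiplication by generators. The leading
    gamma^-1 cancels the gamma of the product ([gaV_K]), and then S(z1) z2 reduces to a counit. *)
Lemma nm_mu a z Y :
  teval (fun z1 z2 => anti_act z1 (lbB a (bmul (J z2) Y))) (comul H z) = lbB (fa a z) Y.
Proof.
transitivity (bmul ((gaV |> muK 1 a) (Sid z)) Y); last first.
  rewrite muK_1l -cvlr gaV_K cvrA (cv_Sid_mul S_comul S_l).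
  by rewrite -[lbS _ _]/(lbB _ _) mu_lbB mu1l.
rewrite (cv_Sid S_comul) (teval_map (L := fun X => bmul X Y)); last by lin.
rewrite -(coassoc (F := fun x y z2 => lB (fv y) (bmul (J (S x)) (lbB a (bmul (J z2) Y)))));
  last by lin.
apply: eq_teval => x z'; rewrite (teval_map (L := fun X => bmul X Y)); last by lin.
apply: eq_teval => y z2; rewrite mu_lB; congr (lB _ _).
by rewrite mu_J_lbB -boxJr mu_box.
Qed.
Lemma lB_K_idSid h :
  cv lB g23V ((K <| ga) \c p12 H H) (idSid h) = (counit H h : k) *: J1.
Proof.
rewrite K_ga cv_pull cvlA (cv_idSid_p12 S_comul).
transitivity (lB ((g23V ** g12) (idSid h)) J1); last first.
  by rewrite g23V_g12_idSid (linZ _ _ (f := fun b => lB b J1)) ?lB1; last by lin.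
rewrite idSidE (teval_map (L := fun t => lB ((g23V ** g12) t) J1)); last by lin.
apply: eq_teval => h1 h'.
rewrite -[RHS](counit_l (F := fun h3 => lB ((g23V ** g12) (tens h1 (Sid h3))) J1)); last by lin.
apply: eq_teval => m h3; rewrite hcompE (mul_idS S_r) hlinZ.
by rewrite (linZ _ _ (f := lB _)); last by lin.
Qed.

Lemma mu_JlB h c W :
  bmul (J h) (lB c W) = teval (fun a b => lB (act a c) (bmul (J b) W)) (comul H h).
Proof.
rewrite -mu_rB -[rB c _]/((bilr rB c \c J) h) rBJ cvE.
rewrite (teval_map (L := fun X => bmul X W)); last by lin.
by apply: eq_teval => a b; rewrite mu_lB.
Qed.

(** The other inverse relation. Carrying gamma^-1 past J(h1) lets h1 act on it and gives [g23V]; the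
    product h S(h) collapses, and what is left of gamma is [g23V] times [g12], a counit by the
    cocycle identity. *)
Lemma qm_nm h Z : teval (fun x z => teval (fun y1 y2 =>
    lbB (ev y2) (bmul (J y1) (anti_act z Z))) (comul H x)) (comul H h) = (counit H h : k) *: Z.
Proof.
transitivity (bmul (cv lB g23V ((K <| ga) \c p12 H H) (idSid h)) Z); last first.
  by rewrite lB_K_idSid (linZ _ _ (f := fun X => bmul X Z)) ?mu1l; last by lin.
rewrite (cv_idSid_p12 S_comul) (teval_map (L := fun X => bmul X Z)); last by lin.
transitivity (teval (fun x z => teval (fun y1 y2 => teval (fun z1 z2 =>
    lbB (ev y2) (bmul (J y1) (lB (fv z2) (bmul (J (S z1)) Z)))) (comul H z)) (comul H x)) (comul H h)).
  do 2 (apply: eq_teval => ? ?); 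
  by rewrite /anti_act (teval_map (L := fun X => lbB _ (bmul _ X))); last by lin.
rewrite (coassoc4 (P := fun y1 y2 z1 z2 => lbB (ev y2) (bmul (J y1) (lB (fv z2) (bmul (J (S z1)) Z)))));
  [|by move=> *; lin|by move=> *; lin].
(* The common summand of both sides, a and b being the legs created when [fv] crosses the first
   generator. All that follows is rebracketing. *)
pose Q a b y2 z1 z2 := lbB (ev y2) (lB (act a (fv z2)) (bmul (K (tens b (S z1))) Z)).
transitivity (teval (fun y1 h' => teval (fun a b => teval (fun m z2 => teval (fun y2 z1 =>
   Q a b y2 z1 z2) (comul H m)) (comul H h')) (comul H y1)) (comul H h)).
  apply: eq_teval => y1 h'; symmetry; rewrite teval_exch; apply: eq_teval => m z2.
  rewrite teval_exch; apply: eq_teval => y2 z1; rewrite mu_JlB (teval_map (L := lbB _));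
    last by lin.
  by apply: eq_teval => a b; rewrite -mu_assoc mu_J.
rewrite -(coassoc (F := fun a b h' => teval (fun m z2 => teval (fun y2 z1 =>
   Q a b y2 z1 z2) (comul H m)) (comul H h'))); last by rewrite /Q; lin.
apply: eq_teval => a t; rewrite coassoc; last by rewrite /Q; lin.
rewrite (teval_map (L := fun X => bmul X Z)); last by lin.
apply: eq_teval => n z2; rewrite shE (cv_idS S_comul).
rewrite (teval_map (L := fun X => bmul (lB _ X) Z)); last by lin.
apply: eq_teval => b m; rewrite (teval_map (L := fun X => bmul (lB _ X) Z)); last by lin.
apply: eq_teval => y2 z1; rewrite /Q mu_lB -[lbS _ _]/(lbB _ _) mu_lbB lB_lbB //.
Qed.
Local Notation D := (bhb act gam gamV).
Local Notation bt := (btens (rbact D0) (lbact D0)).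
Fact bt_bil : bilin bt. Proof. exact: btens_bilin. Qed.
Let btb := bt_bil.
Fact bt_bal b X Y : bt (rbB b X) Y = bt X (lbB b Y). Proof. exact: btens_bal. Qed.
Let diab := dia_bilin.

Lemma lambda_good2 Y : good2 (fun X1 X2 => dia D0 X1 (bmul X2 Y)).
Proof.
have [_ bal] := good2_dia.
by split=> [|d X1 X2]; [lin | rewrite mu_lB bal].
Qed.

Lemma lambda_bilin : bilin (fun X Y => sw X (fun X1 X2 => dia D0 X1 (bmul X2 Y))).
Proof.
by split=> [X|Y]; [apply: lin_dia_evalF => X1 X2; lin | apply: swL2_lin (lambda_good2 Y)].
Qed.

Lemma lambda_btens X Y :
  lambda (D := D) (bt X Y) = sw X (fun X1 X2 => dia D0 X1 (bmul X2 Y)).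
Proof.
apply: (beval_btens _ _ lambda_bilin) => b X' Y'.
rewrite [LHS](sw_rbB (lambda_good2 Y')); apply: eq_dia_eval => X1 X2.
by rewrite mu_rbB.
Qed.

Lemma lambda_lin : linear (lambda (D := D)).
Proof.
apply: (beval_lin lambda_bilin) => b X Y.
rewrite [LHS](sw_rbB (lambda_good2 Y)); apply: eq_dia_eval => X1 X2.
by rewrite mu_rbB.
Qed.

Definition lam_inv X Y := box_eval (fun a h a' =>
  teval (fun x z => bt (lB a ((J <| ev) x)) (anti_act z (lB a' Y))) (comul H h)) X.

Lemma lam_invE a h a' Y : lam_inv (box a h a') Y =
  teval (fun x z => bt (lB a ((J <| ev) x)) (anti_act z (lB a' Y))) (comul H h).
Proof. by rewrite /lam_inv box_evalE; last by lin. Qed.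

Lemma lam_inv_good2 : good2 lam_inv.
Proof.
have lbl : bilin lam_inv by rewrite /lam_inv /box_eval; lin.
split=> // b X Y; move: X; apply: box_eq => [||a h a']; [by lin|by lin|].
by rewrite lbB_box !lam_invE; apply: eq_teval => x z; rewrite lBM.
Qed.

(** Moving the scalar to the right across J(p) lets the second leg of p act on it; the tail of the
    sum is then [fa_ev]. *)
Lemma fa_J a h : teval (fun x z => rbB (fa a z) ((J <| ev) x)) (comul H h) = lbB a (J h).
Proof.
transitivity (teval (fun x z => teval (fun p1 y => teval (fun p2 q =>
   lbB (act p2 (fa a z) * ev q) (J p1)) (comul H y)) (comul H x)) (comul H h)).
  apply: eq_teval => x z; rewrite coassoc; last by lin.
  rewrite cvE (teval_map (L := rbB _)); last by lin.
  apply: eq_teval => p q; rewrite -[lbS _ _]/(lbB _ _) rbB_lbB.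
  rewrite -[rbB _ (J p)]/((bilr rbB (fa a z) \c J) p) rbBJ cvE (teval_map (L := lbB _));
    last by lin.
  by apply: eq_teval => p1 p2; rewrite -[lbS _ _]/(lbB _ _) -lbBM.
rewrite -(coassoc (F := fun p1 y z => teval (fun p2 q =>
   lbB (act p2 (fa a z) * ev q) (J p1)) (comul H y))); last by lin.
rewrite -[RHS](counit_r (F := fun p => lbB a (J p))); last by lin.
apply: eq_teval => p1 t.
rewrite -(coassoc (F := fun p2 q z => lbB (act p2 (fa a z) * ev q) (J p1))); last by lin.
transitivity (lbB (counit H t *: a) (J p1)); last first.
  by rewrite (linZ _ _ (f := fun b => lbB b (J p1))); last by lin.
rewrite -fa_ev (teval_map (L := fun b => lbB b (J p1))); last by lin.
apply: eq_teval => p2 t'; rewrite (teval_map (L := fun b => lbB b (J p1))) //; by lin.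
Qed.

Lemma lambdaK : cancel (lambda (D := D)) (dia_eval lam_inv).
Proof.
have gl := lam_inv_good2; have [bl bal] := gl.
apply: (btens_eq (G := fun t => t)) => [||X Y];
  [exact: (lin_comp (dia_eval_lin gl) lambda_lin) | by lin |].
rewrite lambda_btens (dia_eval_map (L := dia_eval lam_inv)); last exact: dia_eval_lin.
transitivity (sw X (fun X1 X2 => lam_inv X1 (bmul X2 Y))).
  by apply: eq_dia_eval => X1 X2; apply: dia_evalE.
have g2 : good2 (fun X1 X2 => lam_inv X1 (bmul X2 Y)).
  by split=> [|d X1 X2]; [lin | rewrite mu_lB bal].
move: X; apply: box_eq => [||a h a']; [exact: swL2_lin | by lin |].
rewrite swL2E // boxJ.
transitivity (teval (fun x h' => teval (fun z h2 =>
    bt (lB a ((J <| ev) x)) (anti_act z (lbB a' (bmul (J h2) Y)))) (comul H h')) (comul H h)).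
  rewrite coassoc; last by lin.
  by apply: eq_teval => h1 h2; rewrite lam_invE lB1 boxJr mu_lbB.
transitivity (bt (lB a (teval (fun x z => rbB (fa a' z) ((J <| ev) x)) (comul H h))) Y); last first.
  by rewrite fa_J.
rewrite (teval_map (L := fun X => bt (lB a X) Y)); last by lin.
apply: eq_teval => x h'; rewrite -rbB_lB bt_bal -nm_mu (teval_map (L := bt _)) //; by lin.
Qed.

Lemma lam_invK : cancel (dia_eval lam_inv) (lambda (D := D)).
Proof.
have gl := lam_inv_good2; have [bl bal] := gl; have ll := lambda_lin.
apply: (btens_eq (G := fun t => t)) => [||X Y]; [exact: (lin_comp ll (dia_eval_lin gl)) | by lin |].
rewrite -[btens _ _ X Y]/(dia D0 X Y) dia_evalE //.
move: X; apply: box_eq => [||a h a']; [by apply: (lin_comp ll); lin | by lin |].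
rewrite lam_invE (teval_map (L := lambda (D := D))) //.
transitivity (teval (fun x z => teval (fun p0 x' => dia D0 (lB a (J p0))
   (teval (fun p1 q => lbB (ev q) (bmul (J p1) (anti_act z (lB a' Y)))) (comul H x')))
   (comul H x)) (comul H h)).
  apply: eq_teval => x z; rewrite lambda_btens.
  have lS := swL2_lin (lambda_good2 (anti_act z (lB a' Y))).
  transitivity (teval (fun p0 x' => teval (fun p1 q => dia D0 (lB a (J p0))
     (lbB (ev q) (bmul (J p1) (anti_act z (lB a' Y))))) (comul H x')) (comul H x)); last first.
    by apply: eq_teval => p0 x'; rewrite (teval_map (L := dia D0 _)); last by lin.
  rewrite coassoc; last by lin.
  rewrite cvE (teval_map (L := fun X => sw (lB a X) _)); last by apply: (lin_comp lS); lin.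
  apply: eq_teval => p q; rewrite -[lbS _ _]/(lbB _ _) -boxJ swL2E; last exact: lambda_good2.
  by apply: eq_teval => p0 p1; rewrite boxJl boxJr mu_lbB.
rewrite -(coassoc (F := fun p0 x' z => dia D0 (lB a (J p0))
   (teval (fun p1 q => lbB (ev q) (bmul (J p1) (anti_act z (lB a' Y)))) (comul H x'))));
     last by lin.
rewrite boxJ lB_lbB [RHS](dia_bal).
rewrite -[RHS](counit_r (F := fun h => dia D0 (lB a (J h)) (lB a' Y))); last by lin.
apply: eq_teval => p0 h'.
transitivity (dia D0 (lB a (J p0)) ((counit H h' : k) *: lB a' Y)); last first.
  by rewrite (linZ _ _ (f := dia D0 _)); last by lin.
by rewrite -qm_nm [RHS](teval_map (L := dia D0 _)); last by lin.
Qed.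

Lemma lambda_bij : bijective (lambda (D := D)).
Proof. exact: Bijective lambdaK lam_invK. Qed.
End LeftHopf.

Section AntiLeftHopf.
Variable T : lhom H H.
Hypothesis T_comul : forall h,
  comul H (T h) = teval (fun x y => tens (T y) (T x)) (comul H h).
Hypothesis T_r : forall h,
  teval (fun x y => hmul y (T x)) (comul H h) = (counit H h : k) *: hone H.
Hypothesis T_l : forall h,
  teval (fun x y => hmul (T y) x) (comul H h) = (counit H h : k) *: hone H.
Local Notation idT := (idT T).
Local Notation Tid := (Tid T).
Local Notation idTid := (idTid T).

Definition fT := gaV \c idT.
Definition eT := ga \c Tid.
Definition ea a : lhom H B := ((A a \c pl H H) ** ga) \c Tid.

Lemma g12V_A2 a : g12V ** (A2 a \c p12 H H) = (A2 a \c p12 H H) ** g12V.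
Proof. by rewrite /g12V -!cvm_pull gaV_A2. Qed.

Lemma counit_dupr (a : B) h :
  teval (fun x y => (counit H x *: a) * (counit H y *: (1 : B))) (comul H h) = counit H h *: a.
Proof.
rewrite -[RHS](counit_l (F := fun h => counit H h *: a)); last by lin.
by apply: eq_teval => x y; rewrite -scalerAr mulr1 !scalerA mulrC.
Qed.

Lemma ea_fT a h : teval (fun h1 h' => teval (fun m h3 => fT m * act h3 (ea a h1))
   (comul H h')) (comul H h) = counit H h *: a.
Proof.
transitivity ((g12V ** sh ((A a \c pl H H) ** ga)) (idTid h)).
  rewrite (cv_idTid_p12 T_comul); do 2 (apply: eq_teval => ? ?).
  by rewrite shE.
rewrite shM sh_pl cvmA g12V_A2 -cvmA cocycle_gV' cvmA p12_m12.
rewrite -cvm_pull (cv_idTid_mul T_comul T_r T_l) -[RHS]counit_dupr.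
by apply: eq_teval => x y; rewrite gaV_r1 pl_ga1.
Qed.

Lemma g12V_g23_idTid h : (g12V ** g23) (idTid h) = counit H h *: 1.
Proof.
rewrite cocycle_gV' (cv_idTid_mul T_comul T_r T_l) -[RHS]counit_dup.
by apply: eq_teval => x y; rewrite gaV_r1 ga_l1.
Qed.

Definition anti_actT z Z := teval (fun z1 z2 => lbB (eT z1) (bmul (J (T z2)) Z)) (comul H z).

Fact nmT_bil : bilin anti_actT. Proof. by rewrite /anti_actT; lin. Qed.
Let anti_actT_bil' := nmT_bil.

Lemma nmT_mu a z Y :
  teval (fun z1 z2 => anti_actT z2 (lB a (bmul (J z1) Y))) (comul H z) = lB (ea a z) Y.
Proof.
transitivity (bmul ((muK a 1 <| ga) (Tid z)) Y); last first.
  by rewrite muK_1r cvlr K_ga cvlA (cv_Tid_mul T_comul T_l) mu_lB mu1l.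
rewrite (cv_Tid T_comul) (teval_map (L := fun X => bmul X Y)); last by lin.
apply: eq_teval => z1 z2; rewrite (teval_map (L := fun X => bmul X Y)); last by lin.
apply: eq_teval => m z3; rewrite -[lbS _ _]/(lbB _ _) mu_lbB; congr (lbB _ _).
by rewrite mu_J_lB -boxJl mu_box.
Qed.

Lemma lbB_K_idTid h :
  cv lbS ((gaV |> K) \c p12 H H) g23 (idTid h) = (counit H h : k) *: J1.
Proof.
rewrite gaV_K cv_pull cvrA (cv_idTid_p12 T_comul).
transitivity (lbB ((g12V ** g23) (idTid h)) J1); last first.
  by rewrite g12V_g23_idTid (linZ _ _ (f := fun b => lbB b J1)) ?lbB1; last by lin.
rewrite idTidE (teval_map (L := fun t => lbB ((g12V ** g23) t) J1)); last by lin.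
apply: eq_teval => h1 h'.
rewrite -[RHS](counit_l (F := fun h3 => lbB ((g12V ** g23) (tens h3 (Tid h1))) J1)); last by lin.
apply: eq_teval => m h3; rewrite hcompE (mul_idT T_r) hlinZ -[lbS _ _]/(lbB _ _).
by rewrite (linZ _ _ (f := lbB _)); last by lin.
Qed.

Lemma mu_JlbB h c W :
  bmul (J h) (lbB c W) = teval (fun a b => lbB (act b c) (bmul (J a) W)) (comul H h).
Proof.
rewrite -mu_rbB -[rbB c _]/((bilr rbB c \c J) h) rbBJ cvE.
rewrite (teval_map (L := fun X => bmul X W)); last by lin.
by apply: eq_teval => a b; rewrite -[lbS _ _]/(lbB _ _) mu_lbB.
Qed.

Lemma qm_nmT h Z : teval (fun z x => teval (fun y1 y2 =>
    lB (fT y1) (bmul (J y2) (anti_actT z Z))) (comul H x)) (comul H h) = (counit H h : k) *: Z.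
Proof.
transitivity (bmul (cv lbS ((gaV |> K) \c p12 H H) g23 (idTid h)) Z); last first.
  by rewrite lbB_K_idTid (linZ _ _ (f := fun X => bmul X Z)) ?mu1l; last by lin.
rewrite (cv_idTid_p12 T_comul) (teval_map (L := fun X => bmul X Z)); last by lin.
pose Q a b y1 z1 z2 := lB (fT y1) (lbB (act b (eT z1)) (bmul (K (tens a (T z2))) Z)).
transitivity (teval (fun z x => teval (fun z1 z2 => teval (fun y1 y2 =>
    teval (fun a b => Q a b y1 z1 z2) (comul H y2)) (comul H x)) (comul H z)) (comul H h)).
  apply: eq_teval => z x; symmetry; rewrite teval_exch; apply: eq_teval => y1 y2.
  rewrite /anti_actT (teval_map (L := fun X => lB _ (bmul _ X))); last by lin.
  apply: eq_teval => z1 z2; rewrite mu_JlbB (teval_map (L := lB _)); last by lin.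
  by apply: eq_teval => a b; rewrite -mu_assoc mu_J.
rewrite (coassoc4 (P := fun z1 z2 y1 y2 => teval (fun a b => Q a b y1 z1 z2) (comul H y2)));
  [|by rewrite /Q => *; lin|by rewrite /Q => *; lin].
apply: eq_teval => z1 h'; rewrite (teval_map (L := fun X => bmul X Z)); last by lin.
transitivity (teval (fun m' y2 => teval (fun a b => teval (fun z2 y1 => Q a b y1 z1 z2)
  (comul H m')) (comul H y2)) (comul H h')).
  by apply: eq_teval => m' y2; rewrite teval_exch.
rewrite coassoc; last by rewrite /Q; lin.
apply: eq_teval => m b; rewrite -(coassoc (F := fun z2 y1 a => Q a b y1 z1 z2));
  last by rewrite /Q; lin.
rewrite shE (cv_idT T_comul) -[lbS _ _]/(lbB _ _).
rewrite (teval_map (L := fun X => bmul (lbB _ X) Z)); last by lin.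
apply: eq_teval => z2 p; rewrite (teval_map (L := fun X => bmul (lbB _ X) Z)); last by lin.
by apply: eq_teval => y1 a; rewrite /Q mu_lbB mu_lB lB_lbB.
Qed.

Local Notation D := (bhb act gam gamV).
Local Notation bt := (btens (ract D0) (lact D0)).
Local Notation rho := (Defs.mu (D := D)).
Fact btr_bil : bilin bt. Proof. exact: btens_bilin. Qed.
Let btb := btr_bil.
Fact btr_bal b X Y : bt (rB b X) Y = bt X (lB b Y). Proof. exact: btens_bal. Qed.
Let diab := dia_bilin.

Lemma rho_good2 Y : good2 (fun X1 X2 => dia D0 (bmul X1 Y) X2).
Proof.
have [_ bal] := good2_dia.
by split=> [|d X1 X2]; [lin | rewrite mu_lbB bal].
Qed.

Lemma rho_bilin : bilin (fun X Y => sw X (fun X1 X2 => dia D0 (bmul X1 Y) X2)).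
Proof.
by split=> [X|Y]; [apply: lin_dia_evalF => X1 X2; lin | apply: swL2_lin (rho_good2 Y)].
Qed.

Lemma rho_btens X Y : rho (bt X Y) = sw X (fun X1 X2 => dia D0 (bmul X1 Y) X2).
Proof.
apply: (beval_btens _ _ rho_bilin) => b X' Y'.
rewrite [LHS](sw_rB (rho_good2 Y')); apply: eq_dia_eval => X1 X2.
by rewrite mu_rB.
Qed.

Lemma rho_lin : linear rho.
Proof.
apply: (beval_lin rho_bilin) => b X Y.
rewrite [LHS](sw_rB (rho_good2 Y)); apply: eq_dia_eval => X1 X2.
by rewrite mu_rB.
Qed.

Definition rho_inv X Y := box_eval (fun a h a' =>
  teval (fun z x => bt (lbB a' ((fT |> J) x)) (anti_actT z (lbB a X))) (comul H h)) Y.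

Lemma rho_invE X a h a' : rho_inv X (box a h a') =
  teval (fun z x => bt (lbB a' ((fT |> J) x)) (anti_actT z (lbB a X))) (comul H h).
Proof. by rewrite /rho_inv box_evalE; last by lin. Qed.

Lemma rho_inv_good2 : good2 rho_inv.
Proof.
have lbl : bilin rho_inv by rewrite /rho_inv /box_eval; lin.
split=> // b X Y; move: Y; apply: box_eq => [||a h a']; [by lin|by lin|].
by rewrite lB_box !rho_invE; apply: eq_teval => x z; rewrite lbBM.
Qed.

Lemma ea_J a h : teval (fun z x => rB (ea a z) ((fT |> J) x)) (comul H h) = lB a (J h).
Proof.
transitivity (teval (fun z x => teval (fun y q2 => teval (fun p q1 =>
   lB (fT p * act q1 (ea a z)) (J q2)) (comul H y)) (comul H x)) (comul H h)).
  apply: eq_teval => z x; rewrite -(coassoc (F := fun p q1 q2 =>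
    lB (fT p * act q1 (ea a z)) (J q2)));
    last by lin.
  rewrite cvE (teval_map (L := rB _)); last by lin.
  apply: eq_teval => p q; rewrite rB_lB.
  rewrite -[rB _ (J q)]/((bilr rB (ea a z) \c J) q) rBJ cvE (teval_map (L := lB _)); last by lin.
  by apply: eq_teval => q1 q2; rewrite -lBM.
rewrite coassoc; last by lin.
rewrite -[RHS](counit_l (F := fun p => lB a (J p))); last by lin.
apply: eq_teval => t q2.
transitivity (lB (counit H t *: a) (J q2)); last first.
  by rewrite (linZ _ _ (f := fun b => lB b (J q2))); last by lin.
rewrite -ea_fT (teval_map (L := fun b => lB b (J q2))); last by lin.
apply: eq_teval => z y; rewrite (teval_map (L := fun b => lB b (J q2))) //; by lin.
Qed.

Lemma rhoK : cancel rho (dia_eval rho_inv).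
Proof.
have gl := rho_inv_good2; have [bl bal] := gl.
apply: (btens_eq (G := fun t => t)) => [||X Y];
  [exact: (lin_comp (dia_eval_lin gl) rho_lin) | by lin |].
rewrite rho_btens (dia_eval_map (L := dia_eval rho_inv)); last exact: dia_eval_lin.
transitivity (sw X (fun X1 X2 => rho_inv (bmul X1 Y) X2)).
  by apply: eq_dia_eval => X1 X2; apply: dia_evalE.
have g2 : good2 (fun X1 X2 => rho_inv (bmul X1 Y) X2).
  by split=> [|d X1 X2]; [lin | rewrite mu_lbB bal].
move: X; apply: box_eq => [||a h a']; [exact: swL2_lin | by lin |].
rewrite swL2E // boxJ lB_lbB.
transitivity (teval (fun t x => teval (fun h1 z =>
    bt (lbB a' ((fT |> J) x)) (anti_actT z (lB a (bmul (J h1) Y)))) (comul H t)) (comul H h)).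
  rewrite -(coassoc (F := fun h1 z x => bt (lbB a' ((fT |> J) x)) (anti_actT z (lB a (bmul (J h1) Y)))));
    last by lin.
  by apply: eq_teval => h1 h2; rewrite rho_invE lbB1 boxJl mu_lB.
transitivity (bt (lbB a' (teval (fun z x => rB (ea a z) ((fT |> J) x)) (comul H h))) Y); last first.
  by rewrite ea_J.
rewrite (teval_map (L := fun X => bt (lbB a' X) Y)); last by lin.
apply: eq_teval => t x; rewrite -rB_lbB btr_bal -nmT_mu (teval_map (L := bt _)) //; by lin.
Qed.

Lemma rho_invK : cancel (dia_eval rho_inv) rho.
Proof.
have gl := rho_inv_good2; have [bl bal] := gl; have ll := rho_lin.
apply: (btens_eq (G := fun t => t)) => [||X Y]; [exact: (lin_comp ll (dia_eval_lin gl)) | by lin |].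
rewrite -[btens _ _ X Y]/(dia D0 X Y) dia_evalE //.
move: Y; apply: box_eq => [||a h a']; [by apply: (lin_comp ll); lin | by lin |].
rewrite rho_invE (teval_map (L := rho)) //.
transitivity (teval (fun z x => teval (fun x' q1 => dia D0
   (teval (fun p q0 => lB (fT p) (bmul (J q0) (anti_actT z (lbB a X)))) (comul H x')) (lbB a' (J q1)))
   (comul H x)) (comul H h)).
  apply: eq_teval => z x; rewrite rho_btens.
  have lS := swL2_lin (rho_good2 (anti_actT z (lbB a X))).
  transitivity (teval (fun x' q1 => teval (fun p q0 => dia D0
     (lB (fT p) (bmul (J q0) (anti_actT z (lbB a X)))) (lbB a' (J q1))) (comul H x')) (comul H x)); last first.
    by apply: eq_teval => x' q1; rewrite (teval_map (L := fun X => dia D0 X _)); last by lin.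
  rewrite -(coassoc (F := fun p q0 q1 => dia D0
     (lB (fT p) (bmul (J q0) (anti_actT z (lbB a X)))) (lbB a' (J q1)))); last by lin.
  rewrite cvE (teval_map (L := fun X => sw (lbB a' X) _)); last by apply: (lin_comp lS); lin.
  apply: eq_teval => p q; rewrite -lB_lbB -boxJ swL2E; last exact: rho_good2.
  by apply: eq_teval => q0 q1; rewrite boxJl boxJr mu_lB.
rewrite coassoc; last by lin.
rewrite boxJ -[RHS](dia_bal).
rewrite -[RHS](counit_l (F := fun h => dia D0 (lbB a X) (lbB a' (J h)))); last by lin.
apply: eq_teval => h' q1.
transitivity (dia D0 ((counit H h' : k) *: lbB a X) (lbB a' (J q1))); last first.
  by rewrite (linZ _ _ (f := fun X => dia D0 X _)); last by lin.
by rewrite -qm_nmT [RHS](teval_map (L := fun X => dia D0 X _)); last by lin.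
Qed.

Lemma rho_bij : bijective rho.
Proof. exact: Bijective rhoK rho_invK. Qed.
End AntiLeftHopf.

End Associative.

End Deformation.

Local Notation A2 b := (sh (A b)).
Local Notation e2 := (@eps2 k H B).

Lemma eps2_bilin : bilin e2.
Proof. by rewrite /eps2; have ? := @hmul_bilin _ H; lin. Qed.
Lemma lgam_eps2 (p : bilin e2) : lgam p = cm1.
Proof. by apply: lhom2_eq => h g; rewrite lgamE cm1_2 /eps2 counit_hmul. Qed.
Lemma hconv2_lgam (f g : H -> H -> B) (fb : bilin f) (gb : bilin g) h x :
  hconv2 f g h x = (lgam fb ** lgam gb) (tens h x).
Proof. by rewrite cv_tens; unsw; do 2 (apply: eq_teval => ? ?); rewrite !lgamE. Qed.
Lemma eps2_inv : is_hconv_inverse2 e2 e2.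
Proof.
have e h g : hconv2 e2 e2 h g = e2 h g.
  rewrite (hconv2_lgam eps2_bilin eps2_bilin) !lgam_eps2 cvm1l cm1_2 /eps2 counit_hmul //.
by split=> //; exact: eps2_bilin.
Qed.
Lemma eps2_unital : unital2 e2.
Proof. by move=> h; rewrite /eps2 hmul1l hmul1r. Qed.
Lemma eps2_assoc : associative_type act e2.
Proof.
move=> h g b; unsw.
transitivity ((cm1 ** A2 b) (tens h g)).
  rewrite cv_tens; do 2 (apply: eq_teval => ? ?).
  by rewrite mAE shE actlE (act_hmul modalg) cm1_2 /eps2 counit_hmul.
rewrite cvm1l -[A2 b]cvm1r cv_tens; do 2 (apply: eq_teval => ? ?).
by rewrite mAE shE actlE (act_hmul modalg) cm1_2 /eps2 counit_hmul.
Qed.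

Local Notation e2b := eps2_bilin.
Local Notation e2i := eps2_inv.
Local Notation e2a := eps2_assoc.
Local Notation mu0 := (bmul e2 e2).
Local Notation mu0_lB := (mu_lB e2b e2i).
Local Notation mu0_lbB := (mu_lbB e2b e2i).
Local Notation mu0_rB := (mu_rB e2b e2i).
Local Notation mu0_rbB := (mu_rbB e2b e2i).
Local Notation mu0_rB2 := (mu_rB2 e2b e2i e2a).
Local Notation mu0_rbB2 := (mu_rbB2 e2b e2i e2a).
Lemma mu0_bil : bilin mu0. Proof. exact: (mu_bil e2b e2i). Qed.
Lemma mu0_J h g : mu0 (J h) (J g) = J (hmul h g).
Proof. by rewrite (mu_J e2b e2i) !lgam_eps2 cvl1 cvr1 hcompE mulcE. Qed.
Lemma bhb0_Phi_ext : cPhi (bhb0 act) = ext3 phB.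
Proof.
rewrite [LHS](bhb_Phi_ext e2b e2i) /Om; congr (ext3 _).
rewrite /g23 /g1_23 /g12_3V /g12V !lgam_eps2 !cm1_pull sh1 !cvm1l !cvm1r //.
Qed.

Lemma eps_mu0 X Y : eps (mu0 X Y) = ext2 cm1 X Y.
Proof. exact: (eps_mu e2b e2i). Qed.

(** * The twist by Gamma *)

Section Twist.
Variables gam gamV : H -> H -> B.
Hypotheses (gam_bil : bilin gam) (gam_unital : unital2 gam)
  (gam_inv : is_hconv_inverse2 gam gamV) (gam_assoc : associative_type act gam).
Local Notation gagaV := (gagaV gam_bil gam_inv).
Local Notation gaVga := (gaVga gam_bil gam_inv).
Local Notation ga_A2 := (ga_A2 gam_bil gam_assoc).
Local Notation gaV_A2 := (gaV_A2 gam_bil gam_inv gam_assoc).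
Local Notation mu_bil := (mu_bil gam_bil gam_inv).
Local Notation mu_J := (mu_J gam_bil gam_inv).
Local Notation mu_lB := (mu_lB gam_bil gam_inv).
Local Notation mu_lbB := (mu_lbB gam_bil gam_inv).
Local Notation mu_rB := (mu_rB gam_bil gam_inv).
Local Notation mu_rbB := (mu_rbB gam_bil gam_inv).
Local Notation g23 := (g23 gam_bil).
Local Notation g1_23 := (g1_23 gam_bil).
Local Notation g12_3V := (g12_3V gam_inv).
Local Notation g12V := (g12V gam_inv).
Local Notation Om := (Om gam_bil gam_inv).
Local Notation eps_mu := (eps_mu gam_bil gam_inv).
Local Notation bhb_Phi_ext := (bhb_Phi_ext gam_bil gam_inv).
Local Notation KE := (KE gam_bil gam_inv).
Local Notation Gam_ext := (Gam_ext gam_bil).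
Local Notation ext2_ga1 := (ext2_ga1 gam_bil gam_unital).
Local Notation ext2_gar := (ext2_gar gam_bil gam_unital).
Local Notation gamV_bil := (gamV_bil gam_inv).
Local Notation ga := (lgam gam_bil).
Local Notation gaV := (lgam gamV_bil).
Local Notation K := (ga |> ((J \c mulc H) <| gaV)).
Local Notation bmul := (bmul gam gamV).
Local Notation G := (ext2 ga).
Local Notation GV := (ext2 gaV).
Local Notation P0 := (ext3 phB).

Let mub0 := mu0_bil.
Let Gb := ext2_bil ga.
Let GVb := ext2_bil gaV.
Let P0t := ext3_tril phB.

Lemma G_right X Y d : G X (rB d Y) = G X (rbB d Y).
Proof. by apply: ext2_right; apply: ga_A2. Qed.
Lemma GV_right X Y d : GV X (rB d Y) = GV X (rbB d Y).
Proof. by apply: ext2_right; apply: gaV_A2. Qed.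

Lemma Gam_is_C2 : is_C2 (bhb0 act) (Gam act gam).
Proof.
rewrite Gam_ext; split.
- exact: ext2_hom.
- exact: ext2_ga1.
- exact: ext2_gar.
- exists GV; split=> [|X Y|X Y]; first exact: ext2_hom.
  + by rewrite [LHS]conv2_ext gagaV [RHS]eps_mu0.
  + by rewrite [LHS]conv2_ext gaVga [RHS]eps_mu0.
- by move=> X Y d; rewrite [LHS](esym (G_right X Y d)).
Qed.

Lemma GammaV_ext GammaV : is_conv_inverse2 (bhb0 act) (Gam act gam) GammaV -> GammaV = GV.
Proof.
rewrite Gam_ext => -[hV inv1 _].
have E := is_hom2_ext hV; move: E; set F := lin2 _ => E.
have {}E : GammaV = ext2 F by apply/funext => X; apply/funext => Y.
suff <- : F = gaV by [].
apply: (cvm_invU (x := ga)); last exact: gaVga.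
apply: lhom2_eq => h g; have := inv1 (J h) (J g).
by rewrite E [LHS]conv2_ext [RHS]eps_mu0 !ext2_J.
Qed.

Definition tw_mul X1 X2 X3 Y1 Y2 Y3 : M := lB (G X1 Y1) (lbB (GV X3 Y3) (mu0 X2 Y2)).

Lemma tw_mul_goodX Y1 Y2 Y3 : good3 (fun X1 X2 X3 => tw_mul X1 X2 X3 Y1 Y2 Y3).
Proof.
rewrite /tw_mul; split=> [X1|X2 X3|d X1 X2 X3]; [|by lin|].
- split=> [|d X2 X3]; first by lin.
  by rewrite mu0_lbB -lbBM ext2_lB.
- by rewrite ext2_lbB mu0_lB lBM -lB_lbB.
Qed.
Lemma tw_mul_goodY X : good3 (fun Y1 Y2 Y3 => sw3 X (fun X1 X2 X3 => tw_mul X1 X2 X3 Y1 Y2 Y3)).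
Proof.
have gX := tw_mul_goodX; split=> [Y1|Y2 Y3|d Y1 Y2 Y3].
- split=> [|d Y2 Y3].
    by split=> [Y2|Y3]; apply: lin_sw3F => X1 X2 X3; rewrite /tw_mul; lin.
  transitivity (sw3 X (fun X1 X2 X3 => tw_mul X1 (rbB d X2) X3 Y1 Y2 Y3)).
    by apply: eq_sw3 => X1 X2 X3; rewrite /tw_mul mu0_rbB.
  rewrite (sw3_tk23 (gX _ _ _)); apply: eq_sw3 => X1 X2 X3.
  by rewrite /tw_mul ext2_rB.
- by apply: lin_sw3F => X1 X2 X3; rewrite /tw_mul; lin.
- transitivity (sw3 X (fun X1 X2 X3 => tw_mul (rbB d X1) X2 X3 Y1 Y2 Y3)).
    by apply: eq_sw3 => X1 X2 X3; rewrite /tw_mul ext2_rbB.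
  rewrite (sw3_tk12 (gX _ _ _)); apply: eq_sw3 => X1 X2 X3.
  by rewrite /tw_mul mu0_rB.
Qed.

Lemma twist_mulE X Y : twist_mul (bhb0 act) G GV X Y = bmul X Y.
Proof.
have gX := tw_mul_goodX; have gY := tw_mul_goodY.
have lX Y1 Y2 Y3 := swL3_lin (gX Y1 Y2 Y3); have lY X' := swL3_lin (gY X').
pose f X Y := sw3 Y (fun Y1 Y2 Y3 => sw3 X (fun X1 X2 X3 => tw_mul X1 X2 X3 Y1 Y2 Y3)).
rewrite -[LHS]/(f X Y); move: X Y; apply: (hom2V_eq (opl := lB) (opr := lbB)).
- split=> [|a X Y|a X Y|d X Y|d X Y].
  + by split=> [X|Y]; [exact: lY | apply: lin_sw3F => Y1 Y2 Y3; apply: lX].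
  + rewrite /f sw3_map; last by lin.
    apply: eq_sw3 => Y1 Y2 Y3; rewrite (sw3_lB (gX _ _ _)) sw3_map; last by lin.
    by apply: eq_sw3 => X1 X2 X3; rewrite /tw_mul ext2_lB lBM.
  + rewrite /f sw3_map; last by lin.
    apply: eq_sw3 => Y1 Y2 Y3; rewrite (sw3_lbB (gX _ _ _)) sw3_map; last by lin.
    by apply: eq_sw3 => X1 X2 X3; rewrite /tw_mul ext2_lbB lbBM lB_lbB.
  + rewrite /f (sw3_lB (gY _)); apply: eq_sw3 => Y1 Y2 Y3; rewrite (sw3_rB (gX _ _ _)).
    by apply: eq_sw3 => X1 X2 X3; rewrite /tw_mul ext2_rB.
  + rewrite /f (sw3_lbB (gY _)); apply: eq_sw3 => Y1 Y2 Y3; rewrite (sw3_rbB (gX _ _ _)).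
    by apply: eq_sw3 => X1 X2 X3; rewrite /tw_mul ext2_rbB.
- split=> [|a X Y|a X Y|d X Y|d X Y]; first exact: mu_bil.
  + exact: mu_lB.
  + exact: mu_lbB.
  + exact: mu_rB.
  + exact: mu_rbB.
move=> h g; rewrite mu_J KE /f [LHS](swL3E _ _ _ (gY _)); unsw; symmetry.
pullout 1%N; match_teval; pullout 2%N; match_teval.
rewrite [RHS](swL3E _ _ _ (gX _ _ _)); unsw.
do 2 match_teval.
by rewrite /tw_mul !ext2_J mu0_J.
Qed.

Definition tw_Phi X1 X2 X3 X4 Y1 Y2 Y3 Y4 Y5 Z1 Z2 Z3 Z4 : B :=
  G X1 (lB (G Y1 Z1) (mu0 Y2 Z2)) * P0 X2 Y3 Z3 * GV (lbB (GV X4 Y5) (mu0 X3 Y4)) Z4.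

Lemma tw_Phi_goodX Y1 Y2 Y3 Y4 Y5 Z1 Z2 Z3 Z4 : good4 (fun X1 X2 X3 X4 =>
  tw_Phi X1 X2 X3 X4 Y1 Y2 Y3 Y4 Y5 Z1 Z2 Z3 Z4).
Proof.
rewrite /tw_Phi; split=> [X1|X2 X3 X4|d X1 X2 X3 X4]; [|by lin|].
- split=> [X2|X3 X4|d X2 X3 X4]; [|by lin|].
  + split=> [|d X3 X4]; first by lin.
    by rewrite mu0_lbB -lbBM ext2_lB.
  + by rewrite ext3_lbB mu0_lB -lB_lbB ext2_lB !mulrA.
- by rewrite ext2_lbB ext3_lB !mulrA.
Qed.

Lemma tw_Phi_goodY X Z1 Z2 Z3 Z4 : good5 (fun Y1 Y2 Y3 Y4 Y5 =>
  sw4 X (fun X1 X2 X3 X4 => tw_Phi X1 X2 X3 X4 Y1 Y2 Y3 Y4 Y5 Z1 Z2 Z3 Z4)).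
Proof.
have gX := tw_Phi_goodX.
split=> [Y1|Y2 Y3 Y4 Y5|d Y1 Y2 Y3 Y4 Y5].
- split=> [Y2|Y3 Y4 Y5|d Y2 Y3 Y4 Y5].
  + split=> [Y3|Y4 Y5|d Y3 Y4 Y5].
    * split=> [|d Y4 Y5].
        by split=> [Y4|Y5]; apply: lin_sw4F => X1 X2 X3 X4; rewrite /tw_Phi; lin.
      transitivity (sw4 X (fun X1 X2 X3 X4 =>
          tw_Phi X1 X2 (rbB d X3) X4 Y1 Y2 Y3 Y4 Y5 Z1 Z2 Z3 Z4)).
        by apply: eq_sw4 => X1 X2 X3 X4; rewrite /tw_Phi mu0_rbB.
      rewrite (sw4_tk34 (gX _ _ _ _ _ _ _ _ _)); apply: eq_sw4 => X1 X2 X3 X4.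
      by rewrite /tw_Phi ext2_rB.
    * by apply: lin_sw4F => X1 X2 X3 X4; rewrite /tw_Phi; lin.
    * transitivity (sw4 X (fun X1 X2 X3 X4 =>
          tw_Phi X1 (rbB d X2) X3 X4 Y1 Y2 Y3 Y4 Y5 Z1 Z2 Z3 Z4)).
        by apply: eq_sw4 => X1 X2 X3 X4; rewrite /tw_Phi ext3_rbB1.
      rewrite (sw4_tk23 (gX _ _ _ _ _ _ _ _ _)); apply: eq_sw4 => X1 X2 X3 X4.
      by rewrite /tw_Phi mu0_rB.
  + by apply: lin_sw4F => X1 X2 X3 X4; rewrite /tw_Phi; lin.
  + transitivity (sw4 X (fun X1 X2 X3 X4 =>
        tw_Phi (rbB d X1) X2 X3 X4 Y1 Y2 Y3 Y4 Y5 Z1 Z2 Z3 Z4)).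
      by apply: eq_sw4 => X1 X2 X3 X4; rewrite /tw_Phi mu0_lbB lB_lbB ext2_rbB.
    rewrite (sw4_tk12 (gX _ _ _ _ _ _ _ _ _)); apply: eq_sw4 => X1 X2 X3 X4.
    by rewrite /tw_Phi ext3_rB1.
- by apply: lin_sw4F => X1 X2 X3 X4; rewrite /tw_Phi; lin.
- by apply: eq_sw4 => X1 X2 X3 X4; rewrite /tw_Phi ext2_lbB mu0_lB lBM.
Qed.

Lemma eq_sw54 X Y F F' :
  (forall Y1 Y2 Y3 Y4 Y5 X1 X2 X3 X4, F X1 X2 X3 X4 Y1 Y2 Y3 Y4 Y5
    = F' X1 X2 X3 X4 Y1 Y2 Y3 Y4 Y5 :> B) ->
  sw5 Y (fun Y1 Y2 Y3 Y4 Y5 => sw4 X (fun X1 X2 X3 X4 => F X1 X2 X3 X4 Y1 Y2 Y3 Y4 Y5))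
  = sw5 Y (fun Y1 Y2 Y3 Y4 Y5 => sw4 X (fun X1 X2 X3 X4 => F' X1 X2 X3 X4 Y1 Y2 Y3 Y4 Y5)).
Proof. by move=> e; apply: eq_sw5 => *; apply: eq_sw4 => *. Qed.

Lemma tw_Phi_goodZ X Y : good4 (fun Z1 Z2 Z3 Z4 => sw5 Y (fun Y1 Y2 Y3 Y4 Y5 =>
  sw4 X (fun X1 X2 X3 X4 => tw_Phi X1 X2 X3 X4 Y1 Y2 Y3 Y4 Y5 Z1 Z2 Z3 Z4))).
Proof.
have gY := tw_Phi_goodY.
have L (f : M -> M -> M -> M -> M -> M -> M -> M -> M -> M -> B) :
  (forall X1 X2 X3 X4 Y1 Y2 Y3 Y4 Y5, linear (f X1 X2 X3 X4 Y1 Y2 Y3 Y4 Y5)) ->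
  linear (fun u => sw5 Y (fun Y1 Y2 Y3 Y4 Y5 => sw4 X (fun X1 X2 X3 X4 =>
    f X1 X2 X3 X4 Y1 Y2 Y3 Y4 Y5 u))).
  by move=> lf; apply: lin_sw5F => *; apply: lin_sw4F => *.
split=> [Z1|Z2 Z3 Z4|d Z1 Z2 Z3 Z4].
- split=> [Z2|Z3 Z4|d Z2 Z3 Z4].
  + split=> [|d Z3 Z4].
      by split=> [Z3|Z4]; apply: L => *; rewrite /tw_Phi; lin.
    transitivity (sw5 Y (fun Y1 Y2 Y3 Y4 Y5 => sw4 X (fun X1 X2 X3 X4 =>
        tw_Phi X1 X2 X3 X4 Y1 Y2 (rbB d Y3) Y4 Y5 Z1 Z2 Z3 Z4))).
      by apply: eq_sw54 => *; rewrite /tw_Phi ext3_rbB2.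
    rewrite (sw5_tk34 (gY _ _ _ _ _)); apply: eq_sw54 => *.
    by rewrite /tw_Phi mu0_rB2 -rB_lbB ext2_rB.
  + by apply: L => *; rewrite /tw_Phi; lin.
  + transitivity (sw5 Y (fun Y1 Y2 Y3 Y4 Y5 => sw4 X (fun X1 X2 X3 X4 =>
        tw_Phi X1 X2 X3 X4 Y1 (rbB d Y2) Y3 Y4 Y5 Z1 Z2 Z3 Z4))).
      by apply: eq_sw54 => *; rewrite /tw_Phi mu0_rbB.
    rewrite (sw5_tk23 (gY _ _ _ _ _)); apply: eq_sw54 => *.
    by rewrite /tw_Phi ext3_rB2.
- by apply: L => *; rewrite /tw_Phi; lin.
- transitivity (sw5 Y (fun Y1 Y2 Y3 Y4 Y5 => sw4 X (fun X1 X2 X3 X4 =>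
      tw_Phi X1 X2 X3 X4 (rbB d Y1) Y2 Y3 Y4 Y5 Z1 Z2 Z3 Z4))).
    by apply: eq_sw54 => *; rewrite /tw_Phi ext2_rbB.
  rewrite (sw5_tk12 (gY _ _ _ _ _)); apply: eq_sw54 => *.
  by rewrite /tw_Phi mu0_rB.
Qed.

Definition twP X Y Z := sw4 Z (fun Z1 Z2 Z3 Z4 => sw5 Y (fun Y1 Y2 Y3 Y4 Y5 =>
  sw4 X (fun X1 X2 X3 X4 => tw_Phi X1 X2 X3 X4 Y1 Y2 Y3 Y4 Y5 Z1 Z2 Z3 Z4))).

Lemma twP_hom : hom3V mulB mulBr twP.
Proof.
have gX := tw_Phi_goodX; have gY := tw_Phi_goodY; have gZ := tw_Phi_goodZ.
have lX Y1 Y2 Y3 Y4 Y5 Z1 Z2 Z3 Z4 := swL4_lin (gX Y1 Y2 Y3 Y4 Y5 Z1 Z2 Z3 Z4).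
have lY X Z1 Z2 Z3 Z4 := swL5_lin (gY X Z1 Z2 Z3 Z4).
have lZ X Y := swL4_lin (gZ X Y).
split=> [|a X Y Z|a X Y Z|d X Y Z|d X Y Z|d X Y Z|d X Y Z].
- split=> [X Y|X Z|Y Z]; first exact: lZ.
    by apply: lin_sw4F => *; apply: lY.
  by apply: lin_sw4F => *; apply: lin_sw5F => *; apply: lX.
- have lm : linear (mulB a : B -> B) by rewrite /mulB; lin.
  rewrite /twP sw4_map //; apply: eq_sw4 => Z1 Z2 Z3 Z4; rewrite sw5_map //.
  apply: eq_sw5 => Y1 Y2 Y3 Y4 Y5; rewrite (sw4_lB (gX _ _ _ _ _ _ _ _ _)) sw4_map //.
  by apply: eq_sw4 => *; rewrite /tw_Phi /mulB ext2_lB !mulrA.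
- have lm : linear (mulBr a : B -> B) by rewrite /mulBr; lin.
  rewrite /twP sw4_map //; apply: eq_sw4 => Z1 Z2 Z3 Z4; rewrite sw5_map //.
  apply: eq_sw5 => Y1 Y2 Y3 Y4 Y5; rewrite (sw4_lbB (gX _ _ _ _ _ _ _ _ _)) sw4_map //.
  by apply: eq_sw4 => *; rewrite /tw_Phi /mulBr [GV (lbB a _) _]ext2_lbB lbBM [GV (lbB a _) _]ext2_lbB !mulrA.
- apply: eq_sw4 => Z1 Z2 Z3 Z4; rewrite (sw5_lB (gY _ _ _ _ _)); apply: eq_sw5 => Y1 Y2 Y3 Y4 Y5.
  rewrite (sw4_rB (gX _ _ _ _ _ _ _ _ _)); apply: eq_sw4 => *.
  by rewrite /tw_Phi ext2_rB ext2_lB lBM.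
- apply: eq_sw4 => Z1 Z2 Z3 Z4; rewrite (sw5_lbB (gY _ _ _ _ _)); apply: eq_sw5 => Y1 Y2 Y3 Y4 Y5.
  rewrite (sw4_rbB (gX _ _ _ _ _ _ _ _ _)); apply: eq_sw4 => *.
  by rewrite /tw_Phi ext2_rbB.
- rewrite /twP (sw4_lB (gZ _ _)); apply: eq_sw4 => Z1 Z2 Z3 Z4.
  rewrite (sw5_rB (gY _ _ _ _ _)); apply: eq_sw54 => *.
  by rewrite /tw_Phi ext2_rB.
- rewrite /twP (sw4_lbB (gZ _ _)); apply: eq_sw4 => Z1 Z2 Z3 Z4.
  rewrite (sw5_rbB (gY _ _ _ _ _)).
  transitivity (sw5 Y (fun Y1 Y2 Y3 Y4 Y5 => sw4 X (fun X1 X2 X3 X4 =>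
      tw_Phi X1 X2 X3 X4 Y1 Y2 Y3 Y4 (rB d Y5) Z1 Z2 Z3 Z4))).
    by apply: eq_sw54 => *; rewrite /tw_Phi GV_right.
  rewrite -(sw5_tk45 (gY _ _ _ _ _)); apply: eq_sw54 => *.
  by rewrite /tw_Phi mu0_rbB2 -rbB_lbB ext2_rbB.
Qed.

Lemma G_JlB h c m (R : H -> B) : linear R ->
  teval (fun h1 h' => G (J h1) (lB c (J m)) * R h') (comul H h)
  = teval (fun h1 h' => teval (fun h2 h3 => act h1 c * (ga (tens h2 m) * R h3)) (comul H h')) (comul H h).
Proof.
move=> lR; rewrite coassoc; last by lin.
apply: eq_teval => h' h3; rewrite -ext2_rB -[rB c _]/((bilr rB c \c J) h') rBJ cvE.
rewrite (teval_map (L := fun X => G X (J m) * R h3)); last by lin.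
by apply: eq_teval => h1 h2; rewrite ext2_lB ext2_J mulrA.
Qed.

Lemma tw_Phi_J h g1 g2 g3 g4 g5 f1 f2 f3 f4 :
  teval (fun h1 h' => teval (fun h2 h'' => teval (fun h3 h4 =>
    tw_Phi (J h1) (J h2) (J h3) (J h4) (J g1) (J g2) (J g3) (J g4) (J g5)
      (J f1) (J f2) (J f3) (J f4)) (comul H h'')) (comul H h')) (comul H h)
  = teval (fun h1 h' => teval (fun h2 h'' => teval (fun h3 hh => teval (fun h4 h5 =>
      act h1 (ga (tens g1 f1)) * (ga (tens h2 (hmul g2 f2)) * (phB (tens h3 (tens g3 f3)) *
      (gaV (tens (hmul h4 g4) f4) * gaV (tens h5 g5)))))
      (comul H hh)) (comul H h'')) (comul H h')) (comul H h).
Proof.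
pose R h' := teval (fun h3 hh => teval (fun h4 h5 => phB (tens h3 (tens g3 f3)) *
        (gaV (tens (hmul h4 g4) f4) * gaV (tens h5 g5))) (comul H hh)) (comul H h').
have lR : linear R by rewrite /R; lin.
transitivity (teval (fun h1 h' => G (J h1) (lB (ga (tens g1 f1)) (J (hmul g2 f2))) * R h') (comul H h)).
  apply: eq_teval => h1 h'; rewrite /R [RHS](teval_map (L := fun b => G _ _ * b)); last by lin.
  apply: eq_teval => h2 h''; rewrite [RHS](teval_map (L := fun b => G _ _ * b)); last by lin.
  apply: eq_teval => h3 h4.
  by rewrite /tw_Phi !mu0_J ext3_J !ext2_J ext2_lbB ext2_J !mulrA.
rewrite G_JlB //; do 2 (apply: eq_teval => ? ?); rewrite /R.
rewrite (teval_map (L := fun b => act _ _ * (ga _ * b))); last by lin.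
apply: eq_teval => ? ?; rewrite (teval_map (L := fun b => act _ _ * (ga _ * b))) //; last by lin.
Qed.

Lemma twP_J h g f : twP (J h) (J g) (J f) = Om (tens h (tens g f)).
Proof.
rewrite /twP [LHS](swL4E _ _ _ (tw_Phi_goodZ _ _)).
etransitivity.
  do 3 (apply: eq_teval => ? ?); rewrite [LHS](swL5E _ _ _ (tw_Phi_goodY _ _ _ _ _)).
  do 4 (apply: eq_teval => ? ?); rewrite [LHS](swL4E _ _ _ (tw_Phi_goodX _ _ _ _ _ _ _ _ _)).
  unsw; exact: tw_Phi_J.
cbv beta; rewrite /Om -!cvmA cv_tens3.
pullout 7%N; match_teval; pullout 3%N; match_teval; match_teval.
rewrite cv_tens3; pullout 5%N; match_teval; pullout 2%N; match_teval; match_teval.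
rewrite cv_tens3; pullout 3%N; match_teval; pullout 1%N; match_teval; match_teval.
rewrite cv_p12r; pullout 1%N; match_teval; match_teval.
by rewrite !mAE shE !hcompE tmE mulcE m12E.
Qed.

Lemma twist_PhiE : twist_Phi (bhb0 act) G GV = ext3 Om.
Proof.
apply/funext => X; apply/funext => Y; apply/funext => Z.
rewrite /twist_Phi bhb0_Phi_ext -[LHS]/(twP X Y Z); move: X Y Z.
by apply: (hom3V_eq twP_hom (ext3_hom3V _)) => h g f; rewrite twP_J ext3_J.
Qed.

Lemma bhb_twist GammaV : is_conv_inverse2 (bhb0 act) (Gam act gam) GammaV ->
  bhb act gam gamV = twist (bhb0 act) (Gam act gam) GammaV.
Proof.
move=> /GammaV_ext ->; rewrite Gam_ext /twist twist_PhiE.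
have -> : twist_mul (bhb0 act) G GV = bmul.
  by apply/funext => X; apply/funext => Y; exact: twist_mulE.
by rewrite -bhb_Phi_ext.
Qed.

End Twist.
End BoxBimodule.

(** * Antipodes *)

Section CoquasiHopf.
Variables (k : fieldType) (H : coquasi_hopf k).
Hypothesis phi_triv : forall h g f : H, phi h g f = counit H h * counit H g * counit H f.
Local Notation one := (hone H).

Fact scaleL_bil (V : lmodType k) : bilin (fun (a : k^o) (v : V) => (a : k) *: v).
Proof. by lin. Qed.
Definition scaleL V : bil k^o V V := Bil (@scaleL_bil V).
Fact scaleR_bil (V : lmodType k) : bilin (fun (v : V) (a : k^o) => (a : k) *: v).
Proof. by lin. Qed.
Definition scaleR V : bil V k^o V := Bil (@scaleR_bil V).
Definition hmulB : bil H H H := Bil (hmul_bil H).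
Fact tens_flip_bil : bilin (fun u v : H => tens v u : tc H H). Proof. by lin. Qed.
Definition flipB : bil H H (tc H H) := Bil tens_flip_bil.

Local Notation S0 := (LHom (lin_linear (antipode H)) : lhom H H).
Local Notation al := (LHom (lin_linear (alpha H)) : lhom H k^o).
Local Notation be := (LHom (lin_linear (beta H)) : lhom H k^o).
Local Notation id := (idc H : lhom H H).
Local Notation ep := (cm1 : lhom H k^o).

Lemma phiV_triv h g f : phiV h g f = counit H h * counit H g * counit H f.
Proof.
have e : phB H k^o = cm1 by apply: lhom3_eq => x y z; rewrite phBE phi_triv cm1_3.
have := phBphBV H k^o; rewrite e cvm1l => /(congr1
  (fun F : lhom (tc H (tc H H)) k^o => F (tens h (tens g f)))).
by rewrite phBVE cm1_3 /GRing.scale /= !mulr1.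
Qed.

Lemma epE h : ep h = counit H h. Proof. by rewrite cm1E /GRing.scale /= mulr1. Qed.

Lemma be_al : be ** al = ep.
Proof.
apply: lhom_eq => h; rewrite epE -antipode_phi; unsw.
rewrite -(cvm1l (be ** al)) -(cvm1r al) -(cvm1l (al ** _)); symmetry.
do 4 (rewrite cvE; match_teval).
rewrite !epE !mAE phi_triv counit_antipode; ring.
Qed.

Lemma al_be : al ** be = ep.
Proof.
apply: lhom_eq => h; rewrite epE -antipode_phiV; unsw.
rewrite -(cvm1l (al ** be)) -(cvm1r be) -(cvm1l (be ** _)); symmetry.
do 4 (rewrite cvE; match_teval).
rewrite !epE !mAE phiV_triv !counit_antipode; ring.
Qed.

Definition conjS : lhom H H := cv (scaleL _) be (cv (scaleR _) S0 al).

Lemma sc_cv (C : coalgebra k) V (x y : lhom C k^o) (F : lhom C V) :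
  cv (scaleL V) x (cv (scaleL V) y F) = cv (scaleL V) (x ** y) F.
Proof. by symmetry; apply: cvA => a b v; rewrite /= scalerA. Qed.
Lemma scr_cv (C : coalgebra k) V (x y : lhom C k^o) (F : lhom C V) :
  cv (scaleR V) (cv (scaleR V) F x) y = cv (scaleR V) F (x ** y).
Proof. by apply: cvA => v a b; rewrite /= scalerA mulrC. Qed.
Lemma sc_scr (C : coalgebra k) V (x y : lhom C k^o) (F : lhom C V) :
  cv (scaleR V) (cv (scaleL V) x F) y = cv (scaleL V) x (cv (scaleR V) F y).
Proof. by apply: cvA => a v b; rewrite /= !scalerA mulrC. Qed.
Lemma sc_1 (C : coalgebra k) V (F : lhom C V) : cv (scaleL V) (cm1 : lhom C k^o) F = F.
Proof. by apply: lhom_eq => c; rewrite cv_cstl /= scale1r. Qed.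
Lemma scr_1 (C : coalgebra k) V (F : lhom C V) : cv (scaleR V) F (cm1 : lhom C k^o) = F.
Proof. by apply: lhom_eq => c; rewrite cv_cstr /= scale1r. Qed.

Lemma sc_one (x : lhom H k^o) h : cv (scaleL H) x (ccst H one) h = (x h : k) *: one.
Proof. by rewrite cv_cstr. Qed.

Lemma conjS_l h : teval (fun x y => hmul (conjS x) y) (comul H h) = (counit H h : k) *: one.
Proof.
have e : cv hmulB (cv (scaleR _) S0 al) id = cv (scaleL H) al (ccst H one).
  rewrite (cvA (op3 := hmulB) (op4 := scaleL H)); last first.
    by move=> u a v; rewrite /= (linZ _ _
      (f := fun u => hmul u v)) ?(linZ _ _ (f := hmul u)); try lin.
  apply: lhom_eq => x; rewrite sc_one -antipode_alpha; unsw.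
  rewrite cvE; apply: eq_teval => h1 h'; rewrite cvE (teval_map (L := hmulB (S0 h1))); last by lin.
  by apply: eq_teval => h2 h3; rewrite /= (linZ _ _ (f := hmul _)); last by lin.
rewrite -[LHS]/(cv hmulB conjS id h) /conjS (cvA (op3 := scaleL H) (op4 := hmulB)); last first.
  by move=> a u v; rewrite /= (linZ _ _ (f := fun u => hmul u v)); last by lin.
by rewrite e sc_cv be_al sc_one epE.
Qed.

Lemma conjS_r h : teval (fun x y => hmul x (conjS y)) (comul H h) = (counit H h : k) *: one.
Proof.
have e : cv hmulB id (cv (scaleL _) be S0) = cv (scaleL H) be (ccst H one).
  apply: lhom_eq => x; rewrite sc_one -antipode_beta; unsw.
  rewrite cvE; apply: eq_teval => h1 h'; rewrite cvE (teval_map (L := hmulB (id h1))); last by lin.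
  by apply: eq_teval => h2 h3; rewrite /= (linZ _ _ (f := hmul _)); last by lin.
rewrite -[LHS]/(cv hmulB id conjS h) /conjS -sc_scr -(cvA (op1 := scaleR H) (op2 := hmulB));
  last first.
  by move=> u v a; rewrite /= (linZ _ _ (f := hmul u)); last by lin.
rewrite e sc_scr -[X in cv (scaleL H) be X](_ : cv (scaleL H) al (ccst H one) = _); last first.
  by apply: lhom_eq => x; rewrite cv_cstl sc_one.
by rewrite sc_cv be_al sc_one epE.
Qed.

Definition comulH : lhom H (tc H H) := LHom (lin_linear (comul H)).

Lemma conjS_comul h : comul H (conjS h) = teval (fun x y => tens (conjS y) (conjS x)) (comul H h).
Proof.
have e : comulH \c S0 = cv flipB S0 S0.
  by apply: lhom_eq => x; rewrite [LHS]comul_antipode.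
rewrite -[LHS]/((comulH \c conjS) h) -[RHS]/(cv flipB conjS conjS h); congr (hfun _ h).
rewrite /conjS (lhom_cvr (op' := scaleL _) (g := comulH)); last by move=> a u; rewrite /= linearZ.
rewrite (lhom_cvl (op' := scaleR _) (g := comulH)); last by move=> u a; rewrite /= linearZ.
rewrite e -[in X in _ = cv flipB X _]sc_scr (cvA (op3 := flipB) (op4 := scaleL H)); last first.
  move=> u a v; rewrite /= (linZ _ _ (f := tens v)); last by lin.
  by rewrite (linZ _ _ (f := fun x => tens x u)); last by lin.
rewrite sc_cv al_be sc_1 (cvA (op3 := scaleL _) (op4 := flipB)); last first.
  by move=> a u v; rewrite /= (linZ _ _ (f := tens v)); last by lin.
congr (cv _ _ _); apply: cvA => u v a.
by rewrite /= (linZ _ _ (f := fun x => tens x u)); last by lin.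
Qed.

Lemma counit_conjS h : counit H (conjS h) = counit H h.
Proof.
pose c : lhom H k^o := LHom (lin_linear (counit H)).
rewrite -[LHS]/((c \c conjS) h) /conjS (lhom_cvr (op' := mA k^o) (g := c)); last first.
  by move=> a u; rewrite /= linearZ.
rewrite (lhom_cvl (op' := mA k^o) (g := c)); last by move=> u a; rewrite /= linearZ /= mulrC.
have -> : c \c S0 = ep by apply: lhom_eq => x; rewrite epE [LHS]counit_antipode.
by rewrite -[LHS]/((be ** (ep ** al)) h) cvm1l be_al epE.
Qed.

Section BijectiveAntipode.
Hypothesis S_bij : bijective (antipode H).

Lemma conjS_inv : exists T : lhom H H, cancel conjS T /\ cancel T conjS.
Proof.
case: S_bij => g Sg gS.
have lg : linear g by move=> a u v; rewrite -[u in LHS]gS -[v in LHS]gS -linearP Sg.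
pose G : lhom H H := LHom lg.
pose c : lhom H H := cv (scaleL _) be (cv (scaleR _) id al).
pose c' : lhom H H := cv (scaleL _) al (cv (scaleR _) id be).
have Ec : conjS = S0 \c c.
  rewrite /c (lhom_cvr (op' := scaleL _) (g := S0)); last by move=> a u; rewrite /= linearZ.
  rewrite (lhom_cvl (op' := scaleR _) (g := S0)); last by move=> u a; rewrite /= linearZ.
  by congr (cv _ _ (cv _ _ _)); apply: lhom_eq.
have pull (F : lhom H H) (x y : lhom H k^o) :
    F \c cv (scaleL _) x (cv (scaleR _) id y) = cv (scaleL _) x (cv (scaleR _) F y).
  rewrite (lhom_cvr (op' := scaleL _) (g := F)); last by move=> a u; rewrite /= hlinZ.
  rewrite (lhom_cvl (op' := scaleR _) (g := F)); last by move=> u a; rewrite /= hlinZ.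
  by congr (cv _ _ (cv _ _ _)); apply: lhom_eq.
have cc' : c \c c' = id.
  by rewrite /c' pull /c -sc_scr sc_cv al_be sc_1 scr_cv al_be scr_1.
have c'c : c' \c c = id.
  by rewrite /c pull /c' -sc_scr sc_cv be_al sc_1 scr_cv be_al scr_1.
exists (c' \c G); split=> h.
  by rewrite Ec !hcompE [G _]Sg -[LHS]/((c' \c c) h) c'c.
by rewrite Ec !hcompE -[c (c' _)]/((c \c c') _) cc' [LHS]gS.
Qed.
End BijectiveAntipode.
End CoquasiHopf.

Section InverseAntipode.
Variables (k : fieldType) (H : coquasi_bialgebra k) (S T : lhom H H).
Hypotheses (ST : cancel T S) (TS : cancel S T).
Hypothesis S_comul : forall h,
  comul H (S h) = teval (fun x y => tens (S y) (S x)) (comul H h).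
Hypothesis S_r : forall h,
  teval (fun x y => hmul x (S y)) (comul H h) = (counit H h : k) *: hone H.
Hypothesis S_l : forall h,
  teval (fun x y => hmul (S x) y) (comul H h) = (counit H h : k) *: hone H.
Hypothesis counit_S : forall h, counit H (S h) = counit H h.

Lemma anti_inv_comul h : comul H (T h) = teval (fun x y => tens (T y) (T x)) (comul H h).
Proof.
rewrite -[in RHS](ST h) (teval_S S_comul); last by lin.
by rewrite -[LHS]teval_id; apply: eq_teval => x y; rewrite !TS.
Qed.
Lemma anti_inv_r h : teval (fun x y => hmul y (T x)) (comul H h) = (counit H h : k) *: hone H.
Proof.
rewrite -(ST h) (teval_S S_comul) ?counit_S -?S_l; last by lin.
by apply: eq_teval => x y; rewrite TS.
Qed.
Lemma anti_inv_l h : teval (fun x y => hmul (T y) x) (comul H h) = (counit H h : k) *: hone H.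
Proof.
rewrite -(ST h) (teval_S S_comul) ?counit_S -?S_r; last by lin.
by apply: eq_teval => x y; rewrite TS.
Qed.
End InverseAntipode.

Theorem corollary3p6 (k : fieldType) (H : coquasi_hopf k) (B : algType k)
    (act : H -> B -> B) (gam gamV : H -> H -> B)
    (act_modalg : is_module_algebra act)
    (gam_bilin : bilin gam)
    (gam_unital : unital2 gam)
    (gam_inv : is_hconv_inverse2 gam gamV)
    (gam_assoc : associative_type act gam) :
  let L := bhb0 act in
  let Gamma := Gam act gam in
  [/\ is_coquasi_bialgebroid L,
      is_coquasi_bialgebroid (bhb act gam gamV),
      is_C2 L Gamma
    & forall GammaV, is_conv_inverse2 L Gamma GammaV ->
        bhb act gam gamV = twist L Gamma GammaV]
  /\
  ((forall h g f : H, phi h g f = counit H h * counit H g * counit H f) ->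
   two_cocycle act gam ->
   forall GammaV, is_conv_inverse2 L Gamma GammaV ->
     is_left_hopf_algebroid (twist L Gamma GammaV)
     /\ (bijective (antipode H) ->
         is_anti_left_hopf_algebroid (twist L Gamma GammaV))).
Proof.
move=> L Gamma.
have tw GammaV : is_conv_inverse2 L Gamma GammaV -> bhb act gam gamV = twist L Gamma GammaV.
  exact: (bhb_twist act_modalg gam_bilin gam_inv gam_assoc).
split; first split => //.
- exact: (bhb_is_coquasi_bialgebroid act_modalg (eps2_bilin H B) (eps2_unital B)
    (eps2_inv H B) (eps2_assoc act_modalg)).
- exact: (bhb_is_coquasi_bialgebroid act_modalg gam_bilin gam_unital gam_inv gam_assoc).
- exact: (Gam_is_C2 act_modalg gam_bilin gam_unital gam_inv gam_assoc).
move=> phi_triv gam_cocycle GammaV /tw <-.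
have left_b := bhb_left_bialgebroid act_modalg gam_bilin gam_unital gam_inv gam_assoc
  phi_triv gam_cocycle.
have comulS := conjS_comul phi_triv; have Sr := conjS_r phi_triv; have Sl := conjS_l phi_triv.
split=> [|S_bij]; split=> //.
  exact: (lambda_bij act_modalg gam_bilin gam_unital gam_inv gam_assoc phi_triv gam_cocycle
    comulS Sr Sl).
have [T [TS ST]] := conjS_inv phi_triv S_bij.
have eS := counit_conjS phi_triv.
exact: (rho_bij act_modalg gam_bilin gam_unital gam_inv gam_assoc phi_triv gam_cocycle
  (anti_inv_comul ST TS comulS) (anti_inv_r ST TS comulS Sl eS) (anti_inv_l ST TS comulS Sr eS)).
Qed.
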